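(* Let $A$ be a finite-dimensional algebra over a field $K$, let $\mathbb{T}\simeq (K^\times)^n\subset\operatorname{Aut}(A)$ be a $K$-split torus with character lattice $X=\operatorname{Hom}(\mathbb{T},K^\times)$, so that $A$ is $X$-graded, let $I\subset X$ be a basis of $X$, and let $(A^-,T,A^+)$ be a triangular decomposition of $A$ with respect to $(X,I)$. Let $\mathcal{G}_X(A)$ be the category of finitely generated $X$-graded left $A$-modules, whose simple objects are labeled by $\Lambda=\operatorname{Irr}T\times X$, and let $\preceq$ be the partial order on $\Lambda$ given by $(\mu,v)\prec(\lambda,w)$ if and only if $v\neq w$ and $w-v\in\mathbb{N}I$. Then $(\mathcal{G}_X(A),\preceq)$ is a standardly stratified category.
   Context: **Multigraded triangular decomposition.** $\mathbb{N}I$ is the set of non-negative integer combinations of elements of $I$. A triangular decomposition is a triple $(A^-,T,A^+)$ of $X$-graded subalgebras of $A$ such that: (a) multiplication $A^-\otimes_K T\otimes_K A^+\to A$ is an isomorphism of vector spaces; (b') $\operatorname{Supp}A^+\subset\mathbb{N}I$, $\operatorname{Supp}A^-\subset-\mathbb{N}I$ and $T$ is concentrated in degree $0$; (c) $A^-_0=K=A^+_0$; (d) $A^+T=TA^+$ and $A^-T=TA^-$; (e) $T$ is split over $K$, i.e. $\operatorname{End}_T(\lambda)=K$ for every simple $T$-module $\lambda$. Morphisms in $\mathcal{G}_X(A)$ preserve the $X$-grading. With $B^+=A^+T$ (mapping onto $T$ by killing nonzero degrees), the simple object with label $(\lambda,w)$ is the unique simple quotient of $A\otimes_{B^+}\lambda[w]$,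 where $\lambda[w]$ is $\lambda$ placed in degree $w$; the corresponding standard object is $A\otimes_{B^+}P_T(\lambda)[w]$, with $P_T(\lambda)$ the projective cover of $\lambda$ as a $T$-module. **Standardly stratified category.** Let $\mathcal{C}$ be a $K$-linear finite length abelian category with enough projectives, with all simple objects absolutely simple, with simple objects $L(\lambda)$, $\lambda\in\Lambda$, and projective covers $P(\lambda)$. Let $d:\Lambda\to\Xi$ be a map with finite fibres to an interval-finite poset, and order $\Lambda$ by $\lambda<\mu$ iff $d(\lambda)<d(\mu)$. Let $\mathcal{C}_{\le\xi}$ (resp. $\mathcal{C}_{<\xi}$) be the Serre subcategory generated by the $L(\lambda)$ with $d(\lambda)\le\xi$ (resp. $<\xi$), and $\pi_\xi:\mathcal{C}_{\le\xi}\to\mathcal{C}_\xi=\mathcal{C}_{\le\xi}/\mathcal{C}_{<\xi}$ the quotient functor. Suppose each $\pi_\xi$ has an exact left adjoint $\Delta_\xi$. For $d(\lambda)=\xi$ let $P_\xi(\lambda)$ be the projective cover in $\mathcal{C}_\xi$ of the simple object corresponding to $\lambda$, and $\Delta(\lambda)=\Delta_\xi(P_\xi(\lambda))$. $\mathcal{C}$ is standardly stratified if for each $\lambda$ there is an epimorphism $P(\lambda)\to\Delta(\lambda)$ whose kernel has a finite filtration by objects $\Delta(\mu)$ with $\mu>\lambda$. Here $\Xi=X$ with $v\le w$ iff $w-v\in\mathbb{N}I$, and $d(\lambda,w)=w$. *)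

(* Defs.v *)
From HB Require Import structures.
From mathcomp Require Import all_boot all_order all_algebra all_field.
From mathcomp Require Import boolp classical_sets functions cardinality.

Set Implicit Arguments.
Unset Strict Implicit.
Unset Printing Implicit Defensive.

Import GRing.Theory.
Local Open Scope ring_scope.

Record lincat (K : fieldType) := LinCat {
  obj :> Type;
  hom : obj -> obj -> lmodType K;
  idm : forall x, hom x x;
  comp : forall x y z, hom y z -> hom x y -> hom x z;
  comp1m : forall x y (f : hom x y), comp (idm y) f = f;
  compm1 : forall x y (f : hom x y), comp f (idm x) = f;
  compA : forall x y z t (h : hom z t) (g : hom y z) (f : hom x y),
    comp h (comp g f) = comp (comp h g) f;
  comp_linl : forall x y z (g : hom y z), linear (comp g : hom x y -> hom x z);
  comp_linr : forall x y z (f : hom x y),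
    linear (fun g : hom y z => comp g f)
}.
Arguments idm {K C} x : rename.
Arguments comp {K C x y z} g f : rename.
Notation "g \oc f" := (comp g f) (at level 40, left associativity).

Section Categories.
Context {K : fieldType}.
Implicit Types C D E : lincat K.

Definition is_zero C (z : C) : Prop :=
  (forall x (f : hom x z), f = 0) /\ (forall x (f : hom z x), f = 0).

Definition is_mono C (x y : C) (f : hom x y) : Prop :=
  forall w (g h : hom w x), f \oc g = f \oc h -> g = h.

Definition is_epi C (x y : C) (f : hom x y) : Prop :=
  forall w (g h : hom y w), g \oc f = h \oc f -> g = h.

Definition is_iso C (x y : C) (f : hom x y) : Prop :=
  exists g : hom y x, g \oc f = idm x /\ f \oc g = idm y.

Definition isomorphic C (x y : C) : Prop := exists f : hom x y, is_iso f.

(** [is_kernel k f]: the morphism [k] is a kernel of [f]. *)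
Definition is_kernel C (w x y : C) (k : hom w x) (f : hom x y) : Prop :=
  f \oc k = 0 /\
  forall v (g : hom v x), f \oc g = 0 -> exists! h : hom v w, k \oc h = g.

Definition is_cokernel C (x y z : C) (c : hom y z) (f : hom x y) : Prop :=
  c \oc f = 0 /\
  forall v (g : hom y v), g \oc f = 0 -> exists! h : hom z v, h \oc c = g.

Definition is_biproduct C (x y s : C) (i1 : hom x s) (i2 : hom y s)
    (p1 : hom s x) (p2 : hom s y) : Prop :=
  [/\ p1 \oc i1 = idm x, p2 \oc i2 = idm y, p1 \oc i2 = 0, p2 \oc i1 = 0
    & i1 \oc p1 + i2 \oc p2 = idm s].

Record abelian C : Prop := Abelian {
  ab_zero : exists z : C, is_zero z;
  ab_biprod : forall x y : C, exists (s : C) (i1 : hom x s) (i2 : hom y s)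
    (p1 : hom s x) (p2 : hom s y), is_biproduct i1 i2 p1 p2;
  ab_ker : forall (x y : C) (f : hom x y),
    exists (w : C) (k : hom w x), is_kernel k f;
  ab_coker : forall (x y : C) (f : hom x y),
    exists (z : C) (c : hom y z), is_cokernel c f;
  ab_mono : forall (x y : C) (f : hom x y), is_mono f ->
    exists (z : C) (g : hom y z), is_kernel f g;
  ab_epi : forall (x y : C) (f : hom x y), is_epi f ->
    exists (w : C) (g : hom w x), is_cokernel f g
}.

Definition short_exact C (x y z : C) (f : hom x y) (g : hom y z) : Prop :=
  is_kernel f g /\ is_cokernel g f.

Definition is_simple C (x : C) : Prop :=
  ~ is_zero x /\
  forall w (f : hom w x), is_mono f -> is_zero w \/ is_iso f.

Inductive filtered C (P : C -> Prop) : C -> Prop :=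
| Filtered0 x : is_zero x -> filtered P x
| FilteredS x y z (f : hom x y) (g : hom y z) :
    short_exact f g -> filtered P x -> P z -> filtered P y.

Definition finite_length C : Prop := forall x : C, filtered (@is_simple C) x.

Definition is_projective C (p : C) : Prop :=
  forall (x y : C) (g : hom x y) (f : hom p y), is_epi g ->
    exists h : hom p x, g \oc h = f.

Definition enough_projectives C : Prop :=
  forall x : C, exists (p : C) (g : hom p x), is_projective p /\ is_epi g.

Definition is_proj_cover C (p x : C) (f : hom p x) : Prop :=
  [/\ is_projective p, is_epi f
    & forall w (g : hom w p), is_epi (f \oc g) -> is_epi g].

Definition absolutely_simple C (x : C) : Prop :=
  is_simple x /\ forall f : hom x x, exists c : K, f = c *: idm x.

Definition labels_simples C (Lam : Type) (L : Lam -> C) : Prop :=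
  [/\ forall l, is_simple (L l),
      forall l m, isomorphic (L l) (L m) -> l = m
    & forall x : C, is_simple x -> exists l, isomorphic x (L l)].

Record linfunctor C D := LinFunctor {
  fobj :> C -> D;
  fmap : forall x y, {linear hom x y -> hom (fobj x) (fobj y)};
  fmap1 : forall x, fmap x x (idm x) = idm (fobj x);
  fmapM : forall x y z (g : hom y z) (f : hom x y),
    fmap x z (g \oc f) = fmap y z g \oc fmap x y f
}.

Program Definition fcomp C D E (G : linfunctor D E) (F : linfunctor C D) :
    linfunctor C E :=
  {| fobj x := G (F x);
     fmap x y := (@fmap D E G (F x) (F y) \o @fmap C D F x y)%FUN |}.
Next Obligation. by rewrite /= !fmap1. Qed.
Next Obligation. by rewrite /= !fmapM. Qed.

Definition exact C D (F : linfunctor C D) : Prop :=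
  forall (x y z : C) (f : hom x y) (g : hom y z),
    short_exact f g -> short_exact (fmap F x y f) (fmap F y z g).

Definition is_natural C D (F G : linfunctor C D)
    (a : forall x, hom (F x) (G x)) : Prop :=
  forall x y (f : hom x y), a y \oc fmap F x y f = fmap G x y f \oc a x.

Definition nat_isomorphic C D (F G : linfunctor C D) : Prop :=
  exists a : forall x, hom (F x) (G x),
    is_natural a /\ forall x, is_iso (a x).

(** [is_left_adjoint F G]: [F] is left adjoint to [G], the adjunction being
    given by its unit. *)
Definition is_left_adjoint C D (F : linfunctor D C) (G : linfunctor C D) :
    Prop :=
  exists eta : forall d : D, hom d (G (F d)),
    (forall d d' (f : hom d d'),
       eta d' \oc f = fmap G _ _ (fmap F _ _ f) \oc eta d) /\
    (forall d c (f : hom d (G c)),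
       exists! g : hom (F d) c, fmap G _ _ g \oc eta d = f).

Definition full_subcat C (P : C -> Prop) : lincat K :=
  @LinCat K {x : C | P x} (fun x y => hom (sval x) (sval y))
    (fun x => idm (sval x)) (fun x y z g f => g \oc f)
    (fun x y => @comp1m K C (sval x) (sval y))
    (fun x y => @compm1 K C (sval x) (sval y))
    (fun x y z t => @compA K C (sval x) (sval y) (sval z) (sval t))
    (fun x y z => @comp_linl K C (sval x) (sval y) (sval z))
    (fun x y z => @comp_linr K C (sval x) (sval y) (sval z)).

Definition is_serre C (P : C -> Prop) : Prop :=
  (forall z, is_zero z -> P z) /\
  (forall (x y z : C) (f : hom x y) (g : hom y z),
     short_exact f g -> (P y <-> P x /\ P z)).

Definition serre_gen C (S : C -> Prop) (x : C) : Prop :=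
  forall P : C -> Prop, is_serre P -> (forall y, S y -> P y) -> P x.

(** [pi : C -> D] is the quotient functor of the abelian category [C] by the
    Serre subcategory [S], characterised (up to equivalence) by its universal
    property: for every abelian [E], precomposition with [pi] is an
    equivalence from exact functors [D -> E] to exact functors [C -> E]
    which vanish on [S]. *)
Record is_serre_quotient C D (S : C -> Prop) (pi : linfunctor C D) : Prop :=
SerreQuotient {
  sq_abelian : abelian D;
  sq_exact : exact pi;
  sq_kills : forall x, S x -> is_zero (pi x);
  sq_factor : forall (E : lincat K) (F : linfunctor C E), abelian E ->
    exact F -> (forall x, S x -> is_zero (F x)) ->
    exists G : linfunctor D E, exact G /\ nat_isomorphic (fcomp G pi) F;
  sq_unique : forall (E : lincat K) (G H : linfunctor D E), abelian E ->
    exact G -> exact H ->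
    forall a : (forall x, hom (fcomp G pi x) (fcomp H pi x)),
    is_natural a ->
    exists b : (forall y, hom (G y) (H y)),
      [/\ is_natural b, forall x, b (pi x) = a x
        & forall b' : (forall y, hom (G y) (H y)),
            is_natural b' -> (forall x, b' (pi x) = a x) ->
            forall y, b' y = b y]
}.

End Categories.

Record poset := Poset {
  pcar :> Type;
  ple : pcar -> pcar -> Prop;
  ple_refl : forall x, ple x x;
  ple_anti : forall x y, ple x y -> ple y x -> x = y;
  ple_trans : forall y x z, ple x y -> ple y z -> ple x z
}.

Definition plt (Xi : poset) (x y : Xi) : Prop := ple x y /\ x <> y.

Section Stratified.
Context {K : fieldType} (C : lincat K) (Lam : Type) (L : Lam -> C).
Context (Xi : poset) (d : Lam -> Xi).

Definition strat_le (xi : Xi) : C -> Prop :=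
  serre_gen (fun y => exists l, ple (d l) xi /\ y = L l).

Definition strat_lt (xi : Xi) : C -> Prop :=
  serre_gen (fun y => exists l, plt (d l) xi /\ y = L l).

Lemma label_in_strat (l : Lam) : strat_le (d l) (L l).
Proof.
by move=> P _ hP; apply: hP; exists l; split=> //; apply: ple_refl.
Qed.

Definition label_obj (l : Lam) : full_subcat (strat_le (d l)) :=
  exist _ (L l) (@label_in_strat l).

Record stratum (xi : Xi) := Stratum {
  quo : lincat K;
  quo_fun : linfunctor (full_subcat (strat_le xi)) quo;
  quo_funP : is_serre_quotient
    (fun x : full_subcat (strat_le xi) => strat_lt xi (sval x)) quo_fun;
  std_fun : linfunctor quo (full_subcat (strat_le xi));
  std_adj : is_left_adjoint std_fun quo_fun;
  std_exact : exact std_fun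
}.

Record standardly_stratified : Prop := StandardlyStratified {
  ss_abelian : abelian C;
  ss_length : finite_length C;
  ss_proj : enough_projectives C;
  ss_simples : labels_simples L;
  ss_abs : forall x : C, is_simple x -> absolutely_simple x;
  ss_fibres : forall xi : Xi, finite_set [set l | d l = xi];
  ss_intervals : forall x y : Xi, finite_set [set z | ple x z /\ ple z y];
  ss_std : exists (St : forall xi, stratum xi)
      (P : Lam -> C) (p : forall l, hom (P l) (L l))
      (Q : forall l, quo (St (d l)))
      (q : forall l, hom (Q l) (quo_fun (St (d l)) (label_obj l))),
    let Delta l : C := sval (std_fun (St (d l)) (Q l)) in
    [/\ forall l, is_proj_cover (p l),
        forall l, is_proj_cover (q l)
      & forall l, exists (f : hom (P l) (Delta l)) (k : C) (i : hom k (P l)),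
          [/\ is_epi f, is_kernel i f
            & filtered (fun y => exists m, plt (d l) (d m) /\
                                           isomorphic y (Delta m)) k]]
}.

End Stratified.

Definition is_Zbasis (X : zmodType) n (I : 'I_n -> X) : Prop :=
  bijective (fun c : {ffun 'I_n -> int} => \sum_i I i *~ c i).

Definition cone (X : zmodType) n (I : 'I_n -> X) (x : X) : Prop :=
  exists c : 'I_n -> nat, x = \sum_i I i *+ c i.

Lemma cone_refl (X : zmodType) n (I : 'I_n -> X) x : cone I (x - x).
Proof.
exists (fun=> 0%N); rewrite subrr big1 // => i _; exact: mulr0n.
Qed.

Lemma cone_trans (X : zmodType) n (I : 'I_n -> X) y x z :
  cone I (y - x) -> cone I (z - y) -> cone I (z - x).
Proof.
move=> [c hc] [e he]; exists (fun i => (e i + c i)%N).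
rewrite -(subrK y z) -addrA he hc -big_split /=.
by apply: eq_bigr => i _; rewrite mulrnDr.
Qed.

Lemma cone_anti (X : zmodType) n (I : 'I_n -> X) (hI : is_Zbasis I) x y :
  cone I (y - x) -> cone I (x - y) -> x = y.
Proof.
move=> [c hc] [e he].
have inj := bij_inj hI.
have h : [ffun i => (c i + e i)%:Z] = [ffun=> 0] :> {ffun 'I_n -> int}.
  apply: inj; rewrite [RHS]big1; last by move=> i _; rewrite ffunE mulr0z.
  rewrite (eq_bigr (fun i => I i *+ c i + I i *+ e i)); last first.
    by move=> i _; rewrite ffunE -pmulrn mulrnDr.
  by rewrite big_split /= -hc -he addrA subrK subrr.
suff c0 i : c i = 0%N.
  apply/esym/eqP; rewrite -subr_eq0 hc big1 // => i _.
  by rewrite c0 mulr0n.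
have := congr1 (fun g : {ffun 'I_n -> int} => g i) h.
by rewrite !ffunE => -[] /eqP; rewrite addn_eq0 => /andP[/eqP].
Qed.

Definition cone_poset (X : zmodType) n (I : 'I_n -> X) (hI : is_Zbasis I) :
    poset :=
  @Poset X (fun v w => cone I (w - v))
    (@cone_refl X n I) (cone_anti hI) (@cone_trans X n I).

(** A grading is given by its family of projections: [pr x v] is the
    component of degree [x] of [v]. *)
Definition is_grading (K : fieldType) (X : zmodType) (V : lmodType K)
    (pr : X -> V -> V) : Prop :=
  [/\ forall x, linear (pr x),
      forall x y v, pr x (pr y v) = if x == y then pr y v else 0
    & forall v, exists2 s : seq X, uniq s & v = \sum_(x <- s) pr x v].

Definition homog (X : zmodType) (V : Type) (pr : X -> V -> V) (x : X) (v : V) :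
    Prop := pr x v = v.

Definition is_alg_grading (K : fieldType) (X : zmodType) (A : falgType K)
    (wt : X -> A -> A) : Prop :=
  is_grading wt /\
  forall x y a b, homog wt x a -> homog wt y b -> homog wt (x + y) (a * b).

(** The K-split torus with character lattice [X] is the group scheme [Spec K[X]];
    its R-points are the characters [t] of [X] with values in the units of R.
    An action of it on [A] by algebra automorphisms is a coaction
    [A -> A (x) K[X]], [a |-> sum_x wt x a (x) x], which is the same thing as
    an X-grading of the algebra [A]; an R-point [t] multiplies the summand of
    weight [x] of [A (x) R] by [t x].  The torus is embedded in [Aut A] when no
    non-trivial R-point acts trivially on [A (x) R], for any commutative
    K-algebra R. *)
Definition is_split_torus (K : fieldType) (X : zmodType) (A : falgType K)
    (wt : X -> A -> A) : Prop :=
  is_alg_grading wt /\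
  forall (R : comAlgType K) (t : X -> R),
    t 0 = 1 -> (forall x y, t (x + y) = t x * t y) ->
    (forall x a, homog wt x a -> a <> 0 -> t x = 1) ->
    forall x, t x = 1.

Definition mod_iso (R : pzRingType) (M N : lmodType R) : Prop :=
  exists f : {linear M -> N}, bijective f.

Definition mod_simple (R : pzRingType) (M : lmodType R) : Prop :=
  (exists v : M, v <> 0) /\
  forall P : {pred M}, submod_closed P ->
    (forall v, v \in P -> v = 0) \/ (forall v, v \in P).

Definition mod_irr (R : pzRingType) (Irr : Type) (S : Irr -> lmodType R) :
    Prop :=
  [/\ forall i, mod_simple (S i),
      forall i j, mod_iso (S i) (S j) -> i = j
    & forall M : lmodType R, mod_simple M -> exists i, mod_iso M (S i)].

Definition is_split_alg (K : fieldType) (T : falgType K) : Prop :=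
  forall M : lmodType T, mod_simple M ->
  forall f : {linear M -> M}, exists c : K, forall v, f v = c%:A *: v.

Definition restr (K : fieldType) (A : falgType K) (M : lmodType A) : Type := M.

Section Restr.
Context {K : fieldType} {A : falgType K} (M : lmodType A).

HB.instance Definition _ := GRing.Zmodule.copy (restr M) M.

Definition restr_scale (c : K) (m : restr M) : restr M := (c%:A : A) *: (m : M).

Lemma restr_scaleA a b v :
  restr_scale a (restr_scale b v) = restr_scale (a * b) v.
Proof. by rewrite /restr_scale scalerA -scalerAl mul1r scalerA. Qed.
Lemma restr_scale1 : left_id 1 restr_scale.
Proof. by move=> v; rewrite /restr_scale !scale1r. Qed.
Lemma restr_scaleDr : right_distributive restr_scale +%R.
Proof. by move=> c u v; rewrite /restr_scale scalerDr. Qed.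
Lemma restr_scaleDl v : {morph restr_scale^~ v : a b / a + b}.
Proof. by move=> a b; rewrite /restr_scale !scalerDl. Qed.

HB.instance Definition _ := GRing.Zmodule_isLmodule.Build K (restr M)
  restr_scaleA restr_scale1 restr_scaleDr restr_scaleDl.

End Restr.

Section GradedModules.
Context {K : fieldType} {X : zmodType} {A : falgType K} (wt : X -> A -> A).

Record grmod := GrMod {
  gcar :> lmodType A;
  gpr : X -> gcar -> gcar;
  gprP : is_grading (gpr : X -> restr gcar -> restr gcar);
  gpr_act : forall x y a m,
    homog wt x a -> homog gpr y m -> homog gpr (x + y) (a *: m);
  gfg : exists n (g : 'I_n -> gcar), forall m,
    exists c : 'I_n -> A, m = \sum_i c i *: g i
}.

Definition is_grhom (M N : grmod) (f : M -> N) : Prop :=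
  linear f /\ forall x m, f (gpr x m) = gpr x (f m).

Definition grhom_pred (M N : grmod) : {pred M -> restr N} :=
  fun f => `[< is_grhom (f : M -> N) >].

Lemma grhom_submod (M N : grmod) : submod_closed (@grhom_pred M N).
Proof.
have [lin _ _] := gprP N.
have pr0 x : gpr x (0 : N) = 0.
  by have := lin x (-1) 0 0; rewrite scaler0 addr0 scaleN1r addNr.
split.
  apply/asboolP; split=> [a u v|x m] /=; first by rewrite scaler0 addr0.
  by rewrite /= pr0.
move=> c f g /asboolP[fl fg] /asboolP[gl gg]; apply/asboolP; split.
  move=> a u v; rewrite !fctE /=.
  have -> : f (a *: u + v) = a *: (f u : N) + f v := fl a u v.
  have -> : g (a *: u + v) = a *: (g u : N) + g v := gl a u v.
  change (c%:A *: (a *: (f u : N) + f v) + (a *: (g u : N) + g v) =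
          a *: (c%:A *: (f u : N) + g u) + (c%:A *: (f v : N) + g v)).
  by rewrite !scalerDr !scalerA addrACA -scalerAl mul1r -scalerAr mulr1.
move=> x m; rewrite !fctE.
by rewrite [in RHS](lin x c (f m) (g m)) fg gg.
Qed.

HB.instance Definition _ (M N : grmod) :=
  GRing.isSubmodClosed.Build K (M -> restr N) (@grhom_pred M N)
    (@grhom_submod M N).

Record grhom (M N : grmod) := GrHom {
  ghf : M -> restr N;
  _ : ghf \in @grhom_pred M N
}.

HB.instance Definition _ (M N : grmod) := [isSub for @ghf M N].
HB.instance Definition _ (M N : grmod) := [Choice of grhom M N by <:].
HB.instance Definition _ (M N : grmod) :=
  [SubChoice_isSubLmodule of grhom M N by <:].

Lemma grhom_id_subproof (M : grmod) :
  (id : M -> restr M) \in @grhom_pred M M.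
Proof. by apply/asboolP. Qed.
Definition grhom_id (M : grmod) : grhom M M := GrHom (grhom_id_subproof M).

Lemma grhom_comp_subproof (M N P : grmod) (g : grhom N P) (f : grhom M N) :
  (ghf g \o ghf f : M -> restr P) \in @grhom_pred M P.
Proof.
case: g f => [g /asboolP[gl gg]] [f /asboolP[fl fg]] /=; apply/asboolP.
split=> [a u v|x m] /=.
  have -> : f (a *: u + v) = a *: (f u : N) + f v := fl a u v.
  exact: gl.
by rewrite fg gg.
Qed.
Definition grhom_comp (M N P : grmod) (g : grhom N P) (f : grhom M N) :
  grhom M P := GrHom (grhom_comp_subproof g f).

Program Definition grmodcat : lincat K :=
  @LinCat K grmod (fun M N => grhom M N : lmodType K) grhom_id grhom_comp
    _ _ _ _ _.
Next Obligation. exact: val_inj. Qed.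
Next Obligation. exact: val_inj. Qed.
Next Obligation. exact: val_inj. Qed.
Next Obligation.
case: g => g gP c f1 f2; apply: val_inj; apply/funext => m /=.
by have /asboolP[gl _] := gP; exact: (gl (c%:A) (ghf f1 m) (ghf f2 m)).
Qed.
Next Obligation. by move=> c g1 g2; apply: val_inj. Qed.

End GradedModules.

Section Triangular.
Context {K : fieldType} {X : zmodType} {A : falgType K} (wt : X -> A -> A).
Context (n : nat) (I : 'I_n -> X).

Definition is_graded_subalg (U : {aspace A}) : Prop :=
  1 \in U /\ forall x a, a \in U -> wt x a \in U.

(** [td_mul] says that the multiplication map from [Am (x) T (x) Ap] to [A]
    is an isomorphism: it maps the basis of the tensor product formed by the
    [a (x) t (x) b], for [a], [t], [b] in given bases, to a basis of [A]. *)
Record triangular_decomp (Am T Ap : {aspace A}) : Prop := TriangularDecomp {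
  td_Am : is_graded_subalg Am;
  td_T : is_graded_subalg T;
  td_Ap : is_graded_subalg Ap;
  td_mul : basis_of {:A}
    [seq u * b | u <- [seq a * t | a <- vbasis Am, t <- vbasis T],
                 b <- vbasis Ap];
  td_suppAp : forall x a, a \in Ap -> wt x a <> 0 -> cone I x;
  td_suppAm : forall x a, a \in Am -> wt x a <> 0 -> cone I (- x);
  td_degT : forall a, a \in T -> homog wt 0 a;
  td_Am0 : forall a, a \in Am -> homog wt 0 a -> exists c : K, a = c%:A;
  td_Ap0 : forall a, a \in Ap -> homog wt 0 a -> exists c : K, a = c%:A;
  td_ApT : (Ap * T)%VS = (T * Ap)%VS;
  td_AmT : (Am * T)%VS = (T * Am)%VS;
  td_split : is_split_alg (subvs_of T)
}.

Section Induction.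
Context (T Ap : {aspace A}) (N : lmodType (subvs_of T)) (w : X).

(** The action of [B = Ap T] on [N] through [B -> T], which kills the
    components of nonzero degree; [vsproj T] is the identity on [T], which
    contains the component of degree 0 of each element of [B]. *)
Definition infl (b : A) (v : N) : N := vsproj T (wt 0 b) *: v.

Definition balanced (Z : zmodType) (beta : A -> N -> Z) : Prop :=
  [/\ forall a, {morph beta a : u v / u + v},
      forall v, {morph beta^~ v : a b / a + b}
    & forall a b v, b \in (Ap * T)%VS -> beta (a * b) v = beta a (infl b v)].

(** [(V, tau)] is the tensor product of [A] and [N[w]] over [B], with its
    structure of graded A-module, where [N[w]] is [N] placed in degree [w]. *)
Definition is_induced (V : grmod wt) (tau : A -> N -> V) : Prop :=
  [/\ balanced tau,
      forall (Z : zmodType) (beta : A -> N -> Z), balanced beta ->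
        exists2 g : {additive V -> Z}, forall a v, g (tau a v) = beta a v
          & forall g' : {additive V -> Z},
              (forall a v, g' (tau a v) = beta a v) -> g' =1 g,
      forall a b v, a *: tau b v = tau (a * b) v
    & forall x a v, homog wt x a -> homog (@gpr _ _ _ wt V) (x + w) (tau a v)].

Definition is_simple_head (L : grmodcat wt) : Prop :=
  is_simple L /\
  exists (V : grmodcat wt) (tau : A -> N -> (V : grmod wt)),
    is_induced tau /\
    exists q : hom V L, is_epi q /\
      forall (L' : grmodcat wt) (q' : hom V L'), is_simple L' -> is_epi q' ->
        exists i : hom L L', is_iso i /\ q' = i \oc q.

End Induction.
End Triangular.

(* Main.v *)
Require Import Defs.
From HB Require Import structures.
From mathcomp Require Import all_boot all_order all_algebra all_field.
From mathcomp Require Import boolp classical_sets functions cardinality.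
Set Implicit Arguments.
Unset Strict Implicit.
Unset Printing Implicit Defensive.
Import Order.TTheory GRing.Theory Num.Theory Defs.
Local Open Scope ring_scope.

(** Write [B] for the product of [A^+] and [T], and let [rho : B -> T] kill the
    components of nonzero degree.  The triangular decomposition makes [A] a free
    right [B]-module on a homogeneous basis [a j] of [A^-] ([tri_coords_exist]).
    For a [T]-module [N], the module induced from [N] placed in degree [w] is
    therefore the space of families [(v_j)] in [N], standing for the sum of the
    [a j (x) v_j], on which [A] acts by matrices over [T] ([dscale]).  In this
    form it is visibly exact in [N]; call it [Delta w].

    Let [C_(<= w)] and [C_(< w)] be the Serre subcategories of the statement.
    They consist of the modules supported in degrees [<= w] and [< w]
    ([strat_leE], [strat_ltE]).  On [C_(<= w)] the functor taking the weight
    space of degree [w] is exact, its kernel is [C_(< w)], and [Delta w] is left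
    adjoint to it, because [A^+] acts on that weight space through [rho]
    ([delta_hom]); the unit is invertible because the component of degree [0] of
    [A^-] consists of the scalars ([eta_iso]).  An exact functor that has an
    exact left adjoint with invertible unit is the quotient by its kernel
    ([serre_quotient_of_adjoint]).  Thus the stratum of [w] is the category of
    finitely generated [T]-modules, with standard functor [Delta w].

    If [N] is a simple [T]-module, then [Delta w N] is generated by a simple
    weight space, so it has a largest submodule avoiding degree [w], whose
    quotient is its only simple quotient ([top_iso]).  Every simple object [L]
    arises in this way, from the weight space of a maximal degree of [L]
    ([simple_classification]).

    There remains the filtration.  Let [P] be a projective cover of the simple
    object [L] with label [(lam, w)].  Since [L] is generated by a vector of
    degree [w], [P] is a direct summand of the free module [F] on one generator
    of degree [w] ([cover_retract]).  For a set [U] of degrees closed under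
    passing to larger degrees, let [F_U] be the submodule generated by the
    components of degree in [U] ([gen_by]).  In coordinates, [F_U] is the sum of
    the [a j B_u], [u] in [U], up to the shift by [w] ([gen_by_coef]).  Adding
    one degree [v] to [U] hence adds the sum of the [a j B_v], a standard module
    on the [T]-module [B_v], which is projective because [B] is projective over
    [T] ([layer_free]).  This description of a layer passes to direct summands
    ([free_layer_retract]), so the submodule of [P] generated by the degrees
    [> w] is filtered by standard modules of projective [T]-modules in degrees
    [> w] ([gen_by_filtered]), and these are in turn filtered by the standard
    objects, because a projective [T]-module is filtered by projective covers
    of simple ones ([proj_filtered]).  The quotient [Z] of [P] by that submodule
    is the largest quotient of [P] in [C_(<= w)].  Both [Z] and the standard
    object of [(lam, w)] cover [L] minimally and are projective in [C_(<= w)],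
    so each maps onto the other, and they are isomorphic by a comparison of
    dimensions ([cover_filtration]). *)


(** * Finite-dimensional linear algebra *)

Section FiniteDim.
Context {K : fieldType}.

Definition mklin (U V : lmodType K) (f : U -> V) (fl : linear f) :
    {linear U -> V} :=
  HB.pack f (GRing.isLinear.Build K U V *:%R f fl).

(** Among the detachable subspaces inside [Q], one of maximal dimension is all
    of [Q], since a further vector of [Q] could be adjoined to it. *)
Lemma vspace_of_pred (W : vectType K) (Q : W -> Prop) :
  Q 0 -> (forall c x y, Q x -> Q y -> Q (c *: x + y)) ->
  exists U : {vspace W}, forall x, x \in U <-> Q x.
Proof.
move=> Q0 QL.
pose P m := `[< exists U : {vspace W}, (forall x, x \in U -> Q x) /\ \dim U = m >].
have exP : exists m, P m.
  exists 0%N; apply/asboolP; exists 0%VS; split; last by rewrite dimv0.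
  by move=> x; rewrite memv0 => /eqP->.
have ubP m : P m -> (m <= \dim {:W})%N.
  by move=> /asboolP[U [_ <-]]; apply/dimvS/subvf.
case: (ex_maxnP exP ubP) => m /asboolP[U [UQ dU]] max.
exists U => x; split; first exact: UQ.
move=> Qx.
have PUx : P (\dim (U + <[x]>)).
  apply/asboolP; exists (U + <[x]>)%VS; split => // y /memv_addP[u Uu [z]].
  move=> /vlineP[c ->] ->; rewrite addrC; apply: QL => //; exact: UQ.
have : (U == U + <[x]>)%VS by rewrite eqEdim addvSl dU max.
by move/eqP->; rewrite memvE addvSr.
Qed.

(** A module given as a quotient or a submodule has no canonical coordinates,
    so finite dimension is recorded as a property. *)
Definition fdim (V : lmodType K) : Prop :=
  exists (W : vectType K) (f : {linear W -> V}), bijective f.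

(** A complement of the kernel maps bijectively. *)
Lemma fdim_surj (W : vectType K) (V : lmodType K) (f : {linear W -> V}) :
  (forall v, exists w, f w = v) -> fdim V.
Proof.
move=> fs.
have [||U hU] := @vspace_of_pred W (fun w => f w = 0); first exact: linear0.
  by move=> c x y hx hy; rewrite linearP hx hy scaler0 addr0.
pose g := (f \o @vsval K W (U^C)%VS)%FUN.
have gl : linear g by move=> c x y; rewrite /g /= !linearP.
exists (subvs_of (U^C)%VS), (mklin gl).
have ginj : injective g.
  move=> x y /eqP; rewrite -subr_eq0 -linearB /= => /eqP /hU xyU.
  apply/val_inj/eqP; rewrite -subr_eq0 -memv0 -(capv_compl U) memv_cap xyU /=.
  by apply: memvB; apply: subvsP.
have gsurj v : exists w, g w == v.
  have [w <-] := fs v.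
  have /memv_addP[u Uu [c cU ->]] : w \in (U + U^C)%VS by rewrite addv_complf memvf.
  exists (vsproj _ c); rewrite /g /= vsprojK // linearD.
  by have /hU -> := Uu; rewrite add0r.
pose h v := xchoose (gsurj v).
have hK : cancel h g by move=> v; apply/eqP/(xchooseP (gsurj v)).
by exists h => //= x; apply: ginj; rewrite hK.
Qed.

Lemma fdim_vect (W : vectType K) : fdim W.
Proof. by apply: (@fdim_surj W W idfun) => v; exists v. Qed.

Lemma bij_inverse_linear (U V : lmodType K) (f : {linear U -> V}) (g : V -> U) :
  cancel f g -> cancel g f -> linear g.
Proof.
by move=> fK gK c x y; apply: (can_inj fK); rewrite linearP !gK.
Qed.

Lemma fdim_inj (U V : lmodType K) (f : {linear U -> V}) :
  injective f -> fdim V -> fdim U.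
Proof.
move=> finj [W [e [e' eK e'K]]].
have e'l := bij_inverse_linear eK e'K.
have [||X hX] := @vspace_of_pred W (fun w => exists u, f u = e w).
- by exists 0; rewrite !linear0.
- by move=> c x y [u hu] [v hv]; exists (c *: u + v); rewrite !linearP hu hv.
have ex (w : subvs_of X) : exists u, f u == e (vsval w).
  by have /hX[u hu] := subvsP w; exists u; apply/eqP.
pose g w := xchoose (ex w).
have gE w : f (g w) = e (vsval w) by apply/eqP/(xchooseP (ex w)).
have gl : linear g by move=> c x y; apply: finj; rewrite linearP !gE !linearP.
apply: (@fdim_surj (subvs_of X) U (mklin gl)) => u.
have uX : e' (f u) \in X by apply/hX; exists u; rewrite e'K.
by exists (vsproj X (e' (f u))); apply: finj; rewrite /= gE vsprojK // e'K.
Qed.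

Definition vdim_pred (V : lmodType K) (m : nat) : Prop :=
  exists (W : vectType K) (f : {linear W -> V}), bijective f /\ \dim {:W} = m.

(** The default value [0] is meant for modules of infinite dimension. *)
Definition vdim (V : lmodType K) : nat := xget 0%N [set m | vdim_pred V m].

Lemma vdimP (V : lmodType K) : fdim V -> vdim_pred V (vdim V).
Proof. by move=> [W [f fb]]; apply: (@xgetI _ _ _ (\dim {:W})); exists W, f. Qed.

Lemma dim_inj (W1 W2 : vectType K) (f : {linear W1 -> W2}) :
  injective f -> (\dim {:W1} <= \dim {:W2})%N /\
  (\dim {:W1} = \dim {:W2} -> forall y, exists x, f x = y).
Proof.
move=> fi.
have k0 : lker (linfun f) == 0%VS.
  by apply/lker0P => x y; rewrite !lfunE; apply: fi.
have d : \dim (limg (linfun f)) = \dim {:W1}.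
  by rewrite limg_dim_eq // (eqP k0) capv0.
split; first by rewrite -d; apply/dimvS/subvf.
move=> e y.
have : y \in limg (linfun f).
  suff /eqP-> : limg (linfun f) == fullv by apply: memvf.
  by rewrite eqEdim subvf /= d e.
by move=> /memv_imgP[x _ ->]; exists x; rewrite lfunE.
Qed.

Lemma dim_surj (W1 W2 : vectType K) (f : {linear W1 -> W2}) :
  (forall y, exists x, f x = y) -> (\dim {:W2} <= \dim {:W1})%N /\
  (\dim {:W1} = \dim {:W2} -> injective f).
Proof.
move=> fs.
have d : limg (linfun f) = fullv.
  apply/vspaceP => y; rewrite memvf; apply/memv_imgP.
  by have [x <-] := fs y; exists x; rewrite ?memvf ?lfunE.
have := limg_ker_dim (linfun f) fullv; rewrite capfv d => e.
split; first by rewrite -e leq_addl.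
move=> e'; move: e; rewrite e' -[RHS]add0n => /addIn /eqP.
rewrite dimv_eq0 => /lker0P h x y xy.
by apply: h; rewrite !lfunE.
Qed.

Lemma vdim_inj (U V : lmodType K) (f : {linear U -> V}) : fdim V ->
  injective f -> (vdim U <= vdim V)%N /\
  (vdim U = vdim V -> forall y, exists x, f x = y).
Proof.
move=> fV fi; have fU := fdim_inj fi fV.
have [W1 [e1 [[g1 e1K g1K] <-]]] := vdimP fU.
have [W2 [e2 [[g2 e2K g2K] <-]]] := vdimP fV.
have hl : linear (g2 \o f \o e1)%FUN.
  by move=> c x y /=; rewrite !linearP (bij_inverse_linear e2K g2K).
have [|le eq] := @dim_inj _ _ (mklin hl).
  by apply: inj_comp (can_inj e1K); apply: inj_comp (can_inj g2K) fi.
split=> // /eq s y; have [x hx] := s (g2 y).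
by exists (e1 x); apply: (can_inj g2K).
Qed.

Lemma vdim_surj (U V : lmodType K) (f : {linear U -> V}) : fdim U ->
  (forall y, exists x, f x = y) -> [/\ fdim V, (vdim V <= vdim U)%N &
  (vdim U = vdim V -> injective f)].
Proof.
move=> fU fs.
have fV : fdim V.
  have [W1 [e1 [g1 e1K g1K]]] := fU.
  have hl : linear (f \o e1)%FUN by move=> c x y /=; rewrite !linearP.
  apply: (@fdim_surj _ _ (mklin hl)) => v; have [u <-] := fs v.
  by exists (g1 u); rewrite /= g1K.
have [W1 [e1 [[g1 e1K g1K] <-]]] := vdimP fU.
have [W2 [e2 [[g2 e2K g2K] <-]]] := vdimP fV.
have hl : linear (g2 \o f \o e1)%FUN.
  by move=> c x y /=; rewrite !linearP (bij_inverse_linear e2K g2K).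
have [|le eq] := @dim_surj _ _ (mklin hl).
  move=> w; have [u hu] := fs (e2 w).
  by exists (g1 u); rewrite /= g1K hu e2K.
split=> // /eq i x y xy; apply: (can_inj g1K); apply: i.
by rewrite /= !g1K xy.
Qed.

End FiniteDim.
(** * Gradings *)

Section Gradings.
Context {K : fieldType} {X : zmodType} (V : lmodType K) (pr : X -> V -> V).
Hypothesis prP : is_grading pr.

Definition prL (x : X) : {linear V -> V} := let: And3 h _ _ := prP in mklin (h x).
Lemma prLE x v : pr x v = prL x v.
Proof. by rewrite /prL; case: prP. Qed.

Lemma pr0 x : pr x 0 = 0. Proof. by rewrite prLE linear0. Qed.
Lemma prD x u v : pr x (u + v) = pr x u + pr x v.
Proof. by rewrite !prLE linearD. Qed.
Lemma prB x u v : pr x (u - v) = pr x u - pr x v.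
Proof. by rewrite !prLE linearB. Qed.
Lemma prZ x c v : pr x (c *: v) = c *: pr x v.
Proof. by rewrite !prLE linearZ. Qed.
Lemma pr_sum x J (r : seq J) (P : pred J) F :
  pr x (\sum_(j <- r | P j) F j) = \sum_(j <- r | P j) pr x (F j).
Proof. by rewrite prLE linear_sum; apply: eq_bigr => j _; rewrite prLE. Qed.
Lemma prK x y v : pr x (pr y v) = if x == y then pr y v else 0.
Proof. by case: prP. Qed.
Lemma pr_homog x v : homog pr x (pr x v).
Proof. by rewrite /homog prK eqxx. Qed.
Lemma homog_pr x y v : homog pr y v -> pr x v = if x == y then v else 0.
Proof. by move=> <-; rewrite prK. Qed.

Lemma supp_out (s : seq X) x v : uniq s -> v = \sum_(y <- s) pr y v ->
  x \notin s -> pr x v = 0.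
Proof.
move=> us -> xs; rewrite pr_sum big_seq big1 // => y ys.
by rewrite prK; case: eqP => // xy; rewrite xy ys in xs.
Qed.

Lemma supp_sub (s s' : seq X) v : uniq s -> uniq s' ->
  v = \sum_(y <- s) pr y v -> {subset s <= s'} -> v = \sum_(y <- s') pr y v.
Proof.
move=> us us' e ss.
rewrite (bigID (mem s)) /= [X in _ + X]big1 ?addr0; last first.
  by move=> y ys; apply: supp_out us e ys.
rewrite -big_filter {1}e; apply: perm_big; apply: uniq_perm; rewrite ?filter_uniq //.
by move=> y; rewrite mem_filter; case: (boolP (y \in s)) => //= /ss ->.
Qed.

Lemma pr_ex v : exists2 s : seq X, uniq s & v = \sum_(x <- s) pr x v.
Proof. by case: prP. Qed.

Lemma pr_ext u v : (forall x, pr x u = pr x v) -> u = v.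
Proof.
move=> h; apply/eqP; rewrite -subr_eq0; apply/eqP.
have [s _ ->] := pr_ex (u - v).
by rewrite big1 // => x _; rewrite prB h subrr.
Qed.

(** Collect the degrees of a basis. *)
Lemma pr_unif : fdim V ->
  exists2 s : seq X, uniq s & forall v, v = \sum_(x <- s) pr x v.
Proof.
move=> [W [e [e' _ eK]]].
have /all_sig2[s us hs] i := cid2 (pr_ex (e (vbasis {:W})`_i)).
pose S := undup (flatten [seq s i | i <- iota 0 (\dim {:W})]).
exists S; rewrite ?undup_uniq // => v; rewrite -(eK v).
rewrite [e' v](coord_vbasis (memvf _)) linear_sum.
rewrite [RHS](eq_bigr _ (fun x _ => pr_sum _ _ _ _)) exchange_big.
apply: eq_bigr => i _.
rewrite linearZ /= [in LHS](@supp_sub (s i) S _ _ _ (hs i)).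
- by rewrite scaler_sumr; apply: eq_bigr => x _; rewrite prZ.
- exact: us.
- exact: undup_uniq.
- move=> x xs; rewrite mem_undup; apply/flattenP; exists (s i) => //.
  by apply: map_f; rewrite mem_iota /= add0n.
Qed.

End Gradings.

(** * Graded modules *)

Section GradedModulesTheory.
Context {K : fieldType} {X : zmodType} {A : falgType K} {wt : X -> A -> A}.
Hypothesis wtP : is_alg_grading wt.
Notation grmod := (grmod wt).
Implicit Types M N : grmod.

Lemma gpr0 M x : gpr x (0 : M) = 0.
Proof. exact: (pr0 (gprP M)). Qed.
Lemma gprD M x (u v : M) : gpr x (u + v) = gpr x u + gpr x v.
Proof. exact: (prD (gprP M)). Qed.
Lemma gprB M x (u v : M) : gpr x (u - v) = gpr x u - gpr x v.
Proof. exact: (prB (gprP M)). Qed.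
Lemma gprZ M x c (v : M) : gpr x (c%:A *: v) = c%:A *: gpr x v.
Proof. exact: (prZ (gprP M)). Qed.
Lemma gpr_sum M x J (r : seq J) (P : pred J) (F : J -> M) :
  gpr x (\sum_(j <- r | P j) F j) = \sum_(j <- r | P j) gpr x (F j).
Proof. exact: (pr_sum (gprP M)). Qed.
Lemma gprK M x y (v : M) : gpr x (gpr y v) = if x == y then gpr y v else 0.
Proof. exact: (prK (gprP M)). Qed.
Lemma gpr_homog M x (v : M) : homog (@gpr _ _ _ _ M) x (gpr x v).
Proof. exact: (pr_homog (gprP M)). Qed.
Lemma homog_gpr M x y (v : M) : homog (@gpr _ _ _ _ M) y v ->
  gpr x v = if x == y then v else 0.
Proof. exact: (homog_pr (gprP M)). Qed.
Lemma gpr_ex M (v : M) : exists2 s : seq X, uniq s & v = \sum_(x <- s) gpr x v.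
Proof. exact: (pr_ex (gprP M)). Qed.
Lemma gpr_ext M (u v : M) : (forall x, gpr x u = gpr x v) -> u = v.
Proof. exact: (pr_ext (gprP M)). Qed.

Lemma gpr_actl M x z a (m : M) : homog wt x a ->
  gpr z (a *: m) = a *: gpr (z - x) m.
Proof.
move=> ha; have [s us e] := gpr_ex m.
rewrite [in LHS]e [in RHS]e !gpr_sum scaler_sumr gpr_sum scaler_sumr.
apply: eq_bigr => y _; rewrite (homog_gpr _ (gpr_act ha (gpr_homog y m))) gprK.
by rewrite (can2_eq (subrK x) (addrK x)) [y + x]addrC; case: ifP; rewrite ?scaler0.
Qed.

Lemma gpr_actr M y z a (m : M) : homog (@gpr _ _ _ _ M) y m ->
  gpr z (a *: m) = wt (z - y) a *: m.
Proof.
have wg := wtP.1.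
move=> hm; have [s us e] := pr_ex wg a.
rewrite [in LHS]e [in RHS]e (pr_sum wg) !scaler_suml gpr_sum.
apply: eq_bigr => x _; rewrite (homog_gpr _ (gpr_act (pr_homog wg x a) hm)) (prK wg).
by rewrite (can2_eq (subrK y) (addrK y)); case: ifP; rewrite ?scale0r.
Qed.

(** [K]-linearity for the restricted structure, stated through [A]-scaling so
    that the two module structures on one carrier need not be compared. *)
Lemma restr_linear (M N : lmodType A) (f : M -> N) :
  (forall u v, f (u + v) = f u + f v) ->
  (forall c u, f (c%:A *: u) = c%:A *: f u) -> linear (f : restr M -> restr N).
Proof. by move=> fD fZ c u v; rewrite fD; congr (_ + _); apply: fZ. Qed.

Lemma fg_fdim (M : lmodType A) :
  (exists n (g : 'I_n -> M), forall m, exists c : 'I_n -> A, m = \sum_i c i *: g i)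
  <-> fdim (restr M).
Proof.
split=> [[n [g hg]]|[W [e [e' _ eK]]]].
  pose f (c : {ffun 'I_n -> A}) : restr M := \sum_i (c i *: g i : M).
  have fl : linear f.
    move=> k c c'; rewrite /f.
    have -> : k *: (\sum_i c i *: g i : restr M) = \sum_i (k%:A *: (c i *: g i)) :> M.
      exact: (@scaler_sumr _ M).
    rewrite -big_split; apply: eq_bigr => i _; rewrite !ffunE /= scalerDl scalerA.
    by rewrite -scalerAl mul1r.
  apply: (@fdim_surj _ _ _ (mklin fl)) => m; have [c hc] := hg m.
  by exists (finfun c); rewrite /= /f [RHS]hc; apply: eq_bigr => i _; rewrite ffunE.
exists (\dim {:W}), (fun i => e (vbasis {:W})`_i) => m.
exists (fun i => (coord (vbasis fullv) i (e' m))%:A).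
rewrite -[LHS](eK m) [X in e X](coord_vbasis (memvf _)) linear_sum.
by apply: eq_bigr => i _; rewrite linearZ.
Qed.

Lemma gfd M : fdim (restr M).
Proof. by apply/fg_fdim; apply: gfg. Qed.

Lemma gpr_unif M :
  exists2 s : seq X, uniq s & forall v : M, v = \sum_(x <- s) gpr x v.
Proof. exact: (pr_unif (gprP M) (gfd M)). Qed.

Definition gdim M : nat := vdim (restr M).

End GradedModulesTheory.
(** * Homomorphisms, submodules and quotients of graded modules *)

Section GradedHoms.
Context {K : fieldType} {X : zmodType} {A : falgType K} {wt : X -> A -> A}.
Notation grmod := (grmod wt).
Notation C := (grmodcat wt).
Notation Hom M N := (@hom K (grmodcat wt) M N).
Implicit Types M N L : grmod.

Definition ap M N (f : Hom M N) : M -> N := ghf (f : grhom M N).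

Lemma ap_grhom M N (f : Hom M N) : is_grhom (ap f).
Proof. by apply/asboolP; apply: (valP (f : grhom M N)). Qed.

Lemma apL M N (f : Hom M N) a (u v : M) : ap f (a *: u + v) = a *: ap f u + ap f v.
Proof. by have [h _] := ap_grhom f; apply: h. Qed.
Lemma apD M N (f : Hom M N) (u v : M) : ap f (u + v) = ap f u + ap f v.
Proof. by rewrite -[u]scale1r apL !scale1r. Qed.
Lemma ap0 M N (f : Hom M N) : ap f 0 = 0.
Proof. by apply: (addrI (ap f 0)); rewrite -apD !addr0. Qed.
Lemma apZ M N (f : Hom M N) a (u : M) : ap f (a *: u) = a *: ap f u.
Proof. by rewrite -[a *: u]addr0 apL ap0 addr0. Qed.
Lemma apN M N (f : Hom M N) (u : M) : ap f (- u) = - ap f u.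
Proof. by rewrite -scaleN1r apZ scaleN1r. Qed.
Lemma apB M N (f : Hom M N) (u v : M) : ap f (u - v) = ap f u - ap f v.
Proof. by rewrite apD apN. Qed.
Lemma ap_sum M N (f : Hom M N) J (r : seq J) (P : pred J) (F : J -> M) :
  ap f (\sum_(j <- r | P j) F j) = \sum_(j <- r | P j) ap f (F j).
Proof. by apply: (big_morph _ (apD f) (ap0 f)). Qed.
Lemma ap_gpr M N (f : Hom M N) x (u : M) : ap f (gpr x u) = gpr x (ap f u).
Proof. by have [_ h] := ap_grhom f; apply: h. Qed.
Lemma ap_comp L M N (g : Hom M N) (f : Hom L M) u : ap (g \oc f) u = ap g (ap f u).
Proof. by []. Qed.
Lemma ap_id M (u : M) : ap (idm (M : C)) u = u.
Proof. by []. Qed.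
Lemma ap_0 M N u : ap (0 : Hom M N) u = 0.
Proof. by []. Qed.
Lemma ap_add M N (f g : Hom M N) u : ap (f + g) u = ap f u + ap g u.
Proof. by []. Qed.
Lemma ap_scale M N c (f : Hom M N) u : ap (c *: f) u = c%:A *: ap f u.
Proof. by []. Qed.

Lemma hom_ext M N (f g : Hom M N) : (forall u, ap f u = ap g u) -> f = g.
Proof. by move=> h; apply: val_inj; apply/funext => u; apply: h. Qed.

Section MkHom.
Variables (M N : grmod) (f : M -> N).
Hypothesis fL : linear f.
Hypothesis fG : forall x m, f (gpr x m) = gpr x (f m).

Lemma mkhom_subproof : (f : M -> restr N) \in @grhom_pred K X A wt M N.
Proof. by apply/asboolP; split. Qed.
Definition mkhom : Hom M N := GrHom mkhom_subproof.
Lemma mkhomE u : ap mkhom u = f u. Proof. by []. Qed.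
End MkHom.

Lemma ap_inj_dim M N (f : Hom M N) : injective (ap f) ->
  (gdim M <= gdim N)%N /\ (gdim M = gdim N -> forall y, exists x, ap f x = y).
Proof.
move=> fi.
have l := restr_linear (apD f) (fun c u => apZ f c%:A u).
exact: (@vdim_inj _ _ _ (mklin l) (gfd N) fi).
Qed.

Lemma ap_surj_dim M N (f : Hom M N) : (forall y, exists x, ap f x = y) ->
  (gdim N <= gdim M)%N /\ (gdim M = gdim N -> injective (ap f)).
Proof.
move=> fs.
have l := restr_linear (apD f) (fun c u => apZ f c%:A u).
by have [_] := (@vdim_surj _ _ _ (mklin l) (gfd M) fs).
Qed.

(** ** Graded submodules *)

Record gsub M (P : M -> Prop) : Prop := Gsub {
  gsub0 : P 0;
  gsubL : forall a u v, P u -> P v -> P (a *: u + v);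
  gsub_gpr : forall x u, P u -> P (gpr x u) }.

Section SubObject.
Variables (M : grmod) (P : M -> Prop) (hP : gsub P).

Lemma gsubD u v : P u -> P v -> P (u + v).
Proof. by move=> hu hv; rewrite -[u]scale1r; apply: (gsubL hP). Qed.
Lemma gsubZ a u : P u -> P (a *: u).
Proof. by move=> hu; rewrite -[_ *: _]addr0; exact: (gsubL hP a hu (gsub0 hP)). Qed.
Lemma gsubN u : P u -> P (- u).
Proof. by move=> hu; rewrite -scaleN1r; apply: gsubZ. Qed.
Lemma gsubB u v : P u -> P v -> P (u - v).
Proof. by move=> hu hv; apply/gsubD/gsubN. Qed.
Lemma gsub_sum J (r : seq J) (Q : pred J) F : (forall j, Q j -> P (F j)) ->
  P (\sum_(j <- r | Q j) F j).
Proof. by move=> h; apply: big_ind => //; [apply: (gsub0 hP) | apply: gsubD]. Qed.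

Definition sub_car : choiceType := {m : M | `[< P m >]}.
Definition sub_mk (m : M) (h : P m) : sub_car := exist _ m (asboolT h).
Lemma sub_mem (t : sub_car) : P (val t). Proof. by apply/asboolP; apply: (svalP t). Qed.
Definition sub_add (s t : sub_car) : sub_car := sub_mk (gsubD (sub_mem s) (sub_mem t)).
Definition sub_opp (t : sub_car) : sub_car := sub_mk (gsubN (sub_mem t)).
Definition sub_zero : sub_car := sub_mk (gsub0 hP).
Definition sub_scale a (t : sub_car) : sub_car := sub_mk (gsubZ a (sub_mem t)).

Lemma sub_addA : associative sub_add.
Proof. by move=> *; apply: val_inj; rewrite /= addrA. Qed.
Lemma sub_addC : commutative sub_add.
Proof. by move=> *; apply: val_inj; rewrite /= addrC. Qed.
Lemma sub_add0 : left_id sub_zero sub_add.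
Proof. by move=> *; apply: val_inj; rewrite /= add0r. Qed.
Lemma sub_addN : left_inverse sub_zero sub_opp sub_add.
Proof. by move=> *; apply: val_inj; rewrite /= addNr. Qed.
Definition sub_zmod : zmodType :=
  HB.pack sub_car (GRing.isZmodule.Build sub_car sub_addA sub_addC sub_add0 sub_addN).

Lemma sub_sA a b (v : sub_zmod) : sub_scale a (sub_scale b v) = sub_scale (a * b) v.
Proof. by apply: val_inj; rewrite /= scalerA. Qed.
Lemma sub_s1 : left_id 1 (sub_scale : A -> sub_zmod -> sub_zmod).
Proof. by move=> v; apply: val_inj; rewrite /= scale1r. Qed.
Lemma sub_sDr : right_distributive (sub_scale : A -> sub_zmod -> sub_zmod) +%R.
Proof. by move=> *; apply: val_inj; rewrite /= scalerDr. Qed.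
Lemma sub_sDl (v : sub_zmod) : {morph (sub_scale : A -> sub_zmod ->
  sub_zmod)^~ v : a b / a + b}.
Proof. by move=> *; apply: val_inj; rewrite /= scalerDl. Qed.
Definition sub_lmod : lmodType A :=
  HB.pack (sub_zmod : Type) sub_zmod (GRing.Zmodule_isLmodule.Build A sub_zmod
    sub_sA sub_s1 sub_sDr sub_sDl).

Definition sub_gpr x (t : sub_lmod) : sub_lmod := sub_mk (gsub_gpr hP x (sub_mem t)).
Lemma sub_val_sum J (r : seq J) (F : J -> sub_lmod) :
  val (\sum_(j <- r) F j : sub_lmod) = \sum_(j <- r) val (F j) :> M.
Proof. exact: (big_morph (fun t : sub_lmod => val t : M) (fun _ _ => erefl) erefl). Qed.

Lemma sub_gprP : is_grading (sub_gpr : X -> restr sub_lmod -> restr sub_lmod).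
Proof.
split=> [x c u v|x y v|v].
- apply: val_inj; rewrite /= gprD; congr (_ + _); exact: gprZ.
- apply: val_inj; rewrite /= gprK; by case: ifP.
have [s us e] := gpr_ex (val v : M); exists s => //.
by apply: val_inj; rewrite [RHS](sub_val_sum s (fun x => sub_gpr x v)) {1}e.
Qed.

Lemma sub_gpr_act x y a (m : sub_lmod) : homog wt x a -> homog sub_gpr y m ->
  homog sub_gpr (x + y) (a *: m).
Proof.
move=> ha /(congr1 val) hm; apply: val_inj; exact: (gpr_act ha (hm : homog _ _ _)).
Qed.

Lemma sub_fg : exists n (g : 'I_n -> sub_lmod), forall m, exists c : 'I_n ->
  A, m = \sum_i c i *: g i.
Proof.
apply/fg_fdim.
have l : linear ((fun t : sub_lmod => val t : M) : restr sub_lmod -> restr M) by [].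
by apply: (@fdim_inj _ _ _ (mklin l)) (gfd M); apply: val_inj.
Qed.

Definition subobj : grmod := GrMod sub_gprP sub_gpr_act sub_fg.

Definition sub_incl : Hom subobj M :=
  @mkhom subobj M (fun t : sub_lmod => val t) (fun _ _ _ => erefl) (fun _ _ => erefl).

Lemma sub_incl_inj : injective (ap sub_incl).
Proof. exact: val_inj. Qed.

Lemma sub_inclP m : (exists t, ap sub_incl t = m) <-> P m.
Proof.
split=> [[t <-]|h]; first exact: sub_mem.
by exists (sub_mk h : sub_lmod).
Qed.

End SubObject.

(** ** Quotients by graded submodules *)

Section QuotObject.
Variables (M : grmod) (P : M -> Prop) (hP : gsub P).

(** The elements of the quotient are canonical representatives of the cosets. *)
Definition qrep (m : M) : M := choose (fun y => `[< P (y - m) >]) m.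

Lemma qrepP m : P (qrep m - m).
Proof.
apply/asboolP; apply: (@chooseP _ (fun y => `[< P (y - m) >])).
by apply/asboolP; rewrite subrr; apply: (gsub0 hP).
Qed.

Lemma qrep_eq m m' : P (m - m') -> qrep m = qrep m'.
Proof.
move=> h; rewrite /qrep.
have e : (fun y => `[< P (y - m) >]) =1 (fun y => `[< P (y - m') >]).
  move=> y; apply/asboolP/asboolP => hy.
    by have := gsubD hP hy h; rewrite addrA subrK.
  by have := gsubB hP hy h; rewrite opprB addrA subrK.
rewrite (eq_choose e); apply: choose_id; apply/asboolP => //.
by rewrite subrr; apply: (gsub0 hP).
Qed.

Lemma qrepE m m' : (qrep m = qrep m') <-> P (m - m').
Proof.
split=> [e|]; last exact: qrep_eq.
have := gsubB hP (qrepP m') (qrepP m); rewrite e opprB.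
by rewrite addrC addrA subrK.
Qed.

Lemma qrepK m : qrep (qrep m) = qrep m.
Proof. exact: (qrep_eq (qrepP m)). Qed.

Definition quot_car : choiceType := {m : M | qrep m == m}.
Definition quot_p (m : M) : quot_car := exist _ (qrep m) (introT eqP (qrepK m)).
Lemma quot_pE m m' : quot_p m = quot_p m' <-> P (m - m').
Proof.
rewrite -qrepE; split; first by move/(congr1 val).
by move=> e; apply: val_inj.
Qed.
Lemma quot_pK (t : quot_car) : quot_p (val t) = t.
Proof. by apply: val_inj => /=; apply/eqP/(valP t). Qed.
Lemma quot_pv m : P (val (quot_p m) - m). Proof. exact: (qrepP m). Qed.

Definition quot_add (s t : quot_car) : quot_car := quot_p (val s + val t).
Definition quot_opp (t : quot_car) : quot_car := quot_p (- val t).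
Definition quot_zero : quot_car := quot_p 0.
Definition quot_scale a (t : quot_car) : quot_car := quot_p (a *: val t).
Lemma quot_paddE m m' : quot_add (quot_p m) (quot_p m') = quot_p (m + m').
Proof. by apply/quot_pE; rewrite opprD addrACA; apply: (gsubD hP); apply: quot_pv. Qed.
Lemma quot_poppE m : quot_opp (quot_p m) = quot_p (- m).
Proof. by apply/quot_pE; rewrite -opprD; apply: (gsubN hP); apply: quot_pv. Qed.
Lemma quot_pscaleE a m : quot_scale a (quot_p m) = quot_p (a *: m).
Proof. by apply/quot_pE; rewrite -scalerBr; apply: (gsubZ hP); apply: quot_pv. Qed.

Lemma quot_addA : associative quot_add.
Proof. by move=> x y z; rewrite -[x]quot_pK -[y]quot_pK -[z]quot_pK !quot_paddE addrA. Qed.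
Lemma quot_addC : commutative quot_add.
Proof. by move=> x y; rewrite -[x]quot_pK -[y]quot_pK !quot_paddE addrC. Qed.
Lemma quot_add0 : left_id quot_zero quot_add.
Proof. by move=> x; rewrite -[x]quot_pK !quot_paddE add0r. Qed.
Lemma quot_addN : left_inverse quot_zero quot_opp quot_add.
Proof. by move=> x; rewrite -[x]quot_pK quot_poppE quot_paddE addNr. Qed.
Definition quot_zmod : zmodType :=
  HB.pack quot_car (GRing.isZmodule.Build quot_car quot_addA quot_addC quot_add0
  quot_addN).

Lemma quot_sA a b (v : quot_zmod) : quot_scale a (quot_scale b v) = quot_scale (a * b) v.
Proof. by rewrite -[v]quot_pK !quot_pscaleE scalerA. Qed.
Lemma quot_s1 : left_id 1 (quot_scale : A -> quot_zmod -> quot_zmod).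
Proof. by move=> v; rewrite -[v]quot_pK !quot_pscaleE scale1r. Qed.
Lemma quot_sDr : right_distributive (quot_scale : A -> quot_zmod -> quot_zmod) +%R.
Proof.
move=> a x y; rewrite -[x]quot_pK -[y]quot_pK.
have -> : (quot_p (val x) : quot_zmod) + quot_p (val y) = quot_p (val x + val y) :=
  quot_paddE _ _.
by rewrite !quot_pscaleE scalerDr -quot_paddE.
Qed.
Lemma quot_sDl (v : quot_zmod) : {morph (quot_scale : A -> quot_zmod ->
  quot_zmod)^~ v : a b / a + b}.
Proof. by move=> a b; rewrite -[v]quot_pK !quot_pscaleE scalerDl -quot_paddE. Qed.
Definition quot_lmod : lmodType A :=
  HB.pack (quot_zmod : Type) quot_zmod (GRing.Zmodule_isLmodule.Build A quot_zmod
    quot_sA quot_s1 quot_sDr quot_sDl).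

(* The projection again, now into the module, for additivity lemmas to apply. *)
Definition quot_pm (m : M) : quot_lmod := quot_p m.
Lemma quot_pmK (t : quot_lmod) : quot_pm (val t) = t. Proof. exact: quot_pK. Qed.
Lemma quot_pmD u v : quot_pm (u + v) = quot_pm u + quot_pm v.
Proof. by rewrite /quot_pm -quot_paddE. Qed.
Lemma quot_pmZ a u : quot_pm (a *: u) = a *: quot_pm u.
Proof. by rewrite /quot_pm -quot_pscaleE. Qed.
Lemma quot_pm_sum J (r : seq J) (F : J -> M) :
  quot_pm (\sum_(j <- r) F j) = \sum_(j <- r) quot_pm (F j).
Proof. exact: (big_morph quot_pm quot_pmD erefl). Qed.

Definition quot_gpr x (t : quot_lmod) : quot_lmod := quot_pm (gpr x (val t)).
Lemma quot_gprE x m : quot_gpr x (quot_pm m) = quot_pm (gpr x m).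
Proof. by apply/quot_pE; rewrite -gprB; apply: (gsub_gpr hP); apply: quot_pv. Qed.

Lemma quot_gprD x s t : quot_gpr x (s + t) = quot_gpr x s + quot_gpr x t.
Proof.
rewrite -(quot_pmK s) -(quot_pmK t); set u := val s; set v := val t.
rewrite -(quot_pmD u v) (quot_gprE x (u + v)) (quot_gprE x u) (quot_gprE x v).
by rewrite gprD (quot_pmD (gpr x u)).
Qed.

Lemma quot_gprZ x c s : quot_gpr x (c%:A *: s) = c%:A *: quot_gpr x s.
Proof.
rewrite -(quot_pmK s); set u := val s.
by rewrite -(quot_pmZ _ u) (quot_gprE x (_ *: u)) (quot_gprE x u) gprZ (quot_pmZ _
  (gpr x u)).
Qed.

Lemma quot_gprK x y s :
  quot_gpr x (quot_gpr y s) = if x == y then quot_gpr y s else 0.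
Proof.
rewrite -(quot_pmK s); set u := val s.
by rewrite (quot_gprE y u) (quot_gprE x (gpr y u)) gprK; case: ifP.
Qed.

Lemma quot_gprP : is_grading (quot_gpr : X -> restr quot_lmod -> restr quot_lmod).
Proof.
split=> [x|x y v|v].
- exact: (restr_linear (quot_gprD x) (fun c s => quot_gprZ x c s)).
- exact: quot_gprK.
have [s us e] := gpr_ex (val v : M); exists s => //.
rewrite -{1}(quot_pmK v) e (quot_pm_sum s (fun x => gpr x (val v))).
exact: eq_bigr.
Qed.

Lemma quot_gpr_act x y a (m : quot_lmod) : homog wt x a -> homog quot_gpr y m ->
  homog quot_gpr (x + y) (a *: m).
Proof.
move=> ha; rewrite /homog => <-; rewrite -[m]quot_pmK quot_gprE -quot_pmZ quot_gprE.
congr quot_pm; exact: (gpr_act ha (gpr_homog _ _)).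
Qed.

Lemma quot_fg : exists n (g : 'I_n -> quot_lmod), forall m, exists c : 'I_n ->
  A, m = \sum_i c i *: g i.
Proof.
apply/fg_fdim.
have l : linear (quot_pm : restr M -> restr quot_lmod) by apply: restr_linear => *;
  rewrite ?quot_pmD ?quot_pmZ.
by have [|h _ _] := @vdim_surj _ _ _ (mklin l) (gfd M); first by move=> y;
  exists (val y); apply: quot_pK.
Qed.

Definition quotobj : grmod := GrMod quot_gprP quot_gpr_act quot_fg.

Lemma quot_pmL : linear (quot_pm : M -> quotobj).
Proof. by move=> a u v; rewrite quot_pmD quot_pmZ. Qed.
Definition quot_proj : Hom M quotobj :=
  @mkhom M quotobj quot_pm quot_pmL (fun x m => esym (quot_gprE x m)).

Lemma quot_proj_surj t : exists m, ap quot_proj m = t.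
Proof. by exists (val (t : quot_car)); apply: quot_pK. Qed.

Lemma quot_proj_eq0 m : ap quot_proj m = 0 <-> P m.
Proof. by rewrite -{2}[m]subr0 -quot_pE. Qed.

End QuotObject.

End GradedHoms.

Arguments quot_proj_surj {K X A wt M P} hP t.
Arguments quot_proj_eq0 {K X A wt M P} hP m.
Arguments sub_incl_inj {K X A wt M P} hP [x1 x2] _.
Arguments sub_inclP {K X A wt M P} hP m.
(** * Kernels, cokernels and exactness in terms of elements *)

Section Exactness.
Context {K : fieldType} {X : zmodType} {A : falgType K} {wt : X -> A -> A}.
Notation grmod := (grmod wt).
Notation C := (grmodcat wt).
Notation Hom M N := (@hom K (grmodcat wt) M N).
Implicit Types M N L : grmod.

Definition onto M N (f : Hom M N) : Prop := forall y, exists x, ap f x = y.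

Lemma ap_comp_eq L M N (f : Hom M N) (g : Hom L M) (h : Hom L N) :
  f \oc g = h -> forall u, ap f (ap g u) = ap h u.
Proof. by move=> <-. Qed.

Lemma gsub_zero M : gsub (fun m : M => m = 0).
Proof. by split=> [//|a u v -> ->|x u ->]; rewrite ?scaler0 ?addr0 ?gpr0. Qed.

Lemma gker_gsub M N (f : Hom M N) : gsub (fun m => ap f m = 0).
Proof.
split=> [|a u v hu hv|x u hu]; first exact: ap0.
  by rewrite apL hu hv scaler0 addr0.
by rewrite ap_gpr hu gpr0.
Qed.

Lemma gimg_gsub M N (f : Hom M N) : gsub (fun n => exists m, ap f m = n).
Proof.
split=> [|a _ _ [u <-] [v <-]|x _ [u <-]]; first by exists 0; apply: ap0.
  by exists (a *: u + v); apply: apL.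
by exists (gpr x u); apply: ap_gpr.
Qed.

Lemma ap_inj0 M N (f : Hom M N) : (forall m, ap f m = 0 -> m = 0) -> injective (ap f).
Proof.
move=> h u v e; apply/eqP; rewrite -subr_eq0; apply/eqP/h.
by rewrite apB e subrr.
Qed.

Lemma hom_lift L M N (f : Hom L N) (g : Hom M N) : injective (ap f) ->
  (forall m, exists l, ap f l = ap g m) -> exists h : Hom M L, f \oc h = g.
Proof.
move=> fi /choice[h hE].
have hL : linear h by move=> a u v; apply: fi; rewrite apL !hE apL.
have hG x m : h (gpr x m) = gpr x (h m) by apply: fi; rewrite ap_gpr !hE ap_gpr.
by exists (mkhom hL hG); apply: hom_ext => u; rewrite ap_comp mkhomE hE.
Qed.

Lemma hom_colift L M N (c : Hom L M) (g : Hom L N) : onto c ->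
  (forall l, ap c l = 0 -> ap g l = 0) -> exists h : Hom M N, h \oc c = g.
Proof.
move=> /choice[s sE] hg.
have gE l l' : ap c l = ap c l' -> ap g l = ap g l'.
  move=> e; apply/eqP; rewrite -subr_eq0 -apB; apply/eqP/hg.
  by rewrite apB e subrr.
have hL : linear (fun m => ap g (s m)).
  by move=> a u v; rewrite -apL; apply: gE; rewrite apL !sE.
have hG x m : ap g (s (gpr x m)) = gpr x (ap g (s m)).
  by rewrite -ap_gpr; apply: gE; rewrite ap_gpr !sE.
exists (mkhom hL hG); apply: hom_ext => u; rewrite ap_comp mkhomE.
by apply: gE; rewrite sE.
Qed.

Lemma hom_inverse M N (f : Hom M N) : injective (ap f) -> onto f -> is_iso f.
Proof.
move=> fi fs.
have [|g gE] := @hom_lift M N N f (idm (N : C)) fi; first by move=> m; apply: fs.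
exists g; split=> //; apply: hom_ext => u; apply: fi.
by have := congr1 (fun h => ap h (ap f u)) gE; rewrite ap_comp.
Qed.

Lemma isoP M N (f : Hom M N) : is_iso f <-> injective (ap f) /\ onto f.
Proof.
split=> [[g [gf fg]]|[]]; last exact: hom_inverse.
split=> [u v e|y].
  by rewrite -[u]ap_id -[v]ap_id -gf !ap_comp e.
by exists (ap g y); rewrite -ap_comp fg.
Qed.

Lemma monoP M N (f : @hom K C M N) : is_mono f <-> injective (ap f).
Proof.
split=> [fm|fi W g h e]; last first.
  by apply: hom_ext => u; apply: fi; rewrite -!ap_comp e.
apply: ap_inj0 => m fm0.
have := fm _ (sub_incl (gker_gsub f)) 0.
have [t <-] := (sub_inclP (gker_gsub f) m).2 fm0.
move=> -> //; apply: hom_ext => u; rewrite ap_comp ap_comp ap0.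
by apply/(sub_inclP (gker_gsub f)); exists u.
Qed.

Lemma epiP M N (f : @hom K C M N) : is_epi f <-> onto f.
Proof.
split=> [fe y|fs W g h e]; last first.
  by apply: hom_ext => u; have [m <-] := fs u; rewrite -!ap_comp e.
apply/(quot_proj_eq0 (gimg_gsub f)).
have -> // : quot_proj (gimg_gsub f) = 0.
apply: fe; apply: hom_ext => u; rewrite !ap_comp ap_0.
by apply/(quot_proj_eq0 (gimg_gsub f)); exists u.
Qed.

Lemma zeroP M : @is_zero K C M <-> forall m : M, m = 0.
Proof.
split=> [[_ h] m|h]; first by rewrite -[LHS]ap_id (h _ (idm (M : C))).
split=> N f; apply: hom_ext => u; first exact: h.
by rewrite (h u) ap0.
Qed.

Definition sexact L M N (f : Hom L M) (g : Hom M N) : Prop :=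
  [/\ injective (ap f), onto g & forall m, ap g m = 0 <-> exists l, ap f l = m].

Definition closed_sub (P : grmod -> Prop) :=
  forall M N (f : Hom M N), injective (ap f) -> P N -> P M.
Definition closed_quot (P : grmod -> Prop) :=
  forall M N (f : Hom M N), onto f -> P M -> P N.

(** The criteria are proved inside a full subcategory closed under subobjects
    and quotients: this covers the strata, and the whole category as the case
    of the trivial predicate. *)
Section Full.
Variable P : C -> Prop.
Hypotheses (Psub : closed_sub P) (Pquot : closed_quot P).
Notation S := (full_subcat P).

Definition fap (x y : S) (f : hom x y) : (sval x : grmod) -> (sval y : grmod) :=
  @ap K X A wt (sval x) (sval y) f.

(** A categorical kernel is compared with the submodule of elements killed by
    [f], which again belongs to the subcategory. *)
Lemma full_kernelP (w x y : S) (k : hom w x) (f : hom x y) :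
  is_kernel k f <->
  injective (fap k) /\ forall m, fap f m = 0 <-> exists l, fap k l = m.
Proof.
case: w x y k f => [w Pw] [x Px] [y Py] k f; rewrite /fap /=.
split=> [[fk ker]|[ki kf]]; last first.
  split; first by apply: hom_ext => u; apply/kf; exists u.
  move=> [v Pv] g fg.
  have [|h hE] := @hom_lift w v x k g ki.
    by move=> m; apply/kf; apply: (@ap_comp_eq v x y f g 0 fg).
  exists h; split=> // h' h'E; apply: hom_ext => u; apply: ki.
  by rewrite (ap_comp_eq hE) (@ap_comp_eq v w x k h' g h'E).
pose N := gker_gsub f.
have Ni := sub_incl_inj N.
have PN : P (subobj N) by exact: (Psub Ni Px).
have fi : @comp K C (subobj N) x y f (sub_incl N) = 0.
  by apply: hom_ext => u; apply/(sub_inclP N); exists u.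
have [h [hE _]] := ker (exist _ _ PN) (sub_incl N) fi.
have {}hE := @ap_comp_eq (subobj N) w x k h (sub_incl N) hE.
have fk0 := @ap_comp_eq w x y f k 0 fk.
have [|h' /ap_comp_eq h'E] := @hom_lift _ w x (sub_incl N) k Ni.
  by move=> m; apply/(sub_inclP N); apply: fk0.
have h'h u : ap h (ap h' u) = u.
  have [i [_ iu]] := ker (exist _ _ Pw) k fk.
  have e1 : i = @comp K C _ _ _ h h'.
    by apply: iu; apply: hom_ext => v; rewrite -[RHS]h'E -hE.
  have e2 : i = idm (w : C) by apply: iu; apply: hom_ext.
  by rewrite -ap_comp -e1 e2.
split=> [u v e|m]; last first.
  split=> [hm|[l <-]]; last exact: fk0.
  have [t <-] := (sub_inclP N m).2 hm.
  by exists (ap h t); apply: hE.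
by rewrite -[u]h'h -[v]h'h; congr (ap h _); apply: Ni; rewrite !h'E.
Qed.

Lemma full_cokernelP (x y z : S) (c : hom y z) (f : hom x y) :
  is_cokernel c f <->
  (forall u, exists m, fap c m = u) /\ forall m, fap c m = 0 <-> exists l, fap f l = m.
Proof.
case: x y z c f => [x Px] [y Py] [z Pz] c f; rewrite /fap /=.
split=> [[cf coker]|[cs kf]]; last first.
  split; first by apply: hom_ext => u; apply/kf; exists u.
  move=> [v Pv] g gf.
  have [|h hE] := @hom_colift y z v c g cs.
    by move=> m /kf[l <-]; apply: (@ap_comp_eq x y v g f 0 gf).
  exists h; split=> // h' h'E; apply: hom_ext => u; have [m <-] := cs u.
  by rewrite (ap_comp_eq hE) (@ap_comp_eq y z v h' c g h'E).
pose N := gimg_gsub f.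
have Ns := quot_proj_surj N.
have PN : P (quotobj N) by exact: (Pquot Ns Py).
have fi : @comp K C x y (quotobj N) (quot_proj N) f = 0.
  by apply: hom_ext => u; apply/(quot_proj_eq0 N); exists u.
have [h [hE _]] := coker (exist _ _ PN) (quot_proj N) fi.
have {}hE := @ap_comp_eq y z (quotobj N) h c (quot_proj N) hE.
have cf0 := @ap_comp_eq x y z c f 0 cf.
have [|h' /ap_comp_eq h'E] := @hom_colift _ _ z (quot_proj N) c Ns.
  by move=> m /(quot_proj_eq0 N)[l <-]; apply: cf0.
have h'h u : ap h' (ap h u) = u.
  have [i [_ iu]] := coker (exist _ _ Pz) c cf.
  have e1 : i = @comp K C _ _ _ h' h.
    by apply: iu; apply: hom_ext => v; rewrite -[RHS]h'E -hE.
  have e2 : i = idm (z : C) by apply: iu; apply: hom_ext.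
  by rewrite -ap_comp -e1 e2.
split=> [u|m].
  have [m mE] := Ns (ap h u).
  by exists m; rewrite -h'E mE h'h.
split=> [hm|[l <-]]; last exact: cf0.
by apply/(quot_proj_eq0 N); rewrite -hE hm ap0.
Qed.

Lemma full_exactP (x y z : S) (f : hom x y) (g : hom y z) :
  short_exact f g <-> @sexact (sval x) (sval y) (sval z) f g.
Proof.
rewrite /short_exact full_kernelP full_cokernelP /sexact.
by split=> [[[? ?] [? ?]]|[? ? ?]].
Qed.

End Full.

Lemma kernelP M N L (k : Hom L M) (f : Hom M N) :
  is_kernel k f <-> injective (ap k) /\ forall m, ap f m = 0 <-> exists l, ap k l = m.
Proof.
have t (x : C) : (fun _ => True) x by [].
have := @full_kernelP (fun _ => True) (fun _ _ _ _ _ => I)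
  (exist _ L (t L)) (exist _ M (t M)) (exist _ N (t N)) k f.
rewrite /fap /= => <-; split=> [[fk h]|[fk h]]; split=> //.
  by move=> [v Pv] g fg; exact: (h v g fg).
by move=> v g fg; exact: (h (exist _ v (t v)) g fg).
Qed.

Lemma cokernelP M N L (c : Hom M L) (f : Hom N M) :
  is_cokernel c f <-> onto c /\ forall m, ap c m = 0 <-> exists l, ap f l = m.
Proof.
have t (x : C) : (fun _ => True) x by [].
have := @full_cokernelP (fun _ => True) (fun _ _ _ _ _ => I)
  (exist _ N (t N)) (exist _ M (t M)) (exist _ L (t L)) c f.
rewrite /fap /= => <-; split=> [[fk h]|[fk h]]; split=> //.
  by move=> [v Pv] g fg; exact: (h v g fg).
by move=> v g fg; exact: (h (exist _ v (t v)) g fg).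
Qed.

Lemma exactP M N L (f : Hom L M) (g : Hom M N) : short_exact f g <-> sexact f g.
Proof.
rewrite /short_exact kernelP cokernelP /sexact.
by split=> [[[? ?] [? ?]]|[? ? ?]].
Qed.

(** ** The category of graded modules is abelian *)

Section Biproduct.
Variables M N : grmod.
Let V : lmodType A := (M * N)%type.
Definition dsum_gpr x (p : V) : V := (gpr x p.1, gpr x p.2).

Lemma dsum_gprP : is_grading (dsum_gpr : X -> restr V -> restr V).
Proof.
split=> [x|x y [u v]|[u v]].
- apply: (@restr_linear _ _ V V (dsum_gpr x)) => [p q|c p]; congr pair => /=.
  + exact: gprD.
  + exact: gprD.
  + exact: gprZ.
  + exact: gprZ.
- by rewrite /dsum_gpr /= !gprK; case: ifP.
have [s us es] := gpr_ex u; have [t ut et] := gpr_ex v.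
pose S := undup (s ++ t); exists S; first exact: undup_uniq.
have -> : \sum_(x <- S) dsum_gpr x (u, v) = (\sum_(x <- S) gpr x u,
  \sum_(x <- S) gpr x v) :> V.
  elim: S => [|x S IH]; first by rewrite !big_nil.
  by rewrite !big_cons IH.
congr pair; [apply: (supp_sub (gprP M) us _ es)|apply: (supp_sub (gprP N) ut _ et)];
  rewrite ?undup_uniq // => x xs; by rewrite mem_undup mem_cat xs ?orbT.
Qed.

Lemma dsum_gpr_act x y a (m : V) :
  homog wt x a -> homog dsum_gpr y m -> homog dsum_gpr (x + y) (a *: m).
Proof.
case: m => u v ha [hu hv]; rewrite /homog /dsum_gpr /=.
by congr pair; apply: gpr_act.
Qed.

Lemma dsum_fg :
  exists n (g : 'I_n -> V), forall m, exists c : 'I_n -> A, m = \sum_i c i *: g i.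
Proof.
have [p [g hg]] := gfg M; have [q [h hh]] := gfg N.
exists (p + q)%N, (fun i => match fintype.split i with inl j => (g j,
  0) | inr j => (0, h j) end).
move=> [u v]; have [c ->] := hg u; have [d ->] := hh v.
exists (fun i => match fintype.split i with inl j => c j | inr j => d j end).
rewrite big_split_ord /=.
rewrite (eq_bigr (fun i => (c i *: g i, 0) : V)); last first.
  by move=> i _; rewrite (unsplitK (inl i)); congr pair; rewrite scaler0.
rewrite [X in _ + X](eq_bigr (fun i => (0, d i *: h i) : V)); last first.
  by move=> i _; rewrite (unsplitK (inr i)); congr pair; rewrite scaler0.
have -> : \sum_(i < p) ((c i *: g i, 0) : V) = (\sum_(i < p) c i *: g i, 0).
  by apply/esym/(big_morph (fun u => (u, 0) : V)) => // x y; congr pair; rewrite addr0.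
have -> : \sum_(i < q) ((0, d i *: h i) : V) = (0, \sum_(i < q) d i *: h i).
  by apply/esym/(big_morph (fun u => (0, u) : V)) => // x y; congr pair; rewrite addr0.
by congr pair; rewrite ?addr0 ?add0r.
Qed.

Definition dsum : grmod := GrMod dsum_gprP dsum_gpr_act dsum_fg.

Lemma dsum_biprod : exists (i1 : Hom M dsum) (i2 : Hom N dsum)
  (p1 : Hom dsum M) (p2 : Hom dsum N), is_biproduct i1 i2 p1 p2.
Proof.
have l1 : linear (fun u : M => (u, 0) : dsum).
  by move=> a u v; congr pair; rewrite /= scaler0 addr0.
have l2 : linear (fun u : N => (0, u) : dsum).
  by move=> a u v; congr pair; rewrite /= scaler0 addr0.
have g1 x (u : M) : ((gpr x u, 0) : dsum) = gpr x ((u, 0) : dsum) by congr pair;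
  rewrite gpr0.
have g2 x (u : N) : ((0, gpr x u) : dsum) = gpr x ((0, u) : dsum) by congr pair;
  rewrite gpr0.
have l3 : linear (fun u : dsum => u.1 : M) by [].
have l4 : linear (fun u : dsum => u.2 : N) by [].
exists (mkhom l1 g1), (mkhom l2 g2), (mkhom l3 (fun _ _ => erefl)),
  (mkhom l4 (fun _ _ => erefl)).
split; apply: hom_ext => // -[u v]; rewrite ap_add !ap_comp !mkhomE ap_id.
by congr pair; rewrite ?addr0 ?add0r.
Qed.

End Biproduct.

(** The module [M0] only serves to construct a zero object. *)
Lemma grmodcat_abelian (M0 : grmod) : abelian C.
Proof.
split=> [|M N|M N f|M N f|M N f /monoP fi|M N f /epiP fs].
- pose z := gsub_zero M0; exists (subobj z); apply/zeroP => m; apply: (sub_incl_inj z).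
  by rewrite ap0; apply/(sub_inclP z); exists m.
- by exists (dsum M N); apply: dsum_biprod.
- exists (subobj (gker_gsub f)), (sub_incl (gker_gsub f)); apply/kernelP.
  by split=> [|m]; [apply: sub_incl_inj|rewrite sub_inclP].
- exists (quotobj (gimg_gsub f)), (quot_proj (gimg_gsub f)); apply/cokernelP.
  by split=> [|m]; [apply: quot_proj_surj|rewrite quot_proj_eq0].
- exists (quotobj (gimg_gsub f)), (quot_proj (gimg_gsub f)); apply/kernelP.
  by split=> // m; rewrite quot_proj_eq0.
- exists (subobj (gker_gsub f)), (sub_incl (gker_gsub f)); apply/cokernelP.
  by split=> // m; rewrite sub_inclP.
Qed.

End Exactness.
(** * Simple objects, finite length and projective covers *)

Section Length.
Context {K : fieldType} {X : zmodType} {A : falgType K} {wt : X -> A -> A}.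
Notation grmod := (grmod wt).
Notation C := (grmodcat wt).
Notation Hom M N := (@hom K (grmodcat wt) M N).
Implicit Types M N L : grmod.

Lemma simpleP M : @is_simple K C M <->
  (exists m : M, m <> 0) /\
  forall P : M -> Prop, gsub P -> (forall m, P m -> m = 0) \/ (forall m, P m).
Proof.
split=> [[nz h]|[[m nz] h]].
  split.
    apply: contrapT => /forallNP e; apply: nz; apply/zeroP => m.
    by apply: contrapT; apply: e.
  move=> P hP; have [] := h _ (sub_incl hP).
  - exact/monoP/sub_incl_inj.
  - by move=> /zeroP z; left=> m /(sub_inclP hP)[t <-]; rewrite (z t) ap0.
  - by move=> /isoP[_ s]; right=> m; apply/(sub_inclP hP).
split; first by move=> /zeroP z; apply: nz.
move=> W f /monoP fi; have [z|z] := h _ (gimg_gsub f); [left|right].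
  by apply/zeroP => u; apply: fi; rewrite ap0; apply: z; exists u.
by apply/isoP; split.
Qed.

Lemma gsub_dim M (P Q : M -> Prop) (hP : gsub P) (hQ : gsub Q) :
  (forall m, P m -> Q m) -> (gdim (subobj hP) <= gdim (subobj hQ))%N /\
  (gdim (subobj hP) = gdim (subobj hQ) -> forall m, Q m -> P m).
Proof.
move=> PQ; have [|i /ap_comp_eq iE] := hom_lift (g := sub_incl hP) (sub_incl_inj hQ).
  by move=> t; apply/(sub_inclP hQ)/PQ/(sub_inclP hP); exists t.
have ii : injective (ap i).
  by move=> u v e; apply: (sub_incl_inj hP); rewrite -!iE e.
have [le eq] := ap_inj_dim ii; split=> // /eq s m /(sub_inclP hQ)[t <-].
by have [u <-] := s t; rewrite iE; apply/(sub_inclP hP); exists u.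
Qed.

Lemma gsub_dim_le M (P : M -> Prop) (hP : gsub P) : (gdim (subobj hP) <= gdim M)%N /\
  (gdim (subobj hP) = gdim M -> forall m, P m).
Proof.
have [le eq] := ap_inj_dim (sub_incl_inj hP); split=> // /eq s m.
exact/(sub_inclP hP).
Qed.

Lemma gsub_preim M N (f : Hom M N) (Q : N -> Prop) : gsub Q -> gsub (fun m => Q (ap f m)).
Proof.
move=> hQ; split=> [|a u v hu hv|x u hu]; first by rewrite ap0; apply: gsub0.
  by rewrite apL; apply: gsubL.
by rewrite ap_gpr; apply: gsub_gpr.
Qed.

Lemma gsub_image M N (f : Hom M N) (Q : M -> Prop) : gsub Q ->
  gsub (fun n => exists2 m, Q m & ap f m = n).
Proof.
move=> hQ; split=> [|a _ _ [u Qu <-] [v Qv <-]|x _ [u Qu <-]].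
- by exists 0; [apply: gsub0|apply: ap0].
- by exists (a *: u + v); [apply: gsubL|apply: apL].
- by exists (gpr x u); [apply: gsub_gpr|apply: ap_gpr].
Qed.

Lemma gsub_all M : gsub (fun _ : M => True). Proof. by split. Qed.

(** A proper graded submodule of maximal dimension. *)
Lemma max_gsub M : (exists m : M, m <> 0) ->
  exists (P : M -> Prop) (hP : gsub P), @is_simple K C (quotobj hP).
Proof.
move=> [m0 nz].
pose D n := `[< exists (P : M -> Prop) (hP : gsub P),
  ~ (forall m, P m) /\ gdim (subobj hP) = n >].
have exD : exists n, D n.
  exists (gdim (subobj (gsub_zero M))); apply/asboolP; exists _, (gsub_zero M).
  by split=> // /(_ m0).
have ubD n : D n -> (n <= gdim M)%N.
  by move=> /asboolP[P [hP [_ <-]]]; have [] := gsub_dim_le hP.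
case: (ex_maxnP exD ubD) => n /asboolP[P [hP [Pp dP]]] max.
exists P, hP; apply/simpleP; split.
  apply: contrapT => /forallNP e; apply: Pp => m; apply/(quot_proj_eq0 hP).
  by apply: contrapT; apply: e.
move=> Q hQ; pose hR := gsub_preim (quot_proj hP) hQ.
have PR m : P m -> Q (ap (quot_proj hP) m).
  by move=> /(quot_proj_eq0 hP) ->; apply: gsub0 hQ.
have [[m Rm]|allR] := pselect (exists m, ~ Q (ap (quot_proj hP) m)); last first.
  right=> t; have [m <-] := quot_proj_surj hP t.
  by apply: contrapT => h; apply: allR; exists m.
left=> t; have [u <-] := quot_proj_surj hP t => Qu; apply/(quot_proj_eq0 hP).
have [le eq] := gsub_dim hP hR PR; apply: (eq _ _ Qu).
apply/eqP; rewrite eqn_leq le dP /=; apply: max; apply/asboolP.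
by exists _, hR; split=> // /(_ m).
Qed.

Lemma sub_quot_exact M (P : M -> Prop) (hP : gsub P) :
  sexact (sub_incl hP) (quot_proj hP).
Proof.
split; [exact: sub_incl_inj|exact: quot_proj_surj|].
by move=> m; rewrite quot_proj_eq0 sub_inclP.
Qed.

Lemma grmodcat_finite_length : finite_length C.
Proof.
move=> M; have [n] := ubnP (gdim M); elim: n => // n IH in M *.
rewrite ltnS => leMn.
have [nz|z] := pselect (exists m : M, m <> 0); last first.
  apply: Filtered0; apply/zeroP => m.
  by apply: contrapT => h; apply: z; exists m.
have [P [hP sP]] := max_gsub nz.
have [le eq] := gsub_dim_le hP.
apply: (FilteredS _ (IH (subobj hP) _) sP).
  by apply/exactP; apply: sub_quot_exact.
apply: leq_trans leMn; rewrite ltn_neqAle le andbT; apply/eqP => /eq allP.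
have [[t nt] _] := (simpleP _).1 sP; apply: nt.
by have [m <-] := quot_proj_surj hP t; apply/(quot_proj_eq0 hP).
Qed.

Lemma filtered_iso (F : C -> Prop) M N (f : Hom M N) : injective (ap f) -> onto f ->
  filtered F M -> filtered F N.
Proof.
move=> fi fs h; case: h f fi fs => [x /zeroP z|x y z k g /exactP[ki gs kg] Fx Fz] f fi fs.
  apply: Filtered0; apply/zeroP => n.
  by have [m <-] := fs n; rewrite (z m) ap0.
have [h hE] := hom_inverse fi fs.
have [hf fh] := hE; have hf' := ap_comp_eq hf; have fh' := ap_comp_eq fh.
apply: (@FilteredS _ _ _ x N z (f \oc k) (g \oc h)) => //; apply/exactP; split.
- by move=> u v e; apply: ki; apply: fi.
- by move=> u; have [v <-] := gs u; exists (ap f v); rewrite ap_comp hf'.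
move=> n; rewrite ap_comp kg; split=> [[l e]|[l <-]]; exists l.
  by rewrite ap_comp e fh'.
by rewrite ap_comp hf'.
Qed.

(** Induction on the filtration of [N]: pull back its last step to [M]. *)
Lemma filtered_ext (F : C -> Prop) L M N (f : Hom L M) (g : Hom M N) :
  sexact f g -> filtered F L -> filtered F N -> filtered F M.
Proof.
move=> fg FL FN; elim: FN M f g fg => {N} [N /zeroP z|N1 N N2 k q /exactP[ki qs kq]
  _ IH FN2] M f g [fi gs fg].
  by apply: (filtered_iso (f := f)) => // m; apply/fg/z.
pose hP := gker_gsub (q \oc g); have si := sub_incl_inj hP.
refine (@FilteredS K C F (subobj hP) M N2 (sub_incl hP) (q \oc g) _ _ FN2).
  apply/exactP; split=> // [n|m]; last by rewrite sub_inclP.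
  by have [u <-] := qs n; have [m <-] := gs u; exists m.
have [|f' /ap_comp_eq f'E] := hom_lift (g := f) si.
  move=> l; apply/(sub_inclP hP); rewrite ap_comp.
  by have /fg -> : exists l', ap f l' = ap f l; [exists l|apply: ap0].
have [|g' /ap_comp_eq g'E] := hom_lift (g := g \oc sub_incl hP) ki.
  by move=> t; apply/kq; rewrite -!ap_comp compA; apply/(sub_inclP hP); exists t.
apply: (IH (subobj hP) f' g'); split.
- by move=> u v e; apply: fi; rewrite -!f'E e.
- move=> n; have [m mE] := gs (ap k n).
  have /(sub_inclP hP)[t tE] : ap (q \oc g) m = 0 by rewrite ap_comp mE; apply/kq; exists n.
  by exists t; apply: ki; rewrite g'E ap_comp tE mE.
move=> t; split=> [e|[l <-]].
  have /fg[l lE] : ap g (ap (sub_incl hP) t) = 0 by rewrite -ap_comp -g'E e ap0.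
  by exists l; apply: si; rewrite f'E.
by apply: ki; rewrite g'E ap0 ap_comp f'E; apply/fg; exists l.
Qed.

(** ** Projectives *)

Lemma projective_retract M N (i : Hom M N) (r : Hom N M) :
  r \oc i = idm (M : C) -> @is_projective K C N -> @is_projective K C M.
Proof.
move=> ri pN x y g f ge; have [h hE] := pN x y g (f \oc r) ge.
by exists (h \oc i); rewrite compA hE -compA ri compm1.
Qed.

(** Among the graded submodules of a projective [P] that still map onto [M],
    one of minimal dimension is a direct summand: lift [P -> M] to it, and the
    lift restricts to a surjective, hence bijective, endomorphism. *)
Lemma proj_cover_exists M P (p : Hom P M) : @is_projective K C P -> onto p ->
  exists (Q : C) (q : @hom K C Q M), is_proj_cover q.
Proof.
move=> pP ps.
pose D n := `[< exists (S : P -> Prop) (hS : gsub S),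
  onto (p \oc sub_incl hS) /\ gdim (subobj hS) = n >].
have exD : exists n, D n.
  exists (gdim (subobj (gsub_all P))); apply/asboolP; exists _, (gsub_all P).
  split=> // m; have [u <-] := ps m.
  by have [t <-] := (sub_inclP (gsub_all P) u).2 I; exists t.
case: (ex_minnP exD) => n /asboolP[S [hS [Ss dS]]] min.
(* Minimality says precisely that the restriction of [p] to [S] is essential. *)
have small W (g : Hom W (subobj hS)) : onto ((p \oc sub_incl hS) \oc g) -> onto g.
  move=> gs; pose hR := gimg_gsub (sub_incl hS \oc g).
  have RS m : (exists w, ap (sub_incl hS \oc g) w = m) -> S m.
    by move=> [w <-]; apply/(sub_inclP hS); exists (ap g w).
  have [le eq] := gsub_dim hR hS RS => t.
  have [] : exists w, ap (sub_incl hS \oc g) w = ap (sub_incl hS) t.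
    apply: eq; last by apply/(sub_inclP hS); exists t.
    apply/eqP; rewrite eqn_leq le dS; apply: min; apply/asboolP.
    exists _, hR; split=> // m; have [w <-] := gs m.
    have [u uE] := (sub_inclP hR (ap (sub_incl hS \oc g) w)).2 (ex_intro _ w erefl).
    by exists u; rewrite ap_comp uE.
  by move=> w /(sub_incl_inj hS) <-; exists w.
have [|phi phiE] := pP _ _ (p \oc sub_incl hS) p; first exact/epiP.
pose psi : Hom (subobj hS) (subobj hS) := phi \oc sub_incl hS.
have psiE : (p \oc sub_incl hS) \oc psi = p \oc sub_incl hS by rewrite compA phiE.
have psis : onto psi by apply: small; rewrite psiE.
have [_ /(_ erefl) psii] := ap_surj_dim psis.
have [chi [chipsi psichi]] := hom_inverse psii psis.
exists (subobj hS), (p \oc sub_incl hS); split.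
- by apply: (@projective_retract _ _ (sub_incl hS) (chi \oc phi) _ pP); rewrite -compA.
- exact/epiP.
- by move=> W g /epiP gs; apply/epiP; apply: small.
Qed.

End Length.

(** ** Free modules *)

Section Free.
Context {K : fieldType} {X : zmodType} {A : falgType K} {wt : X -> A -> A}.
Hypothesis wtP : is_alg_grading wt.
Notation grmod := (grmod wt).
Notation C := (grmodcat wt).
Notation Hom M N := (@hom K (grmodcat wt) M N).

Lemma wt_mull x z a b : homog wt x a -> wt z (a * b) = a * wt (z - x) b.
Proof.
have wg := wtP.1; move=> ha; have [s us e] := pr_ex wg b.
rewrite [in LHS]e [in RHS]e mulr_sumr !(pr_sum wg) mulr_sumr.
apply: eq_bigr => y _; rewrite (homog_pr wg _ (wtP.2 _ _ _ _ ha (pr_homog wg y b))).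
rewrite (prK wg) (can2_eq (subrK x) (addrK x)) [y + x]addrC.
by case: ifP; rewrite ?mulr0.
Qed.

Lemma wt_mulr y z a b : homog wt y b -> wt z (a * b) = wt (z - y) a * b.
Proof.
have wg := wtP.1; move=> hb; have [s us e] := pr_ex wg a.
rewrite [in LHS]e [in RHS]e mulr_suml !(pr_sum wg) mulr_suml.
apply: eq_bigr => x _; rewrite (homog_pr wg _ (wtP.2 _ _ _ _ (pr_homog wg x a) hb)).
by rewrite (prK wg) (can2_eq (subrK y) (addrK y)); case: ifP; rewrite ?mul0r.
Qed.

(** The component of degree [0] of the unit is a left unit on homogeneous
    elements, by comparing degrees in [1 * a = a]. *)
Lemma wt1 : homog wt 0 (1 : A).
Proof.
have wg := wtP.1.
have hom1 y a : homog wt y a -> wt 0 1 * a = a.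
  by move=> ha; rewrite -{1}(subrr y) -(wt_mulr _ _ ha) mul1r.
have left a : wt 0 (1 : A) * a = a.
  have [s us e] := pr_ex wg a; rewrite {1}e mulr_sumr {2}e.
  by apply: eq_bigr => y _; apply: (@hom1 y); apply: pr_homog.
by rewrite /homog -[RHS]left mulr1.
Qed.

Variables (J : finType) (w : J -> X).
Let V : lmodType A := {ffun J -> A^o}.

(** Shifted so that the generator [j] has degree [w j]. *)
Definition free_gpr x (c : V) : V := [ffun j => wt (x - w j) (c j)].

Lemma free_gprP : is_grading (free_gpr : X -> restr V -> restr V).
Proof.
have wg := wtP.1.
split=> [x|x y c|c].
- apply: (@restr_linear _ _ V V (free_gpr x)) => [c d|k c]; apply/ffunP => j.
    by rewrite !ffunE (prD wg).
  rewrite !ffunE.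
  have e (a : A^o) : k%:A *: a = k *: (a : A) by rewrite -[RHS]mul1r -scalerAr scalerAl.
  by rewrite !e (prZ wg).
- apply/ffunP => j; rewrite !ffunE (prK wg) (inj_eq (addIr _)).
  by case: ifP; rewrite !ffunE.
have [s us hs] := pr_unif wg (fdim_vect A).
pose S := undup [seq x + w j | x <- s, j <- enum J].
exists S; first exact: undup_uniq.
apply/ffunP => j; rewrite (sum_ffunE (rT := A^o)) /=.
have -> : \sum_(x <- S) free_gpr x c j = \sum_(y <- [seq x - w j | x <- S]) wt y (c j).
  by rewrite big_map; apply: eq_bigr => x _; rewrite ffunE.
apply: (supp_sub wg us _ (hs _)).
  by rewrite map_inj_uniq ?undup_uniq //; apply: addIr.
move=> x xs; apply/mapP; exists (x + w j); last by rewrite addrK.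
by rewrite mem_undup; apply/allpairsP; exists (x, j); rewrite xs mem_enum.
Qed.

Lemma free_gpr_act x y a (m : V) :
  homog wt x a -> homog free_gpr y m -> homog free_gpr (x + y) (a *: m).
Proof.
move=> ha hm; apply/ffunP => j; rewrite !ffunE.
have hj : homog wt (y - w j) (m j) by have /ffunP/(_ j) := hm; rewrite ffunE.
by rewrite -addrA; apply: wtP.2.
Qed.

Definition fgen (j : J) : V := [ffun i => if i == j then 1 else 0].

Lemma fgenE (c : V) : c = \sum_j c j *: fgen j.
Proof.
apply/ffunP => i; rewrite (sum_ffunE (rT := A^o)) (bigD1 i) //= big1 ?addr0.
  by rewrite !ffunE eqxx /= /GRing.scale /= mulr1.
by move=> j /negPf ji; rewrite !ffunE eq_sym ji scaler0.
Qed.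

Lemma free_fg :
  exists n (g : 'I_n -> V), forall m, exists c : 'I_n -> A, m = \sum_i c i *: g i.
Proof.
exists #|J|, (fun i => fgen (enum_val i)) => c; exists (fun i => c (enum_val i)).
by rewrite {1}(fgenE c) (reindex (@enum_val _ J)) //; apply: onW_bij; apply: enum_val_bij.
Qed.

Definition freeobj : grmod := GrMod free_gprP free_gpr_act free_fg.

Lemma fgen_homog j : homog (@gpr _ _ _ _ freeobj) (w j) (fgen j).
Proof.
apply/ffunP => i; rewrite !ffunE; case: eqP => [->|_]; last exact: (pr0 wtP.1).
by rewrite subrr wt1.
Qed.

Lemma free_hom (M : grmod) (m : J -> M) :
  (forall j, homog (@gpr _ _ _ _ M) (w j) (m j)) ->
  exists f : Hom freeobj M, forall c, ap f c = \sum_j (c : V) j *: m j.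
Proof.
move=> hm; pose f (c : freeobj) : M := \sum_j (c : V) j *: m j.
have fL : linear f.
  move=> a u v; rewrite /f scaler_sumr -big_split; apply: eq_bigr => j _.
  by rewrite !ffunE /= scalerDl scalerA.
have fG x c : f (gpr x c) = gpr x (f c).
  rewrite /f gpr_sum; apply: eq_bigr => j _.
  by rewrite ffunE (gpr_actr wtP _ _ (hm j)).
by exists (mkhom fL fG).
Qed.

Lemma free_hom_gen (M : grmod) (m : J -> M) (f : Hom freeobj M) :
  (forall c, ap f c = \sum_j (c : V) j *: m j) -> forall j, ap f (fgen j) = m j.
Proof.
move=> fE j; rewrite fE (bigD1 j) //= big1 ?addr0 ?ffunE ?eqxx ?scale1r //.
by move=> i /negPf ij; rewrite ffunE ij scale0r.
Qed.

Lemma free_projective : @is_projective K C freeobj.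
Proof.
move=> x y g f /epiP gs.
have ex j : exists m : (x : grmod), homog (@gpr _ _ _ _ (x : grmod)) (w j) m /\
    ap g m = ap f (fgen j).
  have [m mE] := gs (ap f (fgen j)); exists (gpr (w j) m).
  split; first exact: gpr_homog.
  by rewrite ap_gpr mE -ap_gpr; congr (ap f _); apply: fgen_homog.
have [m mP] := choice ex.
have [h hE] := free_hom (fun j => (mP j).1).
exists h; apply: hom_ext => c; rewrite ap_comp hE ap_sum.
rewrite {2}(fgenE c) (@ap_sum _ _ _ _ freeobj); apply: eq_bigr => j _.
by rewrite apZ (mP j).2 (@apZ _ _ _ _ freeobj).
Qed.

End Free.

Section EnoughProjectives.
Context {K : fieldType} {X : zmodType} {A : falgType K} {wt : X -> A -> A}.
Hypothesis wtP : is_alg_grading wt.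
Notation grmod := (grmod wt).
Notation C := (grmodcat wt).
Notation Hom M N := (@hom K (grmodcat wt) M N).

(** The homogeneous components of a finite system of generators, one for each
    degree of the finite support of [M], are the images of free generators. *)
Lemma grmodcat_proj_epi (M : grmod) :
  exists (P : grmod) (p : Hom P M), @is_projective K C P /\ onto p.
Proof.
have [n [g hg]] := gfg M; have [s us hs] := gpr_unif M.
pose J := ('I_n * 'I_(size s))%type; pose w (j : J) := s`_j.2.
have [|f fE] := @free_hom _ _ _ _ wtP J w M (fun j => gpr (w j) (g j.1)).
  by move=> j; apply: gpr_homog.
exists (freeobj wtP w), f; split; first exact: free_projective.
move=> m; have [c ->] := hg m.
exists [ffun j : J => (c j.1 : A^o)]; rewrite fE.
rewrite (eq_bigr (fun j : J => c j.1 *: gpr (w j) (g j.1))); last first.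
  by move=> j _; rewrite ffunE.
rewrite -(pair_bigA _ (fun i (k : 'I_(size s)) => c i *: gpr s`_k (g i))) /=.
apply: eq_bigr => i _; rewrite [in RHS](hs (g i)) (big_nth 0) big_mkord.
by rewrite scaler_sumr.
Qed.

Lemma grmodcat_enough_proj : enough_projectives C.
Proof.
move=> M; have [P [p [pP ps]]] := grmodcat_proj_epi M.
by exists P, p; split=> //; apply/epiP.
Qed.

Lemma grmodcat_proj_cover (M : C) : exists (Q : C) (q : hom Q M), is_proj_cover q.
Proof. by have [P [p [pP ps]]] := grmodcat_proj_epi M; apply: proj_cover_exists pP ps. Qed.

End EnoughProjectives.
(** * Serre quotients from exact adjunctions *)

Section SerreQuotients.
Context {K : fieldType}.
Implicit Types C D E : lincat K.

Lemma exact_zero_iso C (x y z : C) (k : hom x y) (e : hom y z) :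
  short_exact k e -> is_zero x -> is_iso e.
Proof.
move=> [_ [ek coker]] [_ z0].
have [|h [hE _]] := coker y (idm y); first by rewrite comp1m (z0 _ k).
exists h; split=> //.
have [u [_ uu]] := coker z e ek.
rewrite -(uu (idm z)) ?comp1m //; apply/esym/uu.
by rewrite -compA hE compm1.
Qed.

Lemma exact_iso_zero C (x y z : C) (k : hom x y) (e : hom y z) :
  short_exact k e -> is_zero z -> is_iso k.
Proof.
move=> [[ek ker] _] [z0 _].
have [|h [hE _]] := ker y (idm y); first by rewrite compm1 (z0 _ e).
exists h; split=> //.
have [u [_ uu]] := ker x k ek.
rewrite -(uu (idm x)) ?compm1 //; apply/esym/uu.
by rewrite compA hE comp1m.
Qed.

Lemma iso_comp C (x y z : C) (g : hom y z) (f : hom x y) :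
  is_iso g -> is_iso f -> is_iso (g \oc f).
Proof.
move=> [g' [g'g gg']] [f' [f'f ff']]; exists (f' \oc g'); split.
  by rewrite compA -(compA f') g'g compm1.
by rewrite compA -(compA g) ff' compm1.
Qed.

Lemma iso_sym C (x y : C) : isomorphic x y -> isomorphic y x.
Proof. by move=> [f [g [gf fg]]]; exists g, f. Qed.

Lemma iso_trans C (x y z : C) :
  isomorphic x y -> isomorphic y z -> isomorphic x z.
Proof. by move=> [f fi] [g gi]; exists (g \oc f); apply: iso_comp. Qed.

(** Invertibility modulo [S]: kernel and cokernel lie in [S].  The image
    factorization is part of the data, because an exact functor is applied to
    its two short exact sequences. *)
Definition S_iso C (S : C -> Prop) (x y : C) (f : hom x y) : Prop :=
  exists (k i c : C) (kk : hom k x) (e : hom x i) (m : hom i y) (cc : hom y c),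
    [/\ short_exact kk e, short_exact m cc, f = m \oc e, S k & S c].

Lemma S_iso_iso C E (S : C -> Prop) (F : linfunctor C E) (x y : C) (f : hom x y) :
  exact F -> (forall x, S x -> is_zero (F x)) -> S_iso S f -> is_iso (fmap F _ _ f).
Proof.
move=> Fex FS [k [i [c [kk [e [m [cc [ke mc -> Sk Sc]]]]]]]].
rewrite fmapM; apply: iso_comp.
  by apply: (exact_iso_zero (Fex _ _ _ _ _ mc)); apply: FS.
by apply: (exact_zero_iso (Fex _ _ _ _ _ ke)); apply: FS.
Qed.

Lemma fmap_iso C D (F : linfunctor C D) (x y : C) (f : hom x y) :
  is_iso f -> is_iso (fmap F _ _ f).
Proof. by move=> [g [gf fg]]; exists (fmap F _ _ g); rewrite -!fmapM gf fg !fmap1. Qed.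

Lemma comp_exact C D E (G : linfunctor D E) (F : linfunctor C D) :
  exact G -> exact F -> exact (fcomp G F).
Proof. by move=> hG hF x y z f g /hF /hG. Qed.

(** An exact [F] that kills [S] inverts the counit [eps], so it is isomorphic to
    [F \o De] after [pi].  A natural transformation between functors composed
    with [pi] is determined on the image of [De], where the invertible unit
    carries it over to all objects. *)
Lemma serre_quotient_of_adjoint C D (S : C -> Prop) (pi : linfunctor C D)
    (De : linfunctor D C) (eta : forall d, hom d (pi (De d)))
    (eps : forall c, hom (De (pi c)) c) :
  abelian D -> exact pi -> exact De ->
  (forall d d' (f : hom d d'), eta d' \oc f = fmap pi _ _ (fmap De _ _ f) \oc eta d) ->
  (forall d, is_iso (eta d)) ->
  (forall c c' (f : hom c c'), eps c' \oc fmap De _ _ (fmap pi _ _ f) = f \oc eps c) ->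
  (forall c, fmap pi _ _ (eps c) \oc eta (pi c) = idm (pi c)) ->
  (forall x, S x -> is_zero (pi x)) -> (forall c, S_iso S (eps c)) ->
  is_serre_quotient S pi.
Proof.
move=> Dab piex Deex etan etai epsn triangle piS epsS; split=> //.
- move=> E F Eab Fex FS; exists (fcomp F De); split; first exact: comp_exact.
  exists (fun c => fmap F _ _ (eps c)); split=> [c c' f|c] /=.
    by rewrite -!fmapM epsn.
  exact: S_iso_iso Fex FS (epsS c).
move=> E G H Eab Gex Hex a an.
have an' x y (f : hom x y) : a y \oc fmap G _ _ (fmap pi _ _ f) =
    fmap H _ _ (fmap pi _ _ f) \oc a x := an x y f.
(* The inverse of the unit; on the image of [pi] it is the image of the counit. *)
pose g d := sval (cid (etai d)).
have [ge eg] : (forall d, g d \oc eta d = idm d) /\ (forall d, eta d \oc g d = idm _).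
  by split=> d; have [] := svalP (cid (etai d)).
have gn d d' (f : hom d d') : g d' \oc fmap pi _ _ (fmap De _ _ f) = f \oc g d.
  rewrite -[LHS]compm1 -eg -compA (compA (fmap pi _ _ _)) -etan.
  by rewrite !compA ge comp1m.
have gpi x : g (pi x) = fmap pi _ _ (eps x).
  by rewrite -[RHS]compm1 -eg compA triangle comp1m.
pose b d : hom (G d) (H d) := fmap H _ _ (g d) \oc a (De d) \oc fmap G _ _ (eta d).
exists b; split=> [d d' f|x|b' b'n b'a d].
- rewrite /b -[LHS]compA -fmapM etan fmapM -compA (compA (a _)) an'.
  by rewrite !compA -!fmapM gn.
- by rewrite /b gpi -an' -compA -fmapM triangle fmap1 compm1.
have := b'n _ _ (eta d); rewrite b'a /b -compA => ->.
by rewrite compA -fmapM ge fmap1 comp1m.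
Qed.

End SerreQuotients.
(** * Coordinates attached to a triangular decomposition *)

Section ProductSpaces.
Context {K : fieldType} {A : falgType K}.
Implicit Types U W : {vspace A}.

Section Matrix.
Variables (U W : {vspace A}) (p q : nat) (us : p.-tuple A) (ws : q.-tuple A).
Hypotheses (usP : basis_of U us) (wsP : basis_of W ws).

Definition prod_mx (M : 'M[K]_(p, q)) : A :=
  \sum_i \sum_j M i j *: (us`_i * ws`_j).

Lemma prod_mx_linear : linear prod_mx.
Proof.
move=> c M N; rewrite /prod_mx scaler_sumr -big_split; apply: eq_bigr => i _.
rewrite scaler_sumr -big_split; apply: eq_bigr => j _.
by rewrite !mxE scalerDl scalerA.
Qed.

Lemma prod_mx_img : (U * W <= limg (linfun (mklin prod_mx_linear)))%VS.
Proof.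
apply/prodvP => u w Uu Ww; apply/memv_imgP.
exists (\matrix_(i, j) (coord us i u * coord ws j w)); first exact: memvf.
rewrite lfunE /= {1}(coord_basis usP Uu) {1}(coord_basis wsP Ww) mulr_suml.
apply: eq_bigr => i _; rewrite mulr_sumr; apply: eq_bigr => j _.
by rewrite mxE -scalerAl -scalerAr scalerA.
Qed.

Lemma prod_mxP a : a \in (U * W)%VS -> exists M, a = prod_mx M.
Proof.
move=> /(subvP prod_mx_img) /memv_imgP[M _ ->]; exists M.
by rewrite lfunE.
Qed.

(** The products of basis vectors span, so when the dimension is as large as
    possible they are independent. *)
Lemma prod_mx_inj M : (p * q <= \dim (U * W))%N -> prod_mx M = 0 -> M = 0.
Proof.
move=> le e.
have := limg_ker_dim (linfun (mklin prod_mx_linear)) fullv.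
rewrite capfv dimvf /dim /= => dE.
have /eqP : \dim (lker (linfun (mklin prod_mx_linear))) = 0%N.
  apply/eqP; rewrite -leqn0 -(leq_add2r (p * q)) add0n -{2}dE leq_add2l.
  exact: leq_trans le (dimvS prod_mx_img).
rewrite dimv_eq0 => /eqP k0; apply/eqP; rewrite -memv0 -k0 memv_ker lfunE /=.
exact/eqP.
Qed.

Lemma prodv_right a : a \in (U * W)%VS ->
  exists w : 'I_p -> A, (forall i, w i \in W) /\ a = \sum_(i < p) us`_i * w i.
Proof.
move=> /prod_mxP[M ->]; exists (fun i => \sum_j M i j *: ws`_j); split=> [i|].
  apply: memv_suml => j _; apply/memvZ/(basis_mem wsP)/mem_nth.
  by rewrite size_tuple.
apply: eq_bigr => i _; rewrite mulr_sumr; apply: eq_bigr => j _.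
by rewrite scalerAr.
Qed.

Lemma prodv_right_uniq (w : 'I_p -> A) : (p * q <= \dim (U * W))%N ->
  (forall i, w i \in W) -> \sum_(i < p) us`_i * w i = 0 -> forall i, w i = 0.
Proof.
move=> le wW e i.
have wE k : w k = \sum_j coord ws j (w k) *: ws`_j := coord_basis wsP (wW k).
have M0 : (\matrix_(k, j) coord ws j (w k)) = 0 :> 'M_(p, q).
  apply: (prod_mx_inj le); rewrite -[RHS]e; apply: eq_bigr => k _.
  rewrite [in RHS]wE mulr_sumr; apply: eq_bigr => j _.
  by rewrite mxE scalerAr.
rewrite wE big1 // => j _; have /matrixP/(_ i j) := M0.
by rewrite !mxE => ->; rewrite scale0r.
Qed.

Lemma prodv_left a : a \in (U * W)%VS ->
  exists u : 'I_q -> A, (forall j, u j \in U) /\ a = \sum_(j < q) u j * ws`_j.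
Proof.
move=> /prod_mxP[M ->]; exists (fun j => \sum_i M i j *: us`_i); split=> [j|].
  apply: memv_suml => i _; apply/memvZ/(basis_mem usP)/mem_nth.
  by rewrite size_tuple.
rewrite /prod_mx exchange_big; apply: eq_bigr => j _; rewrite mulr_suml.
by apply: eq_bigr => i _; rewrite scalerAl.
Qed.

Lemma prodv_left_uniq (u : 'I_q -> A) : (p * q <= \dim (U * W))%N ->
  (forall j, u j \in U) -> \sum_(j < q) u j * ws`_j = 0 -> forall j, u j = 0.
Proof.
move=> le uU e j.
have uE k : u k = \sum_i coord us i (u k) *: us`_i := coord_basis usP (uU k).
have M0 : (\matrix_(i, k) coord us i (u k)) = 0 :> 'M_(p, q).
  apply: (prod_mx_inj le); rewrite -[RHS]e /prod_mx exchange_big; apply: eq_bigr => k _.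
  rewrite [in RHS]uE mulr_suml; apply: eq_bigr => i _.
  by rewrite mxE scalerAl.
rewrite uE big1 // => i _; have /matrixP/(_ i j) := M0.
by rewrite !mxE => ->; rewrite scale0r.
Qed.

End Matrix.

Lemma prodv_ind U W (P : A -> Prop) : P 0 ->
  (forall c x y, P x -> P y -> P (c *: x + y)) ->
  (forall u w, u \in U -> w \in W -> P (u * w)) ->
  forall a, a \in (U * W)%VS -> P a.
Proof.
move=> P0 PL PM a /(prod_mxP (vbasisP U) (vbasisP W))[M ->].
have PD x y : P x -> P y -> P (x + y) by move=> hx hy; rewrite -[x]scale1r; apply: PL.
apply: big_ind => // i _; apply: big_ind => // j _.
rewrite -[_ *: _]addr0; apply: PL => //; apply: PM.
  by apply/vbasis_mem/mem_nth; rewrite size_tuple.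
by apply/vbasis_mem/mem_nth; rewrite size_tuple.
Qed.

(** Scan [s] from the right and discard each vector spanned by the later ones;
    the prescribed free part [t] is kept. *)
Lemma free_extract (s t : seq A) : free t -> exists s' : seq A,
  [/\ {subset s' <= s}, free (s' ++ t) & (<<s' ++ t>> = <<s ++ t>>)%VS].
Proof.
move=> ft; elim: s => [|v s [s' [ss fs es]]]; first by exists [::].
case: (boolP (v \in <<s' ++ t>>%VS)) => vs.
  exists s'; split=> //; first by move=> u /ss us; rewrite inE us orbT.
  rewrite cat_cons span_cons -es; apply/esym/addv_idPr.
  by rewrite -memvE.
exists (v :: s'); split; last by rewrite !cat_cons !span_cons es.
  by move=> u; rewrite !inE => /predU1P[->|/ss ->]; rewrite ?eqxx ?orbT.
by rewrite cat_cons free_cons vs.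
Qed.

End ProductSpaces.

Section Coordinates.
Context {K : fieldType} {X : zmodType} {A : falgType K} (wt : X -> A -> A).
Context (n : nat) (I : 'I_n -> X).

(** The data extracted from a triangular decomposition: with [B = T A^+],
    [A] is a free right [B]-module with homogeneous basis [a] and coordinate
    functions [beta], and [B] is a projective left [T]-module with dual basis
    [(p, gam)]. *)
Record tri_coords (T : {aspace A}) (B : {vspace A}) (m : nat)
  (a : 'I_m.+1 -> A) (d : 'I_m.+1 -> X) (beta : 'I_m.+1 -> A -> A)
  (q : nat) (p : 'I_q -> A) (gam : 'I_q -> A -> A) : Prop := TriCoords {
  tcT1 : 1 \in T;
  tcT0 : forall t, t \in T -> homog wt 0 t;
  tcTB : forall t, t \in T -> t \in B;
  tcBM : forall b c, b \in B -> c \in B -> b * c \in B;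
  tcBg : forall x b, b \in B -> wt x b \in B;
  tcB_cone : forall x b, b \in B -> wt x b <> 0 -> cone I x;
  tcB0 : forall b, b \in B -> wt 0 b \in T;
  tc_a0 : a ord0 = 1;
  tc_d0 : d ord0 = 0;
  tc_d : forall j, d j = 0 -> j = ord0;
  tc_a : forall j, homog wt (d j) (a j);
  tc_cone : forall j, cone I (- d j);
  tc_betaB : forall j x, beta j x \in B;
  tc_beta : forall x, x = \sum_j a j * beta j x;
  tc_beta_uniq : forall b, (forall j, b j \in B) ->
    forall j, beta j (\sum_i a i * b i) = b j;
  tc_p : forall i, p i \in B;
  tc_gamT : forall i b, gam i b \in T;
  tc_gam : forall b, b \in B -> b = \sum_i gam i b * p i;
  tc_gamL : forall i t b c, t \in T -> b \in B -> c \in B ->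
    gam i (t * b + c) = t * gam i b + gam i c }.

Hypothesis wtP : is_alg_grading wt.

(** Extract a basis from [1] and the homogeneous components of nonzero degree of
    a basis: these span [U], since its component of degree [0] consists of
    scalars.  Hence [1] is the only basis vector of degree [0]. *)
Lemma homog_basis (U : {vspace A}) : 1 \in U -> (forall x u, u \in U -> wt x u \in U) ->
  (forall u, u \in U -> homog wt 0 u -> exists c : K, u = c%:A) ->
  exists m (a : m.+1.-tuple A) (d : 'I_m.+1 -> X),
  [/\ a`_0 = 1, d ord0 = 0, forall j, d j = 0 -> j = ord0,
      forall j, homog wt (d j) a`_j & basis_of U a].
Proof.
move=> U1 Ug U0; have wg := wtP.1.
have [s us hs] := pr_unif wg (fdim_vect A).
pose S := [seq wt x u | x <- [seq x <- s | x != 0], u <- vbasis U].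
pose one : seq A := [:: 1].
have f1 : free one by rewrite seq1_free oner_eq0.
have [s' [ss fs es]] := free_extract S f1.
have SU : {subset S <= U}.
  by move=> v /allpairsP[[x u] /= [_ /vbasis_mem uU ->]]; apply: Ug.
have spanE : <<S ++ one>>%VS = U.
  apply/eqP; rewrite eqEsubv; apply/andP; split.
    apply/span_subvP => v; rewrite mem_cat /one inE => /orP[/SU //|/eqP-> //].
  rewrite -{1}(span_basis (vbasisP U)); apply/span_subvP => u uU.
  rewrite (hs u); apply: memv_suml => x _; rewrite span_cat span_seq1.
  case: (eqVneq x 0) => [->|x0].
    have uU' := vbasis_mem uU.
    have [c ->] := U0 _ (Ug 0 _ uU') (pr_homog wg 0 u).
    by apply: (subvP (addvSr _ _)); apply/memvZ/memv_line.
  case: (boolP (x \in s)) => xs; last by rewrite (supp_out wg us (hs u) xs) mem0v.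
  apply/(subvP (addvSl _ _))/memv_span/allpairsP; exists (x, u).
  by rewrite mem_filter x0 xs.
have ex v : v \in s' -> exists x, x != 0 /\ homog wt x v.
  move=> /ss /allpairsP[[x u] /= [xs _ ->]]; exists x.
  by move: xs; rewrite mem_filter => /andP[-> _]; split=> //; apply: pr_homog.
have size1 : size (1 :: s') == (size s').+1 by [].
have exd (j : 'I_(size s').+1) : exists x, homog wt x (1 :: s')`_j /\ (x = 0 <-> j = ord0).
  case: j => -[|j] lj /=; first by exists 0; split; [apply: wt1|split=> // _;
    apply: val_inj].
  have /ex[x [x0 hx]] : s'`_j \in s' by apply: mem_nth.
  by exists x; split=> //; split=> [e|//]; rewrite e eqxx in x0.
have [d dP] := choice exd.
exists (size s'), (Tuple size1), d; split=> //.
- exact: (dP ord0).2.2.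
- by move=> j /(dP j).2.1.
- by move=> j; apply: (dP j).1.
rewrite /basis_of /=.
have pe : perm_eq (1 :: s') (s' ++ one) by rewrite perm_sym perm_catC.
rewrite (perm_free pe) fs andbT -spanE -es; apply/eqP/eq_span => v.
exact: (perm_mem pe).
Qed.

Variables (Am T Ap : {aspace A}).
Hypothesis htri : triangular_decomp wt I Am T Ap.

(** The multiplication map is bijective by a count: [A] has the dimension of
    the triple tensor product, which bounds the dimensions of both products
    from below. *)
Lemma tri_dims : [/\ ({:A} = Am * (T * Ap))%VS,
  (\dim Am * \dim (T * Ap) <= \dim (Am * (T * Ap)))%N &
  (\dim T * \dim Ap <= \dim (T * Ap))%N].
Proof.
have hb := td_mul htri.
have sp : ({:A} <= Am * (T * Ap))%VS.
  rewrite -(span_basis hb); apply/span_subvP => v /allpairsP[[u b] /= [uu bb ->]].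
  have /allpairsP[[x t] /= [xx tt ->]] := uu.
  by rewrite -mulrA; do 2?[apply: memv_mul]; apply: vbasis_mem.
have eA : ({:A} = Am * (T * Ap))%VS by apply/eqP; rewrite eqEsubv sp subvf.
have dA : \dim {:A} = (\dim Am * \dim T * \dim Ap)%N.
  by rewrite -(span_basis hb); have /eqP -> :=
    basis_free hb; rewrite !size_allpairs !size_tuple.
have := dim_prodv Am (T * Ap); have := dim_prodv T Ap.
rewrite -eA dA -mulnA => le1 le2; split=> //.
  by rewrite leq_mul2l le1 orbT.
by move: le2; rewrite leq_pmul2l ?adim_gt0.
Qed.

Lemma tri_coords_exist : exists (m : nat) (a : 'I_m.+1 -> A) (d : 'I_m.+1 -> X)
    (beta : 'I_m.+1 -> A -> A) (q : nat) (p : 'I_q -> A) (gam : 'I_q -> A -> A),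
  tri_coords T (Ap * T)%VS a d beta p gam.
Proof.
have wg := wtP.1.
have [eA d1 d2] := tri_dims.
have [Am1 Amg] := td_Am htri; have [T1 Tg] := td_T htri; have [Ap1 Apg] := td_Ap htri.
have [m [a [d [a0 d0 dn0 ah ab]]]] := homog_basis Am1 Amg (td_Am0 htri).
rewrite (td_ApT htri); set B := (T * Ap)%VS.
have dm : \dim Am = m.+1 by rewrite (size_basis ab).
pose Q b := forall x, [/\ wt x b \in B, wt 0 b \in T & wt x b <> 0 -> cone I x].
have Bwt b : b \in B -> Q b.
  move: b; apply: (@prodv_ind _ _ T Ap Q) => [x|c u v hu hv x|t p tT pA x].
  - by rewrite !(pr0 wg) !mem0v.
  - have [u1 u2 u3] := hu x; have [v1 v2 v3] := hv x.
    rewrite !(prD wg) !(prZ wg); split;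
      [by rewrite memvD // memvZ|by rewrite memvD // memvZ|].
    have [e|/eqP/u3 //] := eqVneq (wt x u) 0.
    by rewrite e scaler0 add0r.
  have tE y : wt y (t * p) = t * wt y p.
    by rewrite (wt_mull wtP _ _ (td_degT htri tT)) subr0.
  rewrite !tE; split; first by rewrite memv_mul // Apg.
    have [c ->] := td_Ap0 htri (Apg 0 _ pA) (pr_homog wg 0 p).
    by rewrite -scalerAr mulr1 memvZ.
  by move=> h; apply: (td_suppAp htri pA) => e; rewrite e mulr0 in h.
have TB t : t \in T -> t \in B by move=> tT; rewrite -[t]mulr1 memv_mul.
have BM b c : b \in B -> c \in B -> b * c \in B.
  move=> bB cB; suff /subvP : (B * B <= B)%VS by apply; apply: memv_mul.
  rewrite /B prodvA -(prodvA T) (td_ApT htri) prodvA prodv_id -prodvA prodv_id.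
  exact: subvv.
have exb x : exists b : 'I_m.+1 ->
  A, (forall j, b j \in B) /\ x = \sum_(j < m.+1) a`_j * b j.
  by apply: (prodv_right ab (vbasisP B)); rewrite -eA memvf.
have {exb}[b bP] := choice exb.
have leB : (m.+1 * \dim B <= \dim (Am * B))%N by rewrite -dm.
have exg c : exists u : 'I_(\dim Ap) -> A, (forall j, u j \in T) /\
    (c \in B -> c = \sum_(j < \dim Ap) u j * (vbasis Ap)`_j).
  case: (boolP (c \in B)) => [cB|_].
    by have [u [uT cE]] := prodv_left (vbasisP T) (vbasisP Ap) cB; exists u.
  by exists (fun=> 0); split=> // j; apply: mem0v.
have {exg}[g gP] := choice exg.
exists m, (fun j => a`_j), d, (fun j x => b x j), (\dim Ap), (fun j => (vbasis Ap)`_j),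
  (fun i c => g c i).
have pB (i : 'I_(\dim Ap)) : (vbasis Ap)`_i \in B.
  rewrite -[_`_i]mul1r memv_mul //; apply/vbasis_mem/mem_nth.
  by rewrite size_tuple.
split=> //.
- by move=> t tT; exact: (td_degT htri tT).
- by move=> x c /Bwt/(_ x)[].
- by move=> x c /Bwt/(_ x)[].
- by move=> c /Bwt/(_ 0)[].
- move=> j; have aj : a`_j \in (a : seq A) by apply: mem_nth; rewrite size_tuple.
  apply: (td_suppAm htri (basis_mem ab aj)); rewrite (ah j).
  by apply/eqP/(basis_not0 ab).
- by move=> j x; apply: (bP x).1.
- by move=> x; apply: (bP x).2.
- move=> c cB j; set x := \sum_i _; apply/eqP; rewrite -subr_eq0; apply/eqP.
  apply: (prodv_right_uniq ab (vbasisP B) leB (w := fun j => b x j - c j)) => [i|].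
    by rewrite memvB //; apply: (bP x).1.
  under eq_bigr do rewrite mulrBr.
  by rewrite sumrB -(bP x).2 subrr.
- by move=> i c; apply: (gP c).1.
- by move=> c; apply: (gP c).2.
move=> i t x y tT xB yB; apply/eqP; rewrite -subr_eq0; apply/eqP.
apply: (prodv_left_uniq (vbasisP T) (vbasisP Ap) d2
  (u := fun i => g (t * x + y) i - (t * g x i + g y i))) => [j|].
  by rewrite memvB ?memvD ?memvM //; apply: (gP _).1.
have txB : t * x \in B by apply: BM => //; apply: TB.
under eq_bigr do rewrite mulrBl mulrDl -mulrA.
rewrite sumrB big_split /= -mulr_sumr -!(gP _).2 ?memvD // subrr //.
Qed.

End Coordinates.
(** * Weight spaces and standard modules *)

Section TrivialGrading.
Context {K : fieldType} (T : falgType K).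

(** Finitely generated [T]-modules are treated as modules graded by the trivial
    group, realized as ['I_1], so that all of the above applies to them. *)
Definition wt_triv : 'I_1 -> T -> T := fun _ t => t.

Lemma wt_trivP : is_alg_grading wt_triv.
Proof.
split=> //; split=> [x|x y t|t] //; first by rewrite !ord1.
by exists [:: 0] => //; rewrite big_seq1.
Qed.

Notation D := (grmodcat wt_triv).

Lemma triv_gpr (N : grmod wt_triv) x (v : N) : gpr x v = v.
Proof. by apply: gpr_ext => y; rewrite gprK !ord1. Qed.

Section MkMod.
Variables (N : lmodType T) (hN : fdim (restr N)).

Lemma triv_gprP : is_grading (fun _ : 'I_1 => @id (restr N)).
Proof.
split=> [x|x y t|t] //; first by rewrite !ord1.
by exists [:: 0] => //; rewrite big_seq1.
Qed.

Definition tmod : grmod wt_triv :=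
  @GrMod K _ T wt_triv N (fun _ => @id N) triv_gprP
    (fun _ _ _ _ _ _ => erefl) ((fg_fdim N).2 hN).

End MkMod.

Lemma tmod_hom (N N' : grmod wt_triv) (f : N -> N') : linear f ->
  exists g : @hom K D N N', forall v, ap g v = f v.
Proof.
move=> fl; have fg x (v : N) : f (gpr x v) = gpr x (f v) by rewrite !triv_gpr.
by exists (mkhom fl fg).
Qed.

End TrivialGrading.

Section Standard.
Context {K : fieldType} {X : zmodType} {A : falgType K} {wt : X -> A -> A}.
Context {n : nat} {I : 'I_n -> X}.
Hypothesis wtP : is_alg_grading wt.
Context {T : {aspace A}} {B : {vspace A}} {m : nat}.
Context {a : 'I_m.+1 -> A} {d : 'I_m.+1 -> X} {beta : 'I_m.+1 -> A -> A}.
Context {q : nat} {p : 'I_q -> A} {gam : 'I_q -> A -> A}.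
Hypothesis hc : tri_coords wt I T B a d beta p gam.
Notation TT := (subvs_of T).
Notation grmod := (grmod wt).
Notation C := (grmodcat wt).
Notation Hom M N := (@hom K (grmodcat wt) M N).
Notation tmodcat := (grmodcat (@wt_triv K TT)).
Notation THom M N := (@hom K (grmodcat (@wt_triv K TT)) M N).

Lemma T_scalar c : c%:A \in T.
Proof. by rewrite memvZ ?(tcT1 hc). Qed.
Lemma val_scalar (c : K) : vsval (c%:A : TT) = c%:A.
Proof.
rewrite linearZ /=; congr (_ *: _).
by apply/eqP; rewrite algid_eq1 (tcT1 hc).
Qed.
Lemma val_one : vsval (1 : TT) = 1.
Proof. by have := val_scalar 1; rewrite !scale1r. Qed.

(** ** The weight space functor *)

Section WeightSpace.
Variables (w : X) (M : grmod).

Definition ws_car : choiceType := {v : M | gpr w v == v}.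
Definition ws_mk (v : M) : ws_car := exist _ (gpr w v) (introT eqP (gpr_homog w v)).
Definition ws_val (v : ws_car) : M := val v.
Lemma ws_valK (v : ws_car) : gpr w (ws_val v) = ws_val v.
Proof. exact/eqP/(svalP v). Qed.
Lemma ws_inj : injective ws_val. Proof. exact: val_inj. Qed.
Lemma ws_mkK v : gpr w v = v -> ws_val (ws_mk v) = v.
Proof. by []. Qed.

Definition ws_add u v := ws_mk (ws_val u + ws_val v).
Definition ws_opp u := ws_mk (- ws_val u).
Definition ws_zero := ws_mk 0.
Definition ws_scale (t : TT) v := ws_mk (vsval t *: ws_val v).

Lemma ws_addE u v : ws_val (ws_add u v) = ws_val u + ws_val v.
Proof. by rewrite ws_mkK // gprD !ws_valK. Qed.
Lemma ws_oppE u : ws_val (ws_opp u) = - ws_val u.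
Proof. by rewrite ws_mkK // -sub0r gprB gpr0 ws_valK. Qed.
Lemma ws_zeroE : ws_val ws_zero = 0.
Proof. by rewrite ws_mkK // gpr0. Qed.
Lemma ws_scaleE t v : ws_val (ws_scale t v) = vsval t *: ws_val v.
Proof.
by rewrite ws_mkK // (gpr_actl _ _ (tcT0 hc (subvsP t))) subr0 ws_valK.
Qed.

Lemma ws_addA : associative ws_add.
Proof. by move=> *; apply: ws_inj; rewrite !ws_addE addrA. Qed.
Lemma ws_addC : commutative ws_add.
Proof. by move=> *; apply: ws_inj; rewrite !ws_addE addrC. Qed.
Lemma ws_add0 : left_id ws_zero ws_add.
Proof. by move=> *; apply: ws_inj; rewrite !ws_addE ws_zeroE add0r. Qed.
Lemma ws_addN : left_inverse ws_zero ws_opp ws_add.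
Proof. by move=> *; apply: ws_inj; rewrite ws_addE ws_oppE addNr ws_zeroE. Qed.
Definition ws_zmod : zmodType :=
  HB.pack ws_car (GRing.isZmodule.Build ws_car ws_addA ws_addC ws_add0 ws_addN).

Lemma ws_scaleA s t (v : ws_zmod) : ws_scale s (ws_scale t v) = ws_scale (s * t) v.
Proof. by apply: ws_inj; rewrite !ws_scaleE scalerA. Qed.
Lemma ws_scale1 : left_id 1 (ws_scale : TT -> ws_zmod -> ws_zmod).
Proof. by move=> v; apply: ws_inj; rewrite ws_scaleE val_one scale1r. Qed.
Lemma ws_scaleDr : right_distributive (ws_scale : TT -> ws_zmod -> ws_zmod) +%R.
Proof.
by move=> t u v; apply: ws_inj; rewrite ws_scaleE !ws_addE !ws_scaleE scalerDr.
Qed.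
Lemma ws_scaleDl (v : ws_zmod) :
  {morph (ws_scale : TT -> ws_zmod -> ws_zmod)^~ v : s t / s + t}.
Proof.
by move=> s t; apply: ws_inj; rewrite ws_scaleE linearD scalerDl ws_addE !ws_scaleE.
Qed.
Definition ws_lmod : lmodType TT :=
  HB.pack (ws_zmod : Type) ws_zmod
    (GRing.Zmodule_isLmodule.Build TT ws_zmod ws_scaleA ws_scale1 ws_scaleDr ws_scaleDl).

Lemma ws_fdim : fdim (restr ws_lmod).
Proof.
have l : linear (ws_val : restr ws_lmod -> restr M).
  move=> c u v; rewrite [LHS]ws_addE; congr (_ + _).
  by rewrite [LHS]ws_scaleE val_scalar.
exact: (@fdim_inj _ _ _ (mklin l) ws_inj (gfd M)).
Qed.

Definition wspace : Defs.grmod (@wt_triv K TT) := tmod ws_fdim.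

Definition wsval (v : wspace) : M := ws_val v.
Definition wsmk (v : M) : wspace := ws_mk v.
Lemma wsval_inj : injective wsval. Proof. exact: ws_inj. Qed.
Lemma wsvalK v : gpr w (wsval v) = wsval v. Proof. exact: ws_valK. Qed.
Lemma wsmkK v : wsval (wsmk v) = gpr w v. Proof. by []. Qed.
Lemma wsvalD u v : wsval (u + v) = wsval u + wsval v. Proof. exact: ws_addE. Qed.
Lemma wsvalZ t v : wsval (t *: v) = vsval t *: wsval v. Proof. exact: ws_scaleE. Qed.
Lemma wsval0 : wsval 0 = 0. Proof. exact: ws_zeroE. Qed.
End WeightSpace.

Section WeightSpaceHom.
Variables (w : X) (M N : grmod).

Definition wsmap_fun (f : Hom M N) (v : wspace w M) : wspace w N :=
  wsmk w (ap f (wsval v)).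
Lemma wsmap_funE f v : wsval (wsmap_fun f v) = ap f (wsval v).
Proof. by rewrite wsmkK -ap_gpr wsvalK. Qed.
Lemma wsmap_funL f : linear (wsmap_fun f).
Proof.
by move=> t u v; apply: wsval_inj; rewrite wsvalD wsvalZ !wsmap_funE wsvalD wsvalZ apL.
Qed.
Lemma wsmap_funG f x v : wsmap_fun f (gpr x v) = gpr x (wsmap_fun f v).
Proof. by []. Qed.
Definition wsmap (f : Hom M N) : THom (wspace w M) (wspace w N) :=
  mkhom (wsmap_funL f) (wsmap_funG f).
Lemma wsmapE f v : wsval (ap (wsmap f) v) = ap f (wsval v).
Proof. exact: wsmap_funE. Qed.
Lemma wsmap_linear : linear wsmap.
Proof.
move=> c f g; apply: hom_ext => v; apply: wsval_inj.
by rewrite ap_add ap_scale wsvalD wsvalZ !wsmapE val_scalar.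
Qed.
End WeightSpaceHom.

Program Definition pi (w : X) : linfunctor C tmodcat :=
  {| fobj M := wspace w M; fmap M N := mklin (@wsmap_linear w M N) |}.
Next Obligation. by apply: hom_ext => v; apply: wsval_inj; rewrite wsmapE. Qed.
Next Obligation. by apply: hom_ext => v; apply: wsval_inj; rewrite !wsmapE. Qed.

Lemma ap_pi w M N (f : Hom M N) v : wsval (ap (fmap (pi w) M N f) v) = ap f (wsval v).
Proof. exact: wsmapE. Qed.

Lemma pi_exact w : exact (pi w).
Proof.
move=> L M N f g /exactP[fi gs fg]; apply/exactP; split.
- by move=> u v e; apply/wsval_inj/fi; rewrite -!ap_pi e.
- move=> u; have [v vE] := gs (wsval u).
  exists (wsmk w v); apply: wsval_inj.
  by rewrite ap_pi wsmkK ap_gpr vE wsvalK.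
move=> v; split=> [e|[u <-]].
  have /fg[u uE] : ap g (wsval v) = 0 by rewrite -ap_pi e wsval0.
  exists (wsmk w u); apply: wsval_inj.
  by rewrite ap_pi wsmkK ap_gpr uE wsvalK.
by apply: wsval_inj; rewrite !ap_pi wsval0; apply/fg; exists (wsval u).
Qed.

End Standard.
(** ** The standard module functor *)

Section StandardModules.
Context {K : fieldType} {X : zmodType} {A : falgType K} {wt : X -> A -> A}.
Context {n : nat} {I : 'I_n -> X}.
Hypothesis hI : is_Zbasis I.
Hypothesis wtP : is_alg_grading wt.
Context {T : {aspace A}} {B : {vspace A}} {m : nat}.
Context {a : 'I_m.+1 -> A} {d : 'I_m.+1 -> X} {beta : 'I_m.+1 -> A -> A}.
Context {q : nat} {p : 'I_q -> A} {gam : 'I_q -> A -> A}.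
Hypothesis hc : tri_coords wt I T B a d beta p gam.
Notation TT := (subvs_of T).
Notation grmod := (grmod wt).
Notation C := (grmodcat wt).
Notation Hom M N := (@hom K (grmodcat wt) M N).
Notation D := (grmodcat (@wt_triv K TT)).
Notation THom M N := (@hom K (grmodcat (@wt_triv K TT)) M N).
Notation tmodule := (Defs.grmod (@wt_triv K TT)).
Notation J := 'I_m.+1.

Lemma beta_sum (R : Type) (r : seq R) (x c : R -> A) : (forall k, c k \in B) ->
  forall j, beta j (\sum_(k <- r) x k * c k) = \sum_(k <- r) beta j (x k) * c k.
Proof.
move=> cB j.
have -> : \sum_(k <- r) x k * c k = \sum_i a i * \sum_(k <- r) beta i (x k) * c k.
  under [RHS]eq_bigr do rewrite mulr_sumr.
  rewrite exchange_big; apply: eq_bigr => k _.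
  rewrite {1}(tc_beta hc (x k)) mulr_suml; apply: eq_bigr => i _.
  by rewrite mulrA.
rewrite (tc_beta_uniq hc) // => i; apply: memv_suml => k _.
by apply: (tcBM hc) => //; apply: (tc_betaB hc).
Qed.

Lemma betaD j x y : beta j (x + y) = beta j x + beta j y.
Proof.
have h := @beta_sum bool [:: true; false] (fun b => if b then x else y) (fun=> 1).
have /h/(_ j) : forall k : bool, (fun=> 1) k \in B by move=> k; apply/(tcTB hc)/(tcT1 hc).
by rewrite !big_cons !big_nil !mulr1 !addr0.
Qed.

Lemma betaM j x c : c \in B -> beta j (x * c) = beta j x * c.
Proof.
move=> cB; have := @beta_sum unit [:: tt] (fun=> x) (fun=> c) (fun=> cB) j.
by rewrite !big_seq1.
Qed.

Lemma beta_a i j : beta j (a i) = if i == j then 1 else 0.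
Proof.
have B1 : 1 \in B by apply/(tcTB hc)/(tcT1 hc).
have -> : a i = \sum_k a k * (if i == k then 1 else 0).
  rewrite (bigD1 i) //= eqxx mulr1 big1 ?addr0 // => k.
  by rewrite eq_sym => /negPf ->; rewrite mulr0.
by rewrite (tc_beta_uniq hc) // => k; case: ifP; rewrite ?mem0v.
Qed.

Lemma beta_wt j x z : wt z (beta j x) = beta j (wt (d j + z) x).
Proof.
rewrite [in RHS](tc_beta hc x) (pr_sum wtP.1).
under [in RHS]eq_bigr do rewrite (wt_mull wtP _ _ (tc_a hc _)).
rewrite (tc_beta_uniq hc) => [|i]; last exact/(tcBg hc)/(tc_betaB hc).
by rewrite addrC addKr.
Qed.

Lemma beta_homog j x u : homog wt x u -> homog wt (x - d j) (beta j u).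
Proof. by move=> hu; rewrite /homog beta_wt addrC subrK hu. Qed.

(** On [B] this is the algebra map to [T] that kills the components of nonzero
    degree; [B] acts on [T]-modules through it. *)
Definition rho (b : A) : TT := vsproj T (wt 0 b).

Lemma rhoD x y : rho (x + y) = rho x + rho y.
Proof. by rewrite /rho (prD wtP.1) linearD. Qed.
Lemma rho0 : rho 0 = 0. Proof. by rewrite /rho (pr0 wtP.1) linear0. Qed.
Lemma rho_sum (R : Type) (r : seq R) (x : R -> A) :
  rho (\sum_(k <- r) x k) = \sum_(k <- r) rho (x k).
Proof. exact: (big_morph rho rhoD rho0). Qed.
Lemma val_rho b : b \in B -> vsval (rho b) = wt 0 b.
Proof. by move=> bB; rewrite /rho vsprojK // (tcB0 hc). Qed.
Lemma rho_T t : t \in T -> vsval (rho t) = t.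
Proof. by move=> tT; rewrite val_rho ?(tcTB hc) // (tcT0 hc). Qed.
Lemma rho1 : rho 1 = 1.
Proof. by apply: subvs_inj; rewrite (val_one hc) (rho_T (tcT1 hc)). Qed.

Lemma cone_pointed x : cone I x -> cone I (- x) -> x = 0.
Proof. by move=> h1 h2; apply: (cone_anti hI); rewrite ?subr0 ?sub0r. Qed.

(** A product of components of opposite nonzero degrees vanishes, as the cone is
    pointed. *)
Lemma wt0M b c : b \in B -> c \in B -> wt 0 (b * c) = wt 0 b * wt 0 c.
Proof.
have wg := wtP.1; move=> bB cB; have [s us e] := pr_ex wg b.
rewrite {1}e mulr_suml (pr_sum wg) [in RHS]e (pr_sum wg) mulr_suml.
apply: eq_bigr => x _; rewrite (wt_mull wtP _ _ (pr_homog wg x b)) (prK wg) sub0r.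
case: (eqVneq 0 x) => [<-|x0]; first by rewrite oppr0.
rewrite mul0r; have [->|/eqP bx] := eqVneq (wt x b) 0; first by rewrite mul0r.
have [->|/eqP cx] := eqVneq (wt (- x) c) 0; first by rewrite mulr0.
by rewrite (cone_pointed (tcB_cone hc bB bx) (tcB_cone hc cB cx)) eqxx in x0.
Qed.

Lemma rhoM b c : b \in B -> c \in B -> rho (b * c) = rho b * rho c.
Proof.
move=> bB cB; apply: subvs_inj.
by rewrite /= !val_rho ?(tcBM hc) // wt0M.
Qed.

Lemma rho_beta_deg j x u : homog wt x u -> rho (beta j u) <> 0 -> x = d j.
Proof.
move=> hu h; apply/eqP; rewrite -subr_eq0; apply/eqP; apply: contrapT => ne; apply: h.
apply: subvs_inj; rewrite val_rho ?(tc_betaB hc) // linear0.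
by rewrite (homog_pr wtP.1 _ (beta_homog j hu)); case: eqP => // e; case: ne.
Qed.

Section DeltaObj.
Variables (w : X) (N : tmodule).
Let V : zmodType := {ffun J -> N}.

(** The action on families [(f i)] standing for the sum of the [a i (x) f i]:
    expand [x * a i] over the basis [a j] and move the coordinates, which lie
    in [B], across the tensor sign. *)
Definition dscale (x : A) (f : V) : V :=
  [ffun j => \sum_i rho (beta j (x * a i)) *: f i].

Lemma dscaleA x y f : dscale x (dscale y f) = dscale (x * y) f.
Proof.
apply/ffunP => j; rewrite !ffunE.
under eq_bigr do rewrite ffunE scaler_sumr.
rewrite exchange_big; apply: eq_bigr => i _ /=.
under eq_bigr do rewrite scalerA.
rewrite -scaler_suml; congr (_ *: _).
rewrite -mulrA {2}(tc_beta hc (y * a i)) mulr_sumr.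
under [in RHS]eq_bigr do rewrite mulrA.
rewrite (beta_sum _ (fun k => x * a k)) => [|k]; last exact: (tc_betaB hc).
by rewrite rho_sum; apply: eq_bigr => k _; rewrite rhoM ?(tc_betaB hc).
Qed.

Lemma dscale1 : left_id 1 dscale.
Proof.
move=> f; apply/ffunP => j; rewrite ffunE (bigD1 j) //= big1 ?addr0.
  by rewrite mul1r beta_a eqxx rho1 scale1r.
by move=> i /negPf ij; rewrite mul1r beta_a ij rho0 scale0r.
Qed.

Lemma dscaleDr : right_distributive dscale +%R.
Proof.
move=> x f g; apply/ffunP => j; rewrite !ffunE -big_split; apply: eq_bigr => i _.
by rewrite ffunE scalerDr.
Qed.

Lemma dscaleDl f : {morph dscale^~ f : x y / x + y}.
Proof.
move=> x y; apply/ffunP => j; rewrite !ffunE -big_split; apply: eq_bigr => i _.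
by rewrite mulrDl betaD rhoD scalerDl.
Qed.

Definition delta_lmod : lmodType A :=
  HB.pack (V : Type) V
    (GRing.Zmodule_isLmodule.Build A V dscaleA dscale1 dscaleDr dscaleDl).

Definition delta_gpr (x : X) (f : delta_lmod) : delta_lmod :=
  [ffun j => if x == d j + w then (f : V) j else 0] : V.

(** The pure tensor [x (x) v] in coordinates. *)
Definition tau (x : A) (v : N) : delta_lmod := [ffun j => rho (beta j x) *: v] : V.

Lemma tauE x v j : (tau x v : V) j = rho (beta j x) *: v.
Proof. by rewrite ffunE. Qed.

Lemma tau_scale x y v : x *: tau y v = tau (x * y) v.
Proof.
apply/ffunP => j; rewrite tauE /GRing.scale /= ffunE.
under eq_bigr do rewrite tauE scalerA.
rewrite -scaler_suml; congr (_ *: _).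
rewrite {2}(tc_beta hc y) mulr_sumr.
under [in RHS]eq_bigr do rewrite mulrA.
rewrite (beta_sum _ (fun k => x * a k)) => [|k]; last exact: (tc_betaB hc).
by rewrite rho_sum; apply: eq_bigr => k _; rewrite rhoM ?(tc_betaB hc).
Qed.

Lemma tauDr x u v : tau x (u + v) = tau x u + tau x v.
Proof. by apply/ffunP => j; rewrite !ffunE scalerDr. Qed.
Lemma tauDl x y v : tau (x + y) v = tau x v + tau y v.
Proof. by apply/ffunP => j; rewrite !ffunE betaD rhoD scalerDl. Qed.
Lemma tau_bal x b v : b \in B -> tau (x * b) v = tau x (rho b *: v).
Proof.
move=> bB; apply/ffunP => j; rewrite !ffunE betaM // rhoM ?(tc_betaB hc) //.
by rewrite scalerA.
Qed.

Lemma delta_sumE (R : Type) (r : seq R) (F : R -> delta_lmod) j :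
  (\sum_(k <- r) F k : V) j = \sum_(k <- r) (F k : V) j.
Proof. exact: sum_ffunE. Qed.

Lemma delta_tau (f : delta_lmod) : f = \sum_j tau (a j) ((f : V) j).
Proof.
apply/ffunP => j; rewrite delta_sumE (bigD1 j) //= big1 ?addr0.
  by rewrite tauE beta_a eqxx rho1 scale1r.
by move=> i /negPf ij; rewrite tauE beta_a ij rho0 scale0r.
Qed.

Lemma delta_gpr_tau x z u v : homog wt z u ->
  delta_gpr x (tau u v) = if x == z + w then tau u v else 0.
Proof.
move=> hu; apply/ffunP => j; rewrite ffunE tauE.
have [e|/eqP/(rho_beta_deg hu) <-] := eqVneq (rho (beta j u)) 0.
  by rewrite e scale0r if_same; case: ifP; rewrite ?tauE ?e ?scale0r ?ffunE.
by case: ifP; rewrite ?tauE ?ffunE.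
Qed.

Lemma delta_gprD x f g : delta_gpr x (f + g) = delta_gpr x f + delta_gpr x g.
Proof. by apply/ffunP => j; rewrite !ffunE; case: ifP => //; rewrite addr0. Qed.

Lemma delta_gpr_sum x (R : Type) (r : seq R) (F : R -> delta_lmod) :
  delta_gpr x (\sum_(k <- r) F k) = \sum_(k <- r) delta_gpr x (F k).
Proof.
apply: (big_morph _ (delta_gprD x)); apply/ffunP => j; rewrite !ffunE.
by case: ifP.
Qed.

Lemma tau_rho_scale x t v : t \in T -> tau (x * t) v = tau x (rho t *: v).
Proof. by move=> tT; apply: tau_bal; apply: (tcTB hc). Qed.

Lemma delta_Kscale (c : K) f j : ((c%:A *: f : delta_lmod) : V) j = c%:A *: (f : V) j.
Proof.
rewrite {1}(delta_tau f) scaler_sumr delta_sumE [in RHS](delta_tau f) delta_sumE.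
rewrite scaler_sumr; apply: eq_bigr => i _.
rewrite tau_scale -scalerAl mul1r -[c *: a i]mulr1 -scalerAl scalerAr.
rewrite tau_rho_scale ?(T_scalar hc) // !tauE !scalerA.
rewrite beta_a; case: (i == j); rewrite ?rho0 ?mul0r ?mulr0 ?rho1 ?mul1r ?mulr1 //.
by congr (_ *: _); apply: subvs_inj; rewrite (rho_T (T_scalar hc c)) (val_scalar hc).
Qed.

Lemma delta_gprP : is_grading (delta_gpr : X -> restr delta_lmod -> restr delta_lmod).
Proof.
split=> [x|x y f|f].
- apply: restr_linear => [f g|c f]; first exact: delta_gprD.
  apply/ffunP => j; rewrite [RHS]delta_Kscale [LHS]ffunE [in RHS]ffunE.
  by case: ifP => _; [apply: delta_Kscale|rewrite scaler0].
- apply/ffunP => j; rewrite ![LHS]ffunE; case: (x =P y) => [->|ne].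
    by rewrite [RHS]ffunE; case: ifP => // e; rewrite ffunE e.
  rewrite [RHS]ffunE; case: eqP => // ex; rewrite ffunE.
  by case: eqP => // ey; case: ne; rewrite ex ey.
exists (undup [seq d j + w | j <- enum J]); first exact: undup_uniq.
apply/ffunP => j; rewrite (delta_sumE _ (fun x => delta_gpr x f)).
rewrite (bigD1_seq (d j + w)) ?undup_uniq //=; last first.
  by rewrite mem_undup; apply: map_f; rewrite mem_enum.
rewrite ffunE eqxx big1 ?addr0 // => x /negPf xj.
by rewrite ffunE xj.
Qed.

Lemma delta_gpr_act x y u (f : delta_lmod) :
  homog wt x u -> homog delta_gpr y f -> homog delta_gpr (x + y) (u *: f).
Proof.
move=> hu hf; rewrite /homog {1 2}(delta_tau f) scaler_sumr delta_gpr_sum.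
apply: eq_bigr => j _; rewrite tau_scale.
rewrite (delta_gpr_tau _ _ (wtP.2 _ _ _ _ hu (tc_a hc j))).
case: eqP => // ne.
have -> : (f : V) j = 0.
  rewrite -hf ffunE; case: eqP => // e; case: ne.
  by rewrite e addrA.
by apply/ffunP => i; rewrite !ffunE scaler0.
Qed.

Lemma delta_fg :
  exists k (g : 'I_k -> delta_lmod), forall f, exists c : 'I_k -> A, f = \sum_i c i *: g i.
Proof.
have [k [g hg]] := gfg N; exists k, (fun i => tau 1 (g i)) => f.
have [c cE] := choice (fun j => hg ((f : V) j)).
exists (fun i => \sum_j a j * vsval (c j i)).
rewrite {1}(delta_tau f).
rewrite (eq_bigr (fun j => \sum_i tau (a j * vsval (c j i)) (g i))); last first.
  move=> j _; rewrite [in LHS]cE.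
  rewrite (big_morph (tau (a j)) (tauDr (a j)) (_ : _ = 0)); last first.
    by apply/ffunP => i; rewrite !ffunE scaler0.
  apply: eq_bigr => i _; rewrite tau_rho_scale ?subvsP //; congr (tau _ (_ *: _)).
  by apply: subvs_inj; rewrite (rho_T (subvsP _)).
rewrite exchange_big; apply: eq_bigr => i _ /=; rewrite scaler_suml.
by apply: eq_bigr => j _; rewrite tau_scale mulr1.
Qed.

Definition delta : grmod := GrMod delta_gprP delta_gpr_act delta_fg.

Lemma delta_gen (f : delta) : f = \sum_j a j *: (tau 1 ((f : V) j) : delta).
Proof. by rewrite {1}(delta_tau f); apply: eq_bigr => j _; rewrite tau_scale mulr1. Qed.

Lemma tau_homog x u v : homog wt x u -> homog (@gpr _ _ _ _ delta) (x + w) (tau u v).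
Proof. by move=> hu; rewrite /homog /= (delta_gpr_tau _ _ hu) eqxx. Qed.

(** The map induced on the tensor product by a balanced map is determined by its
    values on the [a j (x) v]. *)
Lemma delta_balanced_map (Z : zmodType) (bt : A -> N -> Z) :
  (forall x, {morph bt x : u v / u + v}) -> (forall v, {morph bt^~ v : x y / x + y}) ->
  (forall x b v, b \in B -> bt (x * b) v = bt x (rho b *: v)) ->
  forall x v, \sum_j bt (a j) ((tau x v : V) j) = bt x v.
Proof.
move=> bD1 bD2 bb x v.
under eq_bigr do rewrite tauE -bb ?(tc_betaB hc) //.
have b0 : bt 0 v = 0 by apply: (addrI (bt 0 v)); rewrite -bD2 !addr0.
by rewrite -(big_morph (bt^~ v) (bD2 v) b0) -(tc_beta hc).
Qed.

End DeltaObj.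

End StandardModules.
(** ** The adjunction between standard modules and weight spaces *)

Section StandardFunctor.
Context {K : fieldType} {X : zmodType} {A : falgType K} {wt : X -> A -> A}.
Context {n : nat} {I : 'I_n -> X}.
Hypothesis hI : is_Zbasis I.
Hypothesis wtP : is_alg_grading wt.
Context {T : {aspace A}} {B : {vspace A}} {m : nat}.
Context {a : 'I_m.+1 -> A} {d : 'I_m.+1 -> X} {beta : 'I_m.+1 -> A -> A}.
Context {q : nat} {p : 'I_q -> A} {gam : 'I_q -> A -> A}.
Hypothesis hc : tri_coords wt I T B a d beta p gam.
Notation TT := (subvs_of T).
Notation grmod := (grmod wt).
Notation C := (grmodcat wt).
Notation Hom M N := (@hom K (grmodcat wt) M N).
Notation D := (grmodcat (@wt_triv K TT)).
Notation THom M N := (@hom K (grmodcat (@wt_triv K TT)) M N).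
Notation tmodule := (Defs.grmod (@wt_triv K TT)).
Notation J := 'I_m.+1.
Notation pi := (pi hc).
Notation delta := (delta hI wtP hc).
Notation tau N := (@tau K X A wt n I hI wtP T B m a d beta q p gam hc N).

Notation rho := (@rho K X A wt T).

Definition dcomp {w : X} {N : tmodule} (h : delta w N) : J -> N := (h : {ffun J -> N}).

Lemma dcomp_ext w N (h h' : delta w N) : (forall j, dcomp h j = dcomp h' j) -> h = h'.
Proof. by move=> e; apply/ffunP. Qed.

Lemma dcompD w N (h h' : delta w N) j : dcomp (h + h') j = dcomp h j + dcomp h' j.
Proof. exact: ffunE. Qed.

Lemma dcomp0 w N j : dcomp (0 : delta w N) j = 0.
Proof. exact: ffunE. Qed.

Lemma dcompZ w N x (h : delta w N) j :
  dcomp (x *: h) j = \sum_i rho (beta j (x * a i)) *: dcomp h i.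
Proof. exact: ffunE. Qed.

Lemma dcompK w N c (h : delta w N) j : dcomp (c%:A *: h) j = c%:A *: dcomp h j.
Proof. exact: delta_Kscale. Qed.

Lemma dcomp_gpr w N x (h : delta w N) j :
  dcomp (gpr x h) j = if x == d j + w then dcomp h j else 0.
Proof. exact: ffunE. Qed.

Lemma dcomp_tau (w : X) N x v j : dcomp (tau N x v : delta w N) j = rho (beta j x) *: v.
Proof. exact: tauE. Qed.

Section Map.
Variables (w : X) (N N' : tmodule).

Definition dmap_fun (f : THom N N') (h : delta w N) : delta w N' :=
  [ffun j => ap f (dcomp h j)] : {ffun J -> N'}.

Lemma dcomp_map_fun f h j : dcomp (dmap_fun f h) j = ap f (dcomp h j).
Proof. exact: ffunE. Qed.

Lemma dmap_funL f : linear (dmap_fun f).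
Proof.
move=> x g h; apply: dcomp_ext => j.
rewrite dcompD dcompZ !dcomp_map_fun dcompD apD dcompZ ap_sum; congr (_ + _).
by apply: eq_bigr => i _; rewrite apZ dcomp_map_fun.
Qed.

Lemma dmap_funG f x h : dmap_fun f (gpr x h) = gpr x (dmap_fun f h).
Proof.
apply: dcomp_ext => j; rewrite dcomp_gpr !dcomp_map_fun dcomp_gpr.
by case: ifP; rewrite ?ap0.
Qed.

Definition dmap (f : THom N N') : Hom (delta w N) (delta w N') :=
  mkhom (dmap_funL f) (dmap_funG f).

Lemma dcomp_map f h j : dcomp (ap (dmap f) h) j = ap f (dcomp h j).
Proof. exact: dcomp_map_fun. Qed.

Lemma dmap_linear : linear dmap.
Proof.
move=> c f g; apply: hom_ext => h; apply: dcomp_ext => j.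
by rewrite ap_add ap_scale dcompD dcompK !dcomp_map ap_add ap_scale.
Qed.
End Map.

Program Definition Delta (w : X) : linfunctor D C :=
  {| fobj N := delta w N; fmap N N' := mklin (@dmap_linear w N N') |}.
Next Obligation. by apply: hom_ext => h; apply: dcomp_ext => j; rewrite dcomp_map. Qed.
Next Obligation. by apply: hom_ext => h; apply: dcomp_ext => j; rewrite !dcomp_map. Qed.

Lemma dcomp_Delta w N N' (f : THom N N') h j :
  dcomp (ap (fmap (Delta w) N N' f) h) j = ap f (dcomp h j).
Proof. exact: dcomp_map. Qed.

Lemma Delta_sexact w (L M N : tmodule) (f : THom L M) (g : THom M N) :
  sexact f g -> sexact (fmap (Delta w) _ _ f) (fmap (Delta w) _ _ g).
Proof.
move=> [fi gs fg]; split.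
- move=> u v e; apply: dcomp_ext => j; apply: fi.
  by rewrite -!(dcomp_Delta (w := w)) e.
- move=> h; have [k kE] := choice (fun j => gs (dcomp h j)).
  pose h' : delta w M := [ffun j => k j] : {ffun J -> M}.
  exists h'; apply: dcomp_ext => j.
  by rewrite dcomp_Delta -kE; congr (ap g _); apply: ffunE.
move=> h; split=> [e|[l <-]].
  have ex j : exists l, ap f l = dcomp h j.
    by apply/fg; rewrite -(dcomp_Delta (w := w)) e dcomp0.
  have [k kE] := choice ex.
  pose h' : delta w L := [ffun j => k j] : {ffun J -> L}.
  exists h'; apply: dcomp_ext => j.
  by rewrite dcomp_Delta -kE; congr (ap f _); apply: ffunE.
apply: dcomp_ext => j; rewrite !dcomp_Delta dcomp0.
by apply/fg; exists (dcomp l j).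
Qed.

Lemma Delta_exact w : exact (Delta w).
Proof. by move=> L M N f g /exactP h; apply/exactP/Delta_sexact. Qed.

Lemma delta_supp w N u (h : delta w N) : gpr u h <> 0 -> cone I (w - u).
Proof.
move=> ne; apply: contrapT => nc; apply: ne; apply: dcomp_ext => j.
rewrite dcomp_gpr dcomp0; case: eqP => // e; case: nc.
by rewrite e opprD addrC addrNK; apply: (tc_cone hc).
Qed.

Lemma delta_genE w N (h : delta w N) :
  h = \sum_j a j *: (tau N 1 (dcomp h j) : delta w N).
Proof. exact: delta_gen. Qed.

Lemma tau1_gpr w N v : gpr w (tau N 1 v : delta w N) = tau N 1 v.
Proof. by have := tau_homog hI wtP hc w v (wt1 wtP); rewrite add0r. Qed.

Lemma tau1_scale w N (t : TT) v :
  tau N 1 (t *: v) = vsval t *: (tau N 1 v : delta w N).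
Proof.
rewrite tau_scale mulr1 -[vsval t]mul1r (tau_rho_scale hI wtP hc _ _ (subvsP t)).
by congr (tau _ _ (_ *: _)); apply: subvs_inj; rewrite (rho_T hc (subvsP t)).
Qed.

Lemma dcomp_tau1 (w : X) N v : dcomp (tau N 1 v : delta w N) ord0 = v.
Proof. by rewrite dcomp_tau -(tc_a0 hc) (beta_a hc) eqxx (rho1 hc) scale1r. Qed.

(** ** Unit of the adjunction *)

Definition eta_fun w (N : tmodule) (v : N) : wspace hc w (delta w N) :=
  wsmk hc w (tau N 1 v : delta w N).

Lemma eta_linear w N : linear (@eta_fun w N).
Proof.
move=> t u v; apply: wsval_inj; rewrite wsvalD wsvalZ !wsmkK !tau1_gpr.
by rewrite tauDr (tau1_scale w).
Qed.

Lemma eta_gpr w N x v : @eta_fun w N (gpr x v) = gpr x (eta_fun w v).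
Proof. by rewrite !triv_gpr. Qed.

Definition eta w (N : tmodule) : THom N (pi w (delta w N)) :=
  mkhom (@eta_linear w N) (@eta_gpr w N).

Lemma etaE w N v : wsval (ap (eta w N) v) = tau N 1 v.
Proof. by rewrite mkhomE wsmkK tau1_gpr. Qed.

Lemma eta_natural w N N' (f : THom N N') :
  eta w N' \oc f = fmap (pi w) _ _ (fmap (Delta w) _ _ f) \oc eta w N.
Proof.
apply: hom_ext => v; apply: wsval_inj; rewrite ap_comp etaE ap_comp ap_pi etaE.
by apply: dcomp_ext => j; rewrite dcomp_Delta !dcomp_tau apZ.
Qed.

(** The vector [1] is the only basis vector of degree [0]. *)
Lemma delta_ws w N (h : delta w N) : gpr w h = h ->
  h = tau N 1 (dcomp h ord0).
Proof.
move=> hw; apply: dcomp_ext => j.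
rewrite dcomp_tau -(tc_a0 hc) (beta_a hc) eq_sym.
have [->|j0] := eqVneq j ord0; first by rewrite (rho1 hc) scale1r.
rewrite rho0 // scale0r -hw dcomp_gpr; case: eqP => // e.
by rewrite (tc_d hc (j := j)) ?eqxx // in j0; apply: (addIr w); rewrite -e add0r.
Qed.

Lemma eta_iso w N : is_iso (eta w N).
Proof.
apply/isoP; split=> [u v e|u].
  by rewrite -(dcomp_tau1 w u) -(dcomp_tau1 w v) -!etaE e.
exists (dcomp (wsval u) ord0); apply: wsval_inj.
by rewrite etaE -delta_ws ?wsvalK.
Qed.

(** ** The universal property *)

Definition no_above (w : X) (M : grmod) : Prop :=
  forall u, u <> w -> cone I (u - w) -> forall v : M, gpr u v = 0.

(** Positive degrees of [B] raise [v] into degrees where [M] vanishes. *)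
Lemma no_above_rho w (M : grmod) b (v : M) : no_above w M -> b \in B -> gpr w v = v ->
  b *: v = vsval (rho b) *: v.
Proof.
move=> na bB vw; rewrite (val_rho hc bB).
apply: gpr_ext => z; rewrite !(gpr_actr wtP _ _ vw) (prK wtP.1).
case: (eqVneq (z - w) 0) => [-> //|zw].
rewrite /= scale0r; have [->|/eqP nz] := eqVneq (wt (z - w) b) 0; first by rewrite scale0r.
have zw' : z <> w by move=> e; rewrite e subrr eqxx in zw.
have := na z zw' (tcB_cone hc bB nz) (b *: v).
by rewrite (gpr_actr wtP _ _ vw).
Qed.

(** The map [sum a j (x) v_j |-> sum a j f(v_j)]; it is linear because [B] acts on
    the weight space through [rho]. *)
Lemma delta_hom w N (M : grmod) (f : THom N (wspace hc w M)) : no_above w M ->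
  exists g : Hom (delta w N) M,
    forall h, ap g h = \sum_j a j *: wsval (ap f (dcomp h j)).
Proof.
move=> na; pose g (h : delta w N) : M := \sum_j a j *: wsval (ap f (dcomp h j)).
have gt x v : g (tau N x v : delta w N) = x *: wsval (ap f v).
  rewrite /g [in RHS](tc_beta hc x) scaler_suml; apply: eq_bigr => j _.
  rewrite dcomp_tau apZ wsvalZ -scalerA.
  by rewrite -(no_above_rho na (tc_betaB hc j x) (wsvalK _)).
have gD h h' : g (h + h') = g h + g h'.
  rewrite /g -big_split; apply: eq_bigr => j _.
  by rewrite dcompD apD wsvalD scalerDr.
have g0 : g 0 = 0 by apply: (addrI (g 0)); rewrite -gD !addr0.
have gZ x h : g (x *: h) = x *: g h.
  rewrite {1}(delta_genE h) scaler_sumr (big_morph g gD g0) scaler_sumr.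
  apply: eq_bigr => j _; rewrite !tau_scale mulr1 gt.
  by rewrite scalerA.
have gG x h : g (gpr x h) = gpr x (g h).
  rewrite /g gpr_sum; apply: eq_bigr => j _.
  rewrite (gpr_actl _ _ (tc_a hc j)) dcomp_gpr -(wsvalK (ap f (dcomp h j))) gprK.
  rewrite (can2_eq (subrK (d j)) (addrK (d j))) [w + _]addrC.
  by case: ifP => _; rewrite ?ap0 ?wsval0 ?gpr0 // wsvalK.
have gl : linear g by move=> x h h'; rewrite gD gZ.
by exists (mkhom gl gG).
Qed.

Lemma delta_hom_tau w N (M : grmod) (f : THom N (wspace hc w M)) (g : Hom (delta w N) M) :
  (forall h, ap g h = \sum_j a j *: wsval (ap f (dcomp h j))) ->
  forall v, ap g (tau N 1 v : delta w N) = wsval (ap f v).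
Proof.
move=> gE v; rewrite gE (bigD1 ord0) //= dcomp_tau1 (tc_a0 hc) scale1r big1 ?addr0 //.
move=> j j0; rewrite dcomp_tau -(tc_a0 hc) (beta_a hc) eq_sym (negPf j0).
by rewrite rho0 // scale0r ap0 wsval0 scaler0.
Qed.

Lemma delta_hom_ext w N (M : grmod) (g g' : Hom (delta w N) M) :
  (forall v, ap g (tau N 1 v : delta w N) = ap g' (tau N 1 v : delta w N)) -> g = g'.
Proof.
move=> e; apply: hom_ext => h; rewrite (delta_genE h) !ap_sum.
by apply: eq_bigr => j _; rewrite !apZ e.
Qed.

Lemma delta_adj w N (M : grmod) (f : THom N (wspace hc w M)) : no_above w M ->
  exists! g : Hom (delta w N) M, fmap (pi w) _ _ g \oc eta w N = f.
Proof.
move=> na; have [g gE] := delta_hom f na.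
have gt := delta_hom_tau gE.
exists g; split.
  by apply: hom_ext => v; apply: wsval_inj; rewrite ap_comp ap_pi etaE gt.
move=> g' g'E; apply: delta_hom_ext => v.
by rewrite gt -g'E ap_comp ap_pi etaE.
Qed.

Lemma delta_induced (Ap : {aspace A}) w (N : tmodule) : B = (Ap * T)%VS ->
  is_induced (wt := wt) Ap w (tau N : A -> gcar N -> delta w N).
Proof.
move=> BE; split.
- split=> [x u v|v x y|x b v]; first exact: tauDr.
    exact: tauDl.
  by rewrite -BE => bB; apply: tau_bal.
- move=> Z bt [bD1 bD2]; rewrite -BE => bb.
  pose g (h : delta w N) := \sum_j bt (a j) (dcomp h j).
  have bt0 x : bt x 0 = 0 by apply: (addrI (bt x 0)); rewrite -bD1 !addr0.
  have g0 : g 0 = 0 by rewrite /g big1 // => j _; rewrite dcomp0 bt0.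
  have gD : {morph g : h h' / h + h'}.
    by move=> h h'; rewrite /g -big_split; apply: eq_bigr => j _; rewrite dcompD bD1.
  pose G : {additive delta w N -> Z} :=
    HB.pack g (GRing.isNmodMorphism.Build _ _ g (conj g0 gD)).
  exists G => [x v|g' g'E h]; first exact: delta_balanced_map.
  have -> : h = \sum_j (tau N (a j) (dcomp h j) : delta w N) by apply: delta_tau.
  rewrite !raddf_sum; apply: eq_bigr => j _.
  by rewrite g'E; apply/esym/delta_balanced_map.
- by move=> x y v; rewrite tau_scale.
by move=> x y v hx; apply: (tau_homog hI wtP hc w v hx).
Qed.

End StandardFunctor.
(** * Heights and supports *)

Section Cone.
Context {X : zmodType} {n : nat} {I : 'I_n -> X}.
Hypothesis hI : is_Zbasis I.

(** The sum of the coordinates.  Heights pick out maximal degrees, the order on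
    degrees being only partial. *)
Lemma height_exists : exists ht : X -> int, (forall x y, ht (x - y) = ht x - ht y) /\
  forall x, cone I x -> x <> 0 -> (0 < ht x)%R.
Proof.
have [crd crdK Kcrd] := hI.
have crdB x y i : crd (x - y) i = crd x i - crd y i.
  rewrite -[x in LHS]Kcrd -[y in LHS]Kcrd.
  rewrite -sumrB (eq_bigr (fun i => I i *~ [ffun i => crd x i - crd y i] i)).
    by rewrite crdK ffunE.
  by move=> j _; rewrite ffunE mulrzBr.
exists (fun x => \sum_i crd x i); split=> [x y|_ [c ->] ne].
  by rewrite -sumrB; apply: eq_bigr => i _; rewrite crdB.
have -> : \sum_i I i *+ c i = \sum_i I i *~ [ffun i => (c i)%:Z] i.
  by apply: eq_bigr => i _; rewrite ffunE pmulrn.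
rewrite crdK lt_neqAle sumr_ge0 ?andbT => [|i _]; last by rewrite ffunE.
apply/negP => /eqP/esym/eqP; rewrite psumr_eq0 => [/allP h|i _]; last by rewrite ffunE.
apply: ne; rewrite big1 // => i _; have := h i (mem_index_enum i).
by rewrite ffunE /= => /eqP [->]; rewrite mulr0n.
Qed.

(** The coordinates of [z - x] are bounded by those of [y - x]. *)
Lemma interval_finite x y :
  finite_set [set z : X | cone I (z - x) /\ cone I (y - z)]%classic.
Proof.
have [[e ee]|ne] := pselect (cone I (y - x)); last first.
  suff -> : [set z : X | cone I (z - x) /\ cone I (y - z)]%classic =
    classical_sets.set0 by [].
  by apply/seteqP; split=> // z [h1 h2]; apply: ne; apply: cone_trans h1 h2.
pose g (c : {ffun 'I_n -> 'I_(\sum_i e i).+1}) := x + \sum_i I i *+ c i.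
apply: (@sub_finite_set _ _ (range g)) => [z [[c cE] [c' c'E]]|]; last first.
  by apply: finite_image; apply: finite_finset.
have ece i : (c i + c' i = e i)%N.
  pose S (c : {ffun 'I_n -> int}) := \sum_i I i *~ c i.
  have Sinj : injective S := bij_inj hI.
  have : S [ffun i => (c i + c' i)%:Z] = S [ffun i => (e i)%:Z].
    rewrite /S.
    have -> : \sum_i I i *~ [ffun i => (e i)%:Z] i = y - x.
      by rewrite ee; apply: eq_bigr => j _; rewrite ffunE pmulrn.
    rewrite (eq_bigr (fun i => I i *+ c i + I i *+ c' i)); last first.
      by move=> j _; rewrite ffunE -pmulrn mulrnDr.
    by rewrite big_split /= -cE -c'E addrC addrA subrK.
  by move=> /Sinj /ffunP/(_ i); rewrite !ffunE => -[].
have lt i : (c i < (\sum_i e i).+1)%N.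
  by rewrite ltnS (bigD1 i) //= -ece -addnA leq_addr.
exists [ffun i => Ordinal (lt i)] => //; rewrite /g.
rewrite (eq_bigr (fun i => I i *+ c i)) => [|i _]; last by rewrite ffunE.
by rewrite -cE addrC subrK.
Qed.

End Cone.

Lemma seq_max (V : eqType) (s : seq V) (f : V -> int) (P : V -> Prop) :
  (exists2 x, x \in s & P x) ->
  exists x, [/\ x \in s, P x & forall y, y \in s -> P y -> (f y <= f x)%R].
Proof.
elim: s => [[] //|u s IH] [x]; rewrite inE => xs Px.
have [ex|nex] := pselect (exists2 x, x \in s & P x); last first.
  have ux : x = u.
    by move: xs => /orP[/eqP //|xs]; case: nex; exists x.
  exists u; rewrite inE eqxx; split=> // [|y]; first by rewrite -ux.
  rewrite inE => /orP[/eqP-> //|ys] Py.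
  by case: nex; exists y.
have [z [zs Pz zm]] := IH ex.
have [[Pu le]|nu] := pselect (P u /\ (f z <= f u)%R).
  exists u; rewrite inE eqxx; split=> // y; rewrite inE => /orP[/eqP-> //|ys] Py.
  exact: le_trans (zm y ys Py) le.
exists z; rewrite inE zs orbT; split=> // y;
  rewrite inE => /orP[/eqP-> Pu|ys /(zm y ys) //].
by case: (leP (f u) (f z)) => // /ltW le; case: nu.
Qed.

Section Simples.
Context {K : fieldType} {X : zmodType} {A : falgType K} {wt : X -> A -> A}.
Context {n : nat} {I : 'I_n -> X}.
Hypothesis hI : is_Zbasis I.
Hypothesis wtP : is_alg_grading wt.
Context {T : {aspace A}} {B : {vspace A}} {m : nat}.
Context {a : 'I_m.+1 -> A} {d : 'I_m.+1 -> X} {beta : 'I_m.+1 -> A -> A}.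
Context {q : nat} {p : 'I_q -> A} {gam : 'I_q -> A -> A}.
Hypothesis hc : tri_coords wt I T B a d beta p gam.
Notation TT := (subvs_of T).
Notation grmod := (grmod wt).
Notation C := (grmodcat wt).
Notation Hom M N := (@hom K (grmodcat wt) M N).
Notation D := (grmodcat (@wt_triv K TT)).
Notation THom M N := (@hom K (grmodcat (@wt_triv K TT)) M N).
Notation tmodule := (Defs.grmod (@wt_triv K TT)).
Notation J := 'I_m.+1.
Notation delta := (delta hI wtP hc).
Notation tau N := (@tau K X A wt n I hI wtP T B m a d beta q p gam hc N).
Notation rho := (@rho K X A wt T).

Definition supp_in (Q : X -> Prop) (M : grmod) : Prop :=
  forall u, ~ Q u -> forall v : M, gpr u v = 0.

Lemma supp_in_sub Q : closed_sub (supp_in Q).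
Proof. by move=> M N f fi h u nu v; apply: fi; rewrite ap_gpr h // ap0. Qed.

Lemma supp_in_quot Q : closed_quot (supp_in Q).
Proof. by move=> M N f fs h u nu v; have [m' <-] := fs v; rewrite -ap_gpr h // ap0. Qed.

Lemma supp_in_ext Q (L M N : grmod) (f : Hom L M) (g : Hom M N) : sexact f g ->
  supp_in Q M <-> supp_in Q L /\ supp_in Q N.
Proof.
move=> [fi gs fg]; split=> [h|[hL hN] u nu v].
  by split; [apply: supp_in_sub fi h|apply: supp_in_quot gs h].
have /fg[l lE] : ap g (gpr u v) = 0 by rewrite ap_gpr hN.
have -> : gpr u v = gpr u (gpr u v) by rewrite gprK eqxx.
by rewrite -lE -ap_gpr hL // ap0.
Qed.

Lemma supp_in_serre Q : is_serre (supp_in Q : C -> Prop).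
Proof.
split; first by move=> z /zeroP h u _ v; apply: h.
by move=> x y z f g /exactP; apply: supp_in_ext.
Qed.

Definition below (w u : X) : Prop := cone I (w - u).

Lemma below_no_above w M : supp_in (below w) M -> no_above (I := I) w M.
Proof.
move=> h u ne cu v; apply: h => cw; apply: ne.
exact: (cone_anti hI cw cu).
Qed.

Lemma delta_below w N : supp_in (below w) (delta w N).
Proof.
move=> u nu h; apply: contrapT => ne; apply: nu.
refine (delta_supp ne).
Qed.

Lemma max_degree (M : grmod) : (exists m : M, m <> 0) ->
  exists w, no_above (I := I) w M /\ exists v : M, v <> 0 /\ gpr w v = v.
Proof.
move=> [m0 nz]; have [ht [htB htpos]] := height_exists hI.
have [s us hs] := gpr_unif M.
pose P x := exists v : M, gpr x v <> 0.
have out x : P x -> x \in s.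
  move=> [v nv]; apply: contrapT => /negP xs; apply: nv.
  exact: (supp_out (gprP M) us (hs v) xs).
have [|w [ws Pw max]] := @seq_max _ s ht P.
  apply: contrapT => h; apply: nz; apply: gpr_ext => x; rewrite gpr0.
  apply: contrapT => ne; apply: h; exists x; last by exists m0.
  by apply: out; exists m0.
exists w; split; last first.
  by have [v nv] := Pw; exists (gpr w v); split=> //; rewrite gprK eqxx.
move=> u uw cu v; apply: contrapT => ne.
have Pu : P u by exists v.
have := max u (out u Pu) Pu; rewrite -subr_le0 -htB leNgt htpos //.
by move=> e; apply: uw; apply/eqP; rewrite -subr_eq0 e.
Qed.

(** * Simple modules *)

Lemma mod_simpleP (R : pzRingType) (N : lmodType R) : mod_simple N <->
  (exists v : N, v <> 0) /\ forall v v' : N, v <> 0 -> exists t : R, v' = t *: v.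
Proof.
split=> [[nz h]|[nz h]]; split=> //.
  move=> v v' nv; pose P : {pred N} := fun u => `[< exists t, u = t *: v >].
  have [|z|all] := h P.
  - split; first by apply/asboolP; exists 0; rewrite scale0r.
    move=> c x y /asboolP[t ->] /asboolP[t' ->]; apply/asboolP.
    by exists (c * t + t'); rewrite scalerDl scalerA.
  - by case: nv; apply: z; apply/asboolP; exists 1; rewrite scale1r.
  - exact/asboolP/(all v').
move=> P [P0 PL].
have [[v [Pv nv]]|no] := pselect (exists v, v \in P /\ v <> 0); last first.
  by left=> v Pv; apply: contrapT => nv; apply: no; exists v.
right=> v'; have [t ->] := h v v' nv.
by rewrite -[t *: v]addr0; apply: PL.
Qed.

Lemma mod_simple_fdim (N : lmodType TT) : mod_simple N -> fdim (restr N).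
Proof.
move=> /mod_simpleP[[v nv] h].
have l : linear ((fun t : TT => t *: v) : TT -> restr N).
  move=> c s t; rewrite scalerDl; congr (_ + _).
  by rewrite -[in LHS](mul1r s) scalerAl -scalerA.
by apply: (@fdim_surj _ _ _ (mklin l)) => v'; have [t ->] := h v v' nv; exists t.
Qed.

Section Radical.
Variables (w : X) (M : grmod).

(** The largest graded submodule of [M] vanishing in degree [w]. *)
Definition radical (v : M) : Prop := forall x : A, gpr w (x *: v) = 0.

Lemma radical_gsub : gsub radical.
Proof.
split=> [x|x u v hu hv y|y u hu x].
- by rewrite scaler0 gpr0.
- by rewrite scalerDr gprD hv scalerA hu addr0.
rewrite (gpr_actr wtP _ _ (gpr_homog y u)).
have := hu (wt (w - y) x); rewrite (gpr_actl _ _ (pr_homog wtP.1 _ x)).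
by rewrite opprB addrCA subrr addr0.
Qed.

Definition top : grmod := quotobj radical_gsub.

Definition generated : Prop := forall P : M -> Prop, gsub P ->
  (forall v, gpr w v = v -> P v) -> forall v, P v.

(** Simplicity of the [T]-module of degree [w], in terms of elements of [M]. *)
Definition ws_simple : Prop := (exists v : M, v <> 0 /\ gpr w v = v) /\
  forall v v' : M, v <> 0 -> gpr w v = v -> gpr w v' = v' ->
  exists t, t \in T /\ v' = t *: v.

Hypotheses (Mgen : generated) (Msimple : ws_simple).

(** A submodule not contained in the radical meets the simple weight space that
    generates [M]. *)
Lemma radical_dichotomy P : gsub P -> (forall v, P v -> radical v) \/ (forall v, P v).
Proof.
move=> hP.
have [[v [Pv nr]]|no] := pselect (exists v, P v /\ ~ radical v); last first.
  by left=> v Pv; apply: contrapT => nv; apply: no; exists v.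
right; apply: Mgen => // v' hv'.
have [x nx] : exists x : A, gpr w (x *: v) <> 0 by apply/existsNP.
have [|t [_ ->]] := Msimple.2 _ v' nx _ hv'; first by rewrite gprK eqxx.
by apply/(gsubZ hP)/(gsub_gpr hP)/(gsubZ hP).
Qed.

Lemma radical_proper : exists v, ~ radical v.
Proof.
by have [v [nv hv]] := Msimple.1; exists v => /(_ 1); rewrite scale1r hv.
Qed.

Lemma top_simple : @is_simple K C top.
Proof.
apply/simpleP; split.
  have [v nv] := radical_proper; exists (ap (quot_proj radical_gsub) v).
  by move=> /(quot_proj_eq0 radical_gsub).
move=> P hP; have [h|h] := radical_dichotomy (gsub_preim (quot_proj radical_gsub) hP).
  left=> t; have [v <-] := quot_proj_surj radical_gsub t => /h.
  by move/(quot_proj_eq0 radical_gsub).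
by right=> t; have [v <-] := quot_proj_surj radical_gsub t; apply: h.
Qed.

Lemma top_unique (L : grmod) (f : Hom M L) : @is_simple K C L -> onto f ->
  forall v, ap f v = 0 <-> radical v.
Proof.
move=> /simpleP[[l nl] Ls] fs.
have kr v : ap f v = 0 -> radical v.
  have [h|h] := radical_dichotomy (gker_gsub f); first exact: h.
  by case: nl; have [v' <-] := fs l; apply: h.
move=> v; split; first exact: kr.
have [h rv|h] := Ls _ (gsub_image f radical_gsub); first by apply: h; exists v.
have [u nu] := radical_proper; case: nu.
have [r rr rE] := h (ap f u).
have /kr : ap f (u - r) = 0 by rewrite apB rE subrr.
by move=> /(gsubD radical_gsub)/(_ rr); rewrite subrK.
Qed.

Lemma top_iso (L : grmod) (f : Hom M L) : @is_simple K C L -> onto f ->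
  exists i : Hom top L, is_iso i /\ f = i \oc quot_proj radical_gsub.
Proof.
move=> Ls fs; have fE := top_unique Ls fs.
have [|i iE] := hom_colift (g := f) (quot_proj_surj radical_gsub).
  by move=> v /(quot_proj_eq0 radical_gsub)/fE.
exists i; split=> //; apply/isoP; split.
  apply: ap_inj0 => t; have [v <-] := quot_proj_surj radical_gsub t.
  by rewrite (ap_comp_eq iE) => /fE/(quot_proj_eq0 radical_gsub).
move=> l; have [v <-] := fs l; exists (ap (quot_proj radical_gsub) v).
exact: (ap_comp_eq iE).
Qed.

End Radical.

Lemma delta_generated w N : generated w (delta w N).
Proof.
move=> P hP h v; rewrite (delta_genE v); apply: (gsub_sum hP) => j _.
by apply/(gsubZ hP)/h; apply: tau1_gpr.
Qed.

Lemma delta_ws_simple w (N : tmodule) : mod_simple N -> ws_simple w (delta w N).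
Proof.
move=> /mod_simpleP[[v nv] h]; split.
  exists (tau N 1 v); split; last exact: tau1_gpr.
  by move=> e; apply: nv; rewrite -(dcomp_tau1 hI wtP hc w v) e dcomp0.
move=> u u' nu hu hu'; rewrite (delta_ws hu) (delta_ws hu').
have nu0 : dcomp u ord0 <> 0.
  move=> e; apply: nu; rewrite (delta_ws hu) e.
  by apply: dcomp_ext => j; rewrite dcomp_tau dcomp0 scaler0.
have [t tE] := h _ (dcomp u' ord0) nu0.
by exists (vsval t); split; [apply: subvsP|rewrite tE -tau1_scale].
Qed.

End Simples.
(** * The simple objects *)

Section Labels.
Context {K : fieldType} {X : zmodType} {A : falgType K} {wt : X -> A -> A}.
Context {n : nat} {I : 'I_n -> X}.
Hypothesis hI : is_Zbasis I.
Hypothesis wtP : is_alg_grading wt.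
Context {T : {aspace A}} {B : {vspace A}} {m : nat}.
Context {a : 'I_m.+1 -> A} {d : 'I_m.+1 -> X} {beta : 'I_m.+1 -> A -> A}.
Context {q : nat} {p : 'I_q -> A} {gam : 'I_q -> A -> A}.
Hypothesis hc : tri_coords wt I T B a d beta p gam.
Notation TT := (subvs_of T).
Notation grmod := (grmod wt).
Notation C := (grmodcat wt).
Notation Hom M N := (@hom K (grmodcat wt) M N).
Notation D := (grmodcat (@wt_triv K TT)).
Notation THom M N := (@hom K (grmodcat (@wt_triv K TT)) M N).
Notation tmodule := (Defs.grmod (@wt_triv K TT)).
Notation J := 'I_m.+1.
Notation delta := (delta hI wtP hc).
Notation tau N := (@tau K X A wt n I hI wtP T B m a d beta q p gam hc N).
Notation rho := (@rho K X A wt T).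
Notation top := (top wtP).

Lemma simple_ws (M : grmod) w (v : M) : @is_simple K C M -> no_above (I := I) w M ->
  v <> 0 -> gpr w v = v -> forall u, exists x : A, u = x *: v.
Proof.
move=> /simpleP[_ h] na nv hv.
have hP : gsub (fun u : M => exists x : A, u = x *: v).
  split=> [|c _ _ [x ->] [y ->]|z _ [x ->]]; first by exists 0; rewrite scale0r.
    by exists (c * x + y); rewrite scalerDl scalerA.
  by exists (wt (z - w) x); rewrite (gpr_actr wtP _ _ hv).
by have [z|//] := h _ hP; case: nv; apply: z; exists 1; rewrite scale1r.
Qed.

(** By the decomposition [A = sum a j B], the component of degree [w] of [A v]
    is [T v]. *)
Lemma simple_ws_simple (M : grmod) w : @is_simple K C M -> no_above (I := I) w M ->
  (exists v : M, v <> 0 /\ gpr w v = v) -> ws_simple (T := T) w M.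
Proof.
move=> sM na ex; split=> // v v' nv hv hv'.
have [x xE] := simple_ws sM na nv hv v'.
exists (vsval (rho (beta ord0 x))); split; first exact: subvsP.
rewrite -hv' xE [in LHS](tc_beta hc x) scaler_suml gpr_sum.
rewrite (bigD1 ord0) //= big1 ?addr0 => [|j j0];
  rewrite -scalerA (gpr_actl _ _ (tc_a hc _)).
  rewrite (tc_a0 hc) (tc_d0 hc) subr0 scale1r.
  rewrite (no_above_rho wtP hc na (tc_betaB hc _ _) hv).
  by rewrite (gpr_actl _ _ (tcT0 hc (subvsP _))) subr0 hv.
rewrite (no_above_rho wtP hc na (tc_betaB hc _ _) hv).
rewrite (gpr_actl _ _ (tcT0 hc (subvsP _))) subr0 -hv gprK.
case: eqP => [e|_]; last by rewrite !scaler0.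
case/eqP: j0; apply: (tc_d hc); apply: (addrI (w - d j)).
by rewrite subrK addr0 e.
Qed.

Lemma ws_simple_mod (M : grmod) w : ws_simple (T := T) w M ->
  mod_simple (gcar (wspace hc w M)).
Proof.
move=> [[v [nv hv]] h]; apply/mod_simpleP; split.
  by exists (wsmk hc w v) => /(congr1 (@wsval _ _ _ _ _ _ _ _ _ _ _ _ _ _ _ hc w M));
    rewrite wsmkK hv wsval0.
move=> u u' nu.
have [|t [tT tE]] := h (wsval u) (wsval u') _ (wsvalK u) (wsvalK u').
  by move=> e; apply: nu; apply: wsval_inj; rewrite e wsval0.
by exists (vsproj T t); apply: wsval_inj; rewrite wsvalZ vsprojK.
Qed.

Lemma iso_mod_iso (N N' : tmodule) (f : THom N N') : is_iso f -> mod_iso (gcar N) (gcar N').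
Proof.
move=> [g [gf fg]].
pose F : {linear gcar N -> gcar N'} :=
  HB.pack (ap f) (GRing.isLinear.Build TT (gcar N) (gcar N') *:%R (ap f) (apL f)).
exists F; exists (ap g) => v; rewrite /=; first exact: (ap_comp_eq gf).
exact: (ap_comp_eq fg).
Qed.

Lemma mod_iso_hom (N N' : tmodule) : mod_iso (gcar N) (gcar N') ->
  exists f : THom N N', is_iso f.
Proof.
move=> [f [g fK gK]]; have [h hE] := @tmod_hom _ TT N N' f (linearP f).
exists h; apply/isoP; split=> [u v|v]; first by rewrite !hE => /(can_inj fK).
by exists (g v); rewrite hE gK.
Qed.

Context {IrrT : Type} {S : IrrT -> lmodType TT} (hS : mod_irr S).

Lemma S_simple lam : mod_simple (S lam). Proof. by case: hS. Qed.

Definition tS lam : tmodule := tmod (mod_simple_fdim (S_simple lam)).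

Definition simple_obj (l : IrrT * X) : C := top l.2 (delta l.2 (tS l.1)).

Lemma deltaS_gen lam w : generated w (delta w (tS lam)).
Proof. exact: delta_generated. Qed.

Lemma deltaS_simple lam w : ws_simple (T := T) w (delta w (tS lam)).
Proof. exact/delta_ws_simple/S_simple. Qed.

Lemma simple_obj_simple l : is_simple (simple_obj l).
Proof. exact: (top_simple wtP (@deltaS_gen l.1 l.2) (@deltaS_simple l.1 l.2)). Qed.

Lemma simple_obj_head (Ap : {aspace A}) lam w : B = (Ap * T)%VS ->
  is_simple_head Ap (S lam) w (simple_obj (lam, w)).
Proof.
move=> BE; split; first exact: simple_obj_simple.
exists (delta w (tS lam)), (tau (tS lam)); split.
  exact: (delta_induced hI wtP hc w (tS lam) BE).
exists (quot_proj (radical_gsub wtP w (delta w (tS lam)))); split.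
  exact/epiP/quot_proj_surj.
move=> L' q' sL' /epiP qs.
exact: (top_iso wtP (@deltaS_gen lam w) (@deltaS_simple lam w) sL' qs).
Qed.

Lemma simple_obj_below lam w : supp_in (below (I := I) w) (simple_obj (lam, w)).
Proof.
apply: supp_in_quot (quot_proj_surj (radical_gsub wtP w (delta w (tS lam)))) _.
exact: delta_below.
Qed.

Lemma simple_obj_ws lam w : exists f : THom (tS lam) (wspace hc w (simple_obj (lam, w))),
  is_iso f.
Proof.
pose hR := radical_gsub wtP w (delta w (tS lam)).
exists (fmap (pi hc w) _ _ (quot_proj hR) \oc eta hI wtP hc w (tS lam)); apply/isoP; split.
  apply: ap_inj0 => v /(congr1 (@wsval _ _ _ _ _ _ _ _ _ _ _ _ _ _ _ hc w _)).
  rewrite ap_comp ap_pi etaE wsval0 => /(quot_proj_eq0 hR)/(_ 1).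
  rewrite scale1r tau1_gpr => e.
  by rewrite -(dcomp_tau1 hI wtP hc w v) e dcomp0.
move=> u; have [h hE] := quot_proj_surj hR (wsval u).
exists (dcomp (gpr w h) ord0); apply: wsval_inj.
rewrite ap_comp ap_pi etaE -delta_ws; last by rewrite gprK eqxx.
by rewrite ap_gpr hE wsvalK.
Qed.

Lemma simple_obj_nz lam w : exists v : (simple_obj (lam, w) : grmod), v <> 0 /\ gpr w v = v.
Proof.
have [f /isoP[fi _]] := simple_obj_ws lam w.
have /mod_simpleP[[v nv] _] := S_simple lam.
exists (wsval (ap f (v : tS lam))); split; last exact: wsvalK.
move=> e; apply: nv; apply: fi; apply: wsval_inj.
by rewrite e ap0 wsval0.
Qed.

Lemma iso_degree (M N : grmod) w : @isomorphic K C M N ->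
  (exists v : M, v <> 0 /\ gpr w v = v) -> exists v : N, v <> 0 /\ gpr w v = v.
Proof.
move=> [f /isoP[fi _]] [v [nv hv]]; exists (ap f v); split; last by rewrite -ap_gpr hv.
by move=> e; apply: nv; apply: fi; rewrite e ap0.
Qed.

Lemma simple_obj_degree lam w v : (exists u : (simple_obj (lam, w) : grmod),
  u <> 0 /\ gpr v u = u) ->
  cone I (w - v).
Proof.
move=> [u [nu hu]]; apply: contrapT => nc; apply: nu; rewrite -hu.
exact: (simple_obj_below nc).
Qed.

Lemma simple_obj_inj l l' : isomorphic (simple_obj l) (simple_obj l') -> l = l'.
Proof.
case: l l' => [lam w] [mu v] e.
have wv : w = v.
  apply: (cone_anti hI).
    exact: (simple_obj_degree (iso_degree e (simple_obj_nz lam w))).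
  exact: (simple_obj_degree (iso_degree (iso_sym e) (simple_obj_nz mu v))).
rewrite -{}wv in e *; congr pair; case: hS => _ inj _; apply: inj.
have [f fi] := simple_obj_ws lam w; have [g gi] := simple_obj_ws mu w.
have [h hi] := e.
have i1 : @isomorphic K D (tS lam) (tS mu).
  apply: iso_trans (iso_sym (ex_intro _ g gi)).
  by apply: iso_trans (ex_intro _ f fi) _; exists (fmap (pi hc w) _ _ h);
    apply: (fmap_iso (pi hc w) hi).
by have [k ki] := i1; apply: (iso_mod_iso ki).
Qed.

(** The weight space of a maximal degree is simple, and the map from the standard
    module adjoint to its identification with some [S lam] is onto. *)
Lemma simple_classification (M : C) : is_simple M -> exists l, isomorphic M (simple_obj l).
Proof.
move=> sM; have /simpleP[nz _] := sM.
have [w [na ex]] := max_degree hI nz.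
have wss := simple_ws_simple sM na ex.
have [lam lamE] : exists lam, mod_iso (gcar (wspace hc w M)) (S lam).
  by case: hS => _ _; apply; apply: ws_simple_mod.
have [f fi] := @mod_iso_hom (wspace hc w M) (tS lam) lamE.
have [f' [f'f ff']] := fi.
have [g gE] := delta_hom hI wtP f' na.
have gt := delta_hom_tau gE.
have gs : onto g.
  have /simpleP[_ h] := sM.
  have [z|//] := h _ (gimg_gsub g).
  have [v [nv hv]] := ex; case: nv.
  apply: z; exists (tau _ 1 (ap f (wsmk hc w v))).
  by rewrite gt (ap_comp_eq f'f) wsmkK.
have [i [ii _]] := top_iso wtP (@deltaS_gen lam w) (@deltaS_simple lam w) sM gs.
by exists (lam, w); apply: iso_sym; exists i.
Qed.

(** On the weight space of a maximal degree the endomorphism is a scalar [c], so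
    [f - c] has a nonzero kernel. *)
Lemma simple_abs (hsplit : is_split_alg TT) (M : C) : is_simple M -> absolutely_simple M.
Proof.
move=> sM; split=> // f; have /simpleP[nz h] := sM.
have [w [na ex]] := max_degree hI nz.
have sW := ws_simple_mod (simple_ws_simple sM na ex).
pose fw := fmap (pi hc w) _ _ f.
pose F : {linear gcar (wspace hc w M) -> gcar (wspace hc w M)} :=
  HB.pack (ap fw) (GRing.isLinear.Build TT (gcar (wspace hc w M)) (gcar (wspace hc w
    M)) *:%R (ap fw) (apL fw)).
have [c cE] := hsplit _ sW F.
exists c; apply: hom_ext => u; apply/eqP; rewrite -subr_eq0; apply/eqP.
have hP := gker_gsub (f + (- c) *: idm M).
have fE v : ap (f + (- c) *: idm M) v = ap f v - ap (c *: idm M) v.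
  by rewrite ap_add !ap_scale scaleNr scaleNr.
have [z|all] := h _ hP; last by rewrite -fE.
have [v [nv hv]] := ex; case: nv; apply: z; rewrite fE.
have e := congr1 (@wsval _ _ _ _ _ _ _ _ _ _ _ _ _ _ _ hc w M) (cE (wsmk hc w v)).
rewrite /= ap_pi wsvalZ (val_scalar hc) wsmkK hv in e.
by rewrite e ap_scale subrr.
Qed.

End Labels.
(** * The strata *)

Section Strata.
Context {K : fieldType} {X : zmodType} {A : falgType K} {wt : X -> A -> A}.
Context {n : nat} {I : 'I_n -> X}.
Hypothesis hI : is_Zbasis I.
Hypothesis wtP : is_alg_grading wt.
Context {T : {aspace A}} {B : {vspace A}} {m : nat}.
Context {a : 'I_m.+1 -> A} {d : 'I_m.+1 -> X} {beta : 'I_m.+1 -> A -> A}.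
Context {q : nat} {p : 'I_q -> A} {gam : 'I_q -> A -> A}.
Hypothesis hc : tri_coords wt I T B a d beta p gam.
Notation TT := (subvs_of T).
Notation grmod := (grmod wt).
Notation C := (grmodcat wt).
Notation Hom M N := (@hom K (grmodcat wt) M N).
Notation D := (grmodcat (@wt_triv K TT)).
Notation THom M N := (@hom K (grmodcat (@wt_triv K TT)) M N).
Notation tmodule := (Defs.grmod (@wt_triv K TT)).
Notation J := 'I_m.+1.
Notation delta := (delta hI wtP hc).
Notation Delta := (Delta hI wtP hc).
Notation tau N := (@tau K X A wt n I hI wtP T B m a d beta q p gam hc N).
Notation rho := (@rho K X A wt T).
Notation eta := (eta hI wtP hc).
Notation pi := (pi hc).
Context {IrrT : Type} {S : IrrT -> lmodType TT} (hS : mod_irr S).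
Notation L := (simple_obj hI wtP hc hS).
Notation below := (below (I := I)).

(** An isomorphism is a short exact sequence with zero kernel. *)
Lemma serre_iso (P : C -> Prop) (x y : grmod) : is_serre P -> @isomorphic K C x y ->
  P y -> P x.
Proof.
move=> [P0 Pe] [f fi] Py.
pose hz := gsub_zero x.
have zz : @is_zero K C (subobj hz).
  by apply/zeroP => t; apply: (sub_incl_inj hz); rewrite ap0; apply/(sub_inclP hz);
    exists t.
have /isoP[finj fs] := fi.
suff : P x /\ P y by case.
have [g [gf fg]] := fi.
have ex : short_exact (sub_incl hz : @hom K C _ _) f.
  apply/exactP; split; [exact: sub_incl_inj|exact: fs|move=> v].
  rewrite sub_inclP; split=> [e|->]; last exact: ap0.
  by apply: finj; rewrite e ap0.
have [_ h] := Pe _ _ _ _ _ ex; split=> //; apply: h; split=> //.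
exact: P0.
Qed.

(** A simple object [L (lam, w)] lies in degrees [<= w] and is nonzero in degree
    [w], so its support satisfies [Q] as soon as [Q w] holds; the general case
    follows along a composition series. *)
Lemma serre_gen_supp (Q : X -> Prop) (x : grmod) :
  (forall u v, Q u -> cone I (u - v) -> Q v) ->
  serre_gen (fun y : C => exists l : IrrT * X, Q l.2 /\ y = L l) x <-> supp_in Q x.
Proof.
move=> Qdown; split=> [|hx P Pserre PL].
  move=> h; apply: h; first exact: supp_in_serre.
  move=> _ [[lam w] [Qw ->]] u nu v; apply: (simple_obj_below (hI := hI) (wtP :=
    wtP) (hc := hc) (hS := hS)).
  by move=> c; apply: nu; apply: Qdown c.
have := @grmodcat_finite_length K X A wt x; move: hx.
suff gen (y : C) : filtered (@is_simple K C) y -> supp_in Q (y : grmod) -> P y.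
  by move=> hx /gen; apply.
elim=> [z zz _|{}y z t f g fg _ IH st ht]; first exact: Pserre.1.
have [hy ht'] := (supp_in_ext Q ((exactP _ _).1 fg)).1 ht.
apply/(Pserre.2 _ _ _ _ _ fg); split; first exact: IH.
have [[lam w] lE] := simple_classification hI wtP hc hS st.
apply: (serre_iso Pserre lE); apply: PL; exists (lam, w); split=> //=.
apply: contrapT => nQ.
have [v [nv hv]] := iso_degree (iso_sym lE) (simple_obj_nz hI wtP hc hS lam w).
by apply: nv; rewrite -hv ht'.
Qed.

Notation strat_le := (strat_le L (Xi := cone_poset hI) (fun l : IrrT * X => l.2)).
Notation strat_lt := (strat_lt L (Xi := cone_poset hI) (fun l : IrrT * X => l.2)).

Lemma strat_leE w (x : grmod) : strat_le w x <-> supp_in (below w) x.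
Proof. by apply: serre_gen_supp => u v hu hv; apply: cone_trans hv hu. Qed.

Lemma strat_ltE w (x : grmod) : strat_lt w x <->
  supp_in (below w) x /\ forall v : x, gpr w v = 0.
Proof.
rewrite /strat_lt (serre_gen_supp (Q := fun u => @plt (cone_poset hI) u w)); last first.
  move=> u v [hu uw] hv; split; first exact: cone_trans hv hu.
  by move=> e; subst v; apply: uw; apply: (cone_anti hI).
split=> [h|[h hw] u nu v].
  split=> [u nu v|v]; last by apply: h => -[].
  by apply: h => -[].
have [->|/eqP uw] := eqVneq u w; first exact: hw.
by apply: h => c; apply: nu.
Qed.

Lemma strat_le_sub w : closed_sub (strat_le w : grmod -> Prop).
Proof. by move=> M N f fi /strat_leE h; apply/strat_leE; apply: supp_in_sub fi h. Qed.

Lemma strat_le_quot w : closed_quot (strat_le w : grmod -> Prop).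
Proof. by move=> M N f fi /strat_leE h; apply/strat_leE; apply: supp_in_quot fi h. Qed.

Lemma strat_le_no_above w (x : grmod) : strat_le w x -> no_above (I := I) w x.
Proof. by move=> /strat_leE; apply: below_no_above. Qed.

Lemma strat_le_delta w N : strat_le w (delta w N).
Proof. by apply/strat_leE; apply: delta_below. Qed.

Section Stratum.
Variable w : X.
Notation Cw := (full_subcat (strat_le w)).

Definition quo_functor : linfunctor Cw D :=
  @LinFunctor K Cw D (fun x => pi w (sval x))
    (fun x y => @fmap K C D (pi w) (sval x) (sval y))
    (fun x => @fmap1 K C D (pi w) (sval x))
    (fun x y z => @fmapM K C D (pi w) (sval x) (sval y) (sval z)).

Definition std_functor : linfunctor D Cw :=
  @LinFunctor K D Cw (fun N => exist _ (Delta w N) (@strat_le_delta w N))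
    (fun N N' => @fmap K D C (Delta w) N N')
    (@fmap1 K D C (Delta w)) (@fmapM K D C (Delta w)).

Lemma quo_functor_exact : exact quo_functor.
Proof.
move=> x y z f g /full_exactP e; apply: (@pi_exact _ _ _ _ _ _ _ _ _ _ _ _ _ _ _ hc w).
apply/exactP; apply: e; [exact: strat_le_sub|exact: strat_le_quot].
Qed.

Lemma std_functor_exact : exact std_functor.
Proof.
move=> x y z f g /exactP e; apply/full_exactP; [exact: strat_le_sub|exact: strat_le_quot|].
exact: Delta_sexact.
Qed.

Lemma std_adjoint : is_left_adjoint std_functor quo_functor.
Proof.
exists (fun N => eta w N); split=> [N N' f|N [c Pc] f]; first exact: eta_natural.
exact: (delta_adj hI wtP f (strat_le_no_above Pc)).
Qed.

Lemma counit_exists : exists eps : forall c : Cw, hom (std_functor (quo_functor c)) c,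
  forall c, fmap quo_functor _ _ (eps c) \oc eta w (quo_functor c) = idm (quo_functor c).
Proof.
have ex (c : Cw) : {e : hom (std_functor (quo_functor c)) c |
    fmap quo_functor _ _ e \oc eta w (quo_functor c) = idm (quo_functor c)}.
  apply: cid; case: c => c Pc.
  have [e [eE _]] := delta_adj hI wtP (idm (wspace hc w c : D)) (strat_le_no_above Pc).
  by exists e.
by exists (fun c => sval (ex c)) => c; apply: (svalP (ex c)).
Qed.

Lemma Delta_tau N N' (f : THom N N') v :
  ap (fmap (Delta w) N N' f) (tau N 1 v : delta w N) = (tau N' 1 (ap f v) : delta w N').
Proof. by apply: dcomp_ext => j; rewrite dcomp_Delta !dcomp_tau apZ. Qed.

(** The counit is bijective in degree [w]. *)
Lemma counit_S_iso (c : grmod) (Pc : strat_le w c) (e : Hom (delta w (wspace hc w c)) c) :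
  (forall u, ap e (tau _ 1 u : delta w (wspace hc w c)) = wsval u) ->
  S_iso (fun x : Cw => strat_lt w (sval x))
    (e : @hom K Cw (exist _ _ (@strat_le_delta w (wspace hc w c))) (exist _ c Pc)).
Proof.
move=> eE; pose hk := gker_gsub e; pose hi := gimg_gsub e.
have Pi := strat_le_sub (sub_incl_inj hi) Pc.
have Pq := strat_le_quot (quot_proj_surj hi) Pc.
have Pk := strat_le_sub (sub_incl_inj hk) (@strat_le_delta w (wspace hc w c)).
have [|e' e'E] := hom_lift (g := e) (sub_incl_inj hi).
  by move=> h; apply/(sub_inclP hi); exists h.
have e'v := ap_comp_eq e'E.
exists (exist _ _ Pk), (exist _ _ Pi), (exist _ _ Pq).
exists (sub_incl hk), e', (sub_incl hi), (quot_proj hi); split=> /=.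
- apply/full_exactP; [exact: strat_le_sub|exact: strat_le_quot|].
  split=> [|t|h]; first exact: sub_incl_inj.
    have [h hE] := (sub_inclP hi (ap (sub_incl hi) t)).1 (ex_intro _ t erefl).
    by exists h; apply: (sub_incl_inj hi); rewrite e'v.
  rewrite sub_inclP -e'v; split=> [->|z]; first exact: ap0.
  by apply: (sub_incl_inj hi); rewrite z ap0.
- apply/full_exactP; [exact: strat_le_sub|exact: strat_le_quot|].
  exact: sub_quot_exact.
- exact: (esym e'E).
- apply/strat_ltE; split; first exact/strat_leE.
  move=> t; apply: (sub_incl_inj hk); rewrite ap0 ap_gpr.
  set h := ap (sub_incl hk) t.
  have hk0 : ap e h = 0 by apply/(sub_inclP hk); exists t.
  have hw : gpr w (gpr w h) = gpr w h by rewrite gprK eqxx.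
  have := eE (dcomp (gpr w h) ord0); rewrite -(delta_ws hw) ap_gpr hk0 gpr0 => z.
  rewrite (delta_ws hw); set v := dcomp _ _ in z *.
  have -> : v = 0 by apply: wsval_inj; rewrite -z wsval0.
  by apply: dcomp_ext => j; rewrite dcomp_tau dcomp0 scaler0.
apply/strat_ltE; split; first exact/strat_leE.
move=> t; have [v <-] := quot_proj_surj hi t; rewrite -ap_gpr.
apply/(quot_proj_eq0 hi); exists (tau _ 1 (wsmk hc w v)).
by rewrite eE wsmkK.
Qed.

Lemma strat_quotient :
  is_serre_quotient (fun x : Cw => strat_lt w (sval x)) quo_functor.
Proof.
have [eps epsE] := counit_exists.
have epsv (c : Cw) u : @ap K X A wt (delta w (wspace hc w (sval c))) (sval c) (eps
  c) (tau _ 1 u) = wsval u.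
  have /(congr1 (@wsval _ _ _ _ _ _ _ _ _ _ _ _ _ _ _ hc w (sval c))) :=
    ap_comp_eq (epsE c) u.
  by rewrite ap_pi etaE.
apply: (@serre_quotient_of_adjoint _ Cw D _ quo_functor std_functor (eta w) eps).
- exact: (grmodcat_abelian (freeobj (wt_trivP TT) (fun _ : 'I_1 => 0))).
- exact: quo_functor_exact.
- exact: std_functor_exact.
- by move=> N N' f; apply: eta_natural.
- by move=> N; apply: eta_iso.
- move=> c c' f.
  apply: (@delta_hom_ext _ _ _ _ _ _ hI wtP _ _ _ _ _ _ _ _ _ hc w _ (sval c')) => u.
  rewrite [LHS](congr1 _ (Delta_tau _ u)) [LHS]epsv.
  by rewrite [RHS](congr1 _ (epsv c u)) ap_pi.
- exact: epsE.
- move=> x /strat_ltE[_ h]; apply/zeroP => u; apply: wsval_inj.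
  by rewrite -(wsvalK u) h wsval0.
by case=> c Pc; apply: counit_S_iso; apply: (epsv (exist _ c Pc)).
Qed.

Definition weight_stratum :
    @stratum K C (IrrT * X)%type L (cone_poset hI) (fun l : IrrT * X => l.2) w :=
  Stratum strat_quotient std_adjoint std_functor_exact.

End Stratum.

End Strata.
(** * Standard filtrations *)

Lemma count_lt (V : eqType) (s : seq V) (P Q : pred V) x : x \in s ->
  Q x -> ~~ P x -> (forall y, P y -> Q y) -> (count P s < count Q s)%N.
Proof.
move=> xs Qx nPx PQ; elim: s xs => //= y s IH; rewrite inE.
have le : (P y <= Q y)%N by case: (boolP (P y)) => // /PQ ->.
case/orP=> [/eqP <-|/IH lt]; last by rewrite -addnS leq_add.
by rewrite Qx (negPf nPx) add0n add1n ltnS sub_count.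
Qed.

Section Layers.
Context {K : fieldType} {X : zmodType} {A : falgType K} {wt : X -> A -> A}.
Context {n : nat} {I : 'I_n -> X}.
Hypothesis hI : is_Zbasis I.
Hypothesis wtP : is_alg_grading wt.
Context {T : {aspace A}} {B : {vspace A}} {m : nat}.
Context {a : 'I_m.+1 -> A} {d : 'I_m.+1 -> X} {beta : 'I_m.+1 -> A -> A}.
Context {q : nat} {p : 'I_q -> A} {gam : 'I_q -> A -> A}.
Hypothesis hc : tri_coords wt I T B a d beta p gam.
Notation TT := (subvs_of T).
Notation grmod := (grmod wt).
Notation C := (grmodcat wt).
Notation Hom M N := (@hom K (grmodcat wt) M N).
Notation D := (grmodcat (@wt_triv K TT)).
Notation THom M N := (@hom K (grmodcat (@wt_triv K TT)) M N).
Notation tmodule := (Defs.grmod (@wt_triv K TT)).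
Notation J := 'I_m.+1.
Notation delta := (delta hI wtP hc).
Notation Delta := (Delta hI wtP hc).
Notation tau N := (@tau K X A wt n I hI wtP T B m a d beta q p gam hc N).
Notation pi := (pi hc).
Notation plt := (@plt (cone_poset hI)).
Notation wsval w M := (@wsval _ _ _ _ _ _ _ _ _ _ _ _ _ _ _ hc w M).

(** The graded submodule generated by the components of degree in [U], as an
    intersection. *)
Definition gen_by (U : X -> Prop) (M : grmod) (v : M) : Prop :=
  forall P : M -> Prop, gsub P -> (forall u x, U u -> gpr u x = x -> P x) -> P v.

Lemma gen_by_gsub U M : gsub (@gen_by U M).
Proof.
split=> [P hP _|c u v hu hv P hP h|x u hu P hP h]; first exact: gsub0.
  by apply: (gsubL hP); [apply: hu|apply: hv].
by apply: (gsub_gpr hP); apply: hu.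
Qed.

Lemma gen_by_deg (U : X -> Prop) (M : grmod) u (x : M) : U u -> gpr u x = x -> gen_by U x.
Proof. by move=> Uu ux P hP h; apply: h Uu ux. Qed.

Lemma gen_by_map U (M N : grmod) (f : Hom M N) v : gen_by U v -> gen_by U (ap f v).
Proof.
move=> h; apply: (h _ (gsub_preim f (gen_by_gsub U N))) => u x Uu ux.
by apply: gen_by_deg Uu _; rewrite -ap_gpr ux.
Qed.

Definition quot_by U (M : grmod) : grmod := quotobj (gen_by_gsub U M).
Notation qproj U M := (quot_proj (gen_by_gsub U M)).

Lemma quot_by_no_above U (M : grmod) v : (forall u, plt v u -> U u) ->
  no_above (I := I) v (quot_by U M).
Proof.
move=> h u uv cu z; have [y <-] := quot_proj_surj (gen_by_gsub U M) z.
rewrite -ap_gpr; apply/(quot_proj_eq0 (gen_by_gsub U M)).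
apply: (@gen_by_deg U M u); last by rewrite gprK eqxx.
by apply: h; split=> // e; apply: uv.
Qed.

(** Under these conditions the weight space of the degree [v] generates a copy
    of its standard module: the second condition is the injectivity of the
    canonical map to [Z]. *)
Definition free_layer v (Z : grmod) : Prop :=
  [/\ @is_projective K D (wspace hc v Z),
      forall z : J -> Z, (forall j, gpr v (z j) = z j) ->
        \sum_j a j *: z j = 0 -> forall j, z j = 0
    & no_above (I := I) v Z].

Lemma free_layer_retract v (Z Z' : grmod) (i : Hom Z' Z) (r : Hom Z Z') :
  r \oc i = idm (Z' : C) -> free_layer v Z -> free_layer v Z'.
Proof.
move=> ri [pZ fZ nZ]; have riv := ap_comp_eq ri; split.
- apply: (projective_retract (i := fmap (pi v) _ _ i) (r := fmap (pi v) _ _ r)) pZ.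
  by rewrite -fmapM ri fmap1.
- move=> z zv zs j; rewrite -[z j]riv (fZ (fun j => ap i (z j))) ?ap0 //.
    by move=> k; rewrite -ap_gpr zv.
  by under eq_bigr do rewrite -apZ; rewrite -ap_sum zs ap0.
by move=> u uv cu z; rewrite -[z]riv -ap_gpr nZ // ap0.
Qed.

Lemma quot_by_retract U (M N : grmod) (i : Hom M N) (r : Hom N M) :
  r \oc i = idm (M : C) ->
  exists (i' : Hom (quot_by U M) (quot_by U N)) (r' : Hom (quot_by U N) (quot_by U M)),
    r' \oc i' = idm (quot_by U M : C).
Proof.
move=> ri; have riv := ap_comp_eq ri.
have [|i' /ap_comp_eq i'E] := hom_colift (g :=
  qproj U N \oc i) (quot_proj_surj (gen_by_gsub U M)).
  move=> v /(quot_proj_eq0 (gen_by_gsub U M)) h; rewrite ap_comp.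
  by apply/(quot_proj_eq0 (gen_by_gsub U N)); apply: gen_by_map.
have [|r' /ap_comp_eq r'E] := hom_colift (g :=
  qproj U M \oc r) (quot_proj_surj (gen_by_gsub U N)).
  move=> v /(quot_proj_eq0 (gen_by_gsub U N)) h; rewrite ap_comp.
  by apply/(quot_proj_eq0 (gen_by_gsub U M)); apply: gen_by_map.
exists i', r'; apply: hom_ext => z; have [v <-] := quot_proj_surj (gen_by_gsub U M) z.
by rewrite ap_comp i'E ap_comp r'E ap_comp riv.
Qed.

(** ** Layers of a free module of rank one *)

Section FreeLayer.
Variables (w : X) (U : X -> Prop) (v : X).
Hypothesis Uup : forall u u', U u -> cone I (u' - u) -> U u'.
Hypotheses (Uv : ~ U v) (Ugt : forall u, plt v u -> U u).
Let F : grmod := freeobj wtP (fun _ : 'I_1 => w).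

Definition free_elt (x : A) : F := [ffun _ => x] : {ffun 'I_1 -> A^o}.
Definition fcoef (c : F) : A := (c : {ffun 'I_1 -> A^o}) ord0.

Lemma free_eltK x : fcoef (free_elt x) = x. Proof. exact: ffunE. Qed.
Lemma fcoefK c : free_elt (fcoef c) = c.
Proof. by apply/ffunP => j; rewrite ffunE ord1. Qed.
Lemma fcoefD c c' : fcoef (c + c') = fcoef c + fcoef c'. Proof. exact: ffunE. Qed.
Lemma fcoef0 : fcoef 0 = 0. Proof. exact: ffunE. Qed.
Lemma fcoefZ x c : fcoef (x *: c) = x * fcoef c. Proof. exact: ffunE. Qed.
Lemma fcoef_gpr u c : fcoef (gpr u c) = wt (u - w) (fcoef c). Proof. exact: ffunE. Qed.
Lemma free_eltM x y : free_elt (x * y) = x *: free_elt y.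
Proof. by rewrite -[RHS]fcoefK fcoefZ free_eltK. Qed.
Lemma free_eltD x y : free_elt (x + y) = free_elt x + free_elt y.
Proof. by rewrite -[RHS]fcoefK fcoefD !free_eltK. Qed.
Lemma free_elt0 : free_elt 0 = 0. Proof. by rewrite -[RHS]fcoefK fcoef0. Qed.
Lemma free_elt_sum (R : Type) (r : seq R) (x : R -> A) :
  free_elt (\sum_(k <- r) x k) = \sum_(k <- r) free_elt (x k).
Proof. exact: (big_morph free_elt free_eltD free_elt0). Qed.
Lemma free_elt_deg x y : homog wt x y -> gpr (x + w) (free_elt y) = free_elt y.
Proof. by move=> hy; rewrite -[LHS]fcoefK fcoef_gpr addrK free_eltK hy. Qed.

(** All coordinates lie in the part of [B] with degrees in [U], up to the shift
    by [w]. *)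
Definition coef_in (c : F) : Prop :=
  forall j x, ~ U (x + w) -> wt x (beta j (fcoef c)) = 0.

Lemma coef_in_gsub : gsub coef_in.
Proof.
have wg := wtP.1.
split=> [j x _|x c c' hc1 hc2 j z nz|y c hc1 j z nz].
- have b0 : beta j 0 = 0 by apply: (addrI (beta j 0)); rewrite -(betaD hc) !addr0.
  by rewrite fcoef0 b0 (pr0 wg).
- rewrite fcoefD fcoefZ (betaD hc) (prD wg) hc2 // addr0.
  rewrite {1}(tc_beta hc (fcoef c)) mulr_sumr.
  under eq_bigr do rewrite mulrA.
  rewrite (beta_sum hc _ (fun k => x * a k)) => [|k]; last exact: (tc_betaB hc).
  rewrite (pr_sum wg) big1 // => i _.
  have [s us e] := pr_ex wg (beta i (fcoef c)).
  rewrite e mulr_sumr (pr_sum wg) big1 // => y _.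
  rewrite (wt_mulr wtP _ _ (pr_homog wg y _)).
  have [Uy|nU] := pselect (U (y + w)); last by rewrite hc1 // mulr0.
  have [->|/eqP ne] := eqVneq (wt (z - y) (beta j (x * a i))) 0; first by rewrite mul0r.
  case: nz; apply: Uup Uy _; rewrite opprD addrACA subrr addr0.
  exact: (tcB_cone hc (tc_betaB hc _ _) ne).
rewrite fcoef_gpr -[y - w](addrNK (d j)) addrC -(beta_wt wtP hc) (prK wg).
by case: eqP => // <-; apply: hc1.
Qed.

(** The elements with coordinates in degrees of [U] form a submodule because [B]
    lives in the cone and [U] is closed under adding elements of the cone. *)
Lemma gen_by_coef c : gen_by U c <-> coef_in c.
Proof.
have wg := wtP.1; split=> [h|h].
  apply: (h _ coef_in_gsub) => u c' Uu cu j x nx.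
  have hu : homog wt (u - w) (fcoef c') by rewrite /homog -fcoef_gpr cu.
  rewrite (homog_pr wg _ (beta_homog wtP hc j hu)); case: eqP => // e; case: nx.
  apply: Uup Uu _; rewrite e [_ - d j + w]addrAC subrK addrAC subrr add0r.
  exact: (tc_cone hc).
rewrite -[c]fcoefK (tc_beta hc (fcoef c)) free_elt_sum.
apply: (gsub_sum (gen_by_gsub U F)) => j _; rewrite free_eltM.
apply: (gsubZ (gen_by_gsub U F)).
have [s us e] := pr_ex wg (beta j (fcoef c)); rewrite e free_elt_sum.
apply: (gsub_sum (gen_by_gsub U F)) => x _.
have [Ux|nx] := pselect (U (x + w)).
  exact: gen_by_deg Ux (free_elt_deg (pr_homog wg x _)).
by rewrite h // free_elt0; apply: gsub0; apply: gen_by_gsub.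
Qed.

(** The other coordinates have degree larger than [v], since the [a j] with
    [j <> ord0] have negative degree. *)
Lemma layer_rest c : gpr v c = c -> gen_by U (c - free_elt (beta ord0 (fcoef c))).
Proof.
have wg := wtP.1; move=> cv.
have hu : homog wt (v - w) (fcoef c) by rewrite /homog -fcoef_gpr cv.
rewrite -{1}[c]fcoefK {1}(tc_beta hc (fcoef c)) free_elt_sum (bigD1 ord0) //=.
rewrite (tc_a0 hc) mul1r addrAC subrr add0r; apply: (gsub_sum (gen_by_gsub U F)) => j j0.
rewrite free_eltM; apply: (gsubZ (gen_by_gsub U F)).
have vd : v - d j <> v.
  move=> e; case/eqP: j0; apply: (tc_d hc); apply: oppr_inj; apply: (addrI v).
  by rewrite e oppr0 addr0.
apply: (@gen_by_deg U F (v - w - d j + w));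
  last exact: (free_elt_deg (beta_homog wtP hc j hu)).
apply: Ugt; split; rewrite [_ - d j + w]addrAC subrK; last by move=> e; apply: vd.
rewrite /= addrAC subrr add0r; exact: (tc_cone hc).
Qed.

Lemma layer_deg c : gpr v c = c -> homog wt (v - w) (beta ord0 (fcoef c)).
Proof.
move=> cv; have hu : homog wt (v - w) (fcoef c) by rewrite /homog -fcoef_gpr cv.
by have := beta_homog wtP hc ord0 hu; rewrite (tc_d0 hc) subr0.
Qed.

Lemma layer_gen c : gpr v c = c -> gen_by U c <-> beta ord0 (fcoef c) = 0.
Proof.
move=> cv; have hb := layer_deg cv; split=> [/gen_by_coef h|e].
  by rewrite -hb h // subrK.
by have := layer_rest cv; rewrite e free_elt0 subr0.
Qed.

(** For [j <> ord0] the coordinate of [t * a j] at [ord0] has negative degree, so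
    it vanishes. *)
Lemma beta0_T t x : t \in T -> beta ord0 (t * x) = t * beta ord0 x.
Proof.
move=> tT; have wg := wtP.1.
rewrite {1}(tc_beta hc x) mulr_sumr; under eq_bigr do rewrite mulrA.
rewrite (beta_sum hc _ (fun k => t * a k)) => [|k]; last exact: (tc_betaB hc).
rewrite (bigD1 ord0) //= big1 ?addr0 => [|j j0].
  rewrite (tc_a0 hc) mulr1 -{1}[t]mul1r -{1}(tc_a0 hc) (betaM hc) ?(tcTB hc) //.
  by rewrite (beta_a hc) eqxx mul1r.
have ht : homog wt (d j) (t * a j).
  by have := wtP.2 _ _ _ _ (tcT0 hc tT) (tc_a hc j); rewrite add0r.
have := beta_homog wtP hc ord0 ht; rewrite (tc_d0 hc) subr0 => hb.
have [->|/eqP ne] := eqVneq (beta ord0 (t * a j)) 0; first by rewrite mul0r.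
case/eqP: j0; apply: (tc_d hc); apply: (cone_pointed hI); last exact: (tc_cone hc).
by apply: (tcB_cone hc (tc_betaB hc ord0 (t * a j))); rewrite hb.
Qed.

Let Z : grmod := quot_by U F.

(** The layer is a direct summand of a free [T]-module: it is the component of
    [B] of degree [v - w], and [B] is projective over [T]. *)
Lemma layer_projective : @is_projective K D (wspace hc v Z).
Proof.
have wg := wtP.1.
pose FT := freeobj (wt_trivP TT) (fun _ : 'I_q => 0).
pose ifun (c : wspace hc v F) : FT :=
  [ffun i => vsproj T (gam i (beta ord0 (fcoef (wsval v F c))))] : {ffun 'I_q -> TT^o}.
have ifunL : linear ifun.
  move=> t c c'; apply/ffunP => i; rewrite [LHS]ffunE [in RHS]ffunE.
  rewrite wsvalD wsvalZ fcoefD fcoefZ (betaD hc) beta0_T ?subvsP //.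
  rewrite (tc_gamL hc) ?subvsP ?(tc_betaB hc) // linearD.
  rewrite ![in RHS]ffunE; congr (_ + _).
  have gT x := tc_gamT hc i x.
  have tT := subvsP t.
  by apply: subvs_inj; rewrite /GRing.scale /= !vsprojK ?memvM.
have [i0 i0E] := tmod_hom ifunL.
pose hg := gen_by_gsub U F.
have projs : onto (fmap (pi v) _ _ (quot_proj hg)).
  move=> u; have [c cE] := quot_proj_surj hg (wsval v Z u).
  by exists (wsmk hc v c); apply: wsval_inj; rewrite ap_pi wsmkK ap_gpr cE wsvalK.
have [|i /ap_comp_eq iE] := hom_colift (g := i0) projs.
  move=> c /(congr1 (wsval v Z)); rewrite ap_pi wsval0 => /(quot_proj_eq0 hg).
  move/(layer_gen (wsvalK c)) => e; rewrite i0E; apply/ffunP => k; rewrite !ffunE e.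
  have -> : gam k 0 = 0.
    have := tc_gamL hc k (tcT1 hc) (mem0v B) (mem0v B).
    by rewrite mulr0 addr0 mul1r => e0; apply: (addrI (gam k 0)); rewrite -e0 addr0.
  exact: linear0.
have [r rE] := @free_hom _ _ _ _ (wt_trivP TT) _ (fun _ : 'I_q => 0) (wspace hc v Z)
  (fun k => wsmk hc v (ap (quot_proj hg) (free_elt (wt (v - w) (p k))))) (fun k => erefl).
refine (projective_retract (i := i) (r :=
  r) _ (@free_projective _ _ _ _ (wt_trivP TT) _ (fun _ : 'I_q => 0))).
apply: hom_ext => u; have [c <-] := projs u; rewrite ap_comp iE rE.
apply: wsval_inj; rewrite ap_id i0E ap_pi.
set b := beta ord0 (fcoef (wsval v F c)).
have hb : homog wt (v - w) b := layer_deg (wsvalK c).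
have bB : b \in B := tc_betaB hc _ _.
have sumE (G : 'I_q -> wspace hc v Z) : wsval v Z (\sum_k G k) = \sum_k wsval v Z (G k).
  by apply: (big_morph (wsval v Z)); [apply: wsvalD|apply: wsval0].
rewrite sumE.
transitivity (ap (quot_proj hg) (free_elt b)).
  rewrite -[in RHS]hb [in RHS](tc_gam hc bB) (pr_sum wg) free_elt_sum ap_sum.
  apply: eq_bigr => k _.
  rewrite wsvalZ wsmkK -ap_gpr -{1}[v](subrK w) (free_elt_deg (pr_homog wg _ _))
    -apZ -free_eltM.
  rewrite ffunE vsprojK ?(tc_gamT hc) //.
  by rewrite (wt_mull wtP _ _ (tcT0 hc (tc_gamT hc k _))) subr0.
apply/esym/eqP; rewrite -subr_eq0 -apB; apply/eqP/(quot_proj_eq0 hg).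
exact: (layer_rest (wsvalK c)).
Qed.

(** Modulo [gen_by U] an element of degree [v] is its coordinate at [ord0], and
    elements of [B] are independent over the [a j]. *)
Lemma layer_free : free_layer v Z.
Proof.
pose hg := gen_by_gsub U F; have wg := wtP.1.
split; [exact: layer_projective| |exact: quot_by_no_above].
move=> z zv zs.
have /choice[c cP] : forall j, exists c : F, gpr v c = c /\ ap (quot_proj hg) c = z j.
  move=> j; have [c cE] := quot_proj_surj hg (z j); exists (gpr v c).
  by rewrite gprK eqxx ap_gpr cE zv.
pose b j := beta ord0 (fcoef (c j)).
have bB j : b j \in B := tc_betaB hc _ _.
have h1 : gen_by U (\sum_j a j *: c j).
  apply/(quot_proj_eq0 hg); rewrite ap_sum -[RHS]zs; apply: eq_bigr => j _.
  by rewrite apZ (cP j).2.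
have h2 : gen_by U (\sum_j a j *: (c j - free_elt (b j))).
  by apply: (gsub_sum hg) => j _; apply: (gsubZ hg); apply: layer_rest; exact: (cP j).1.
have h3 : gen_by U (free_elt (\sum_j a j * b j)).
  have -> : free_elt (\sum_j a j * b j) = \sum_j a j *: c j - \sum_j a j *: (c j -
    free_elt (b j)).
    rewrite free_elt_sum -sumrB; apply: eq_bigr => j _.
    by rewrite scalerBr subKr free_eltM.
  exact: (gsubB hg h1 h2).
move=> j; rewrite -(cP j).2; apply/(quot_proj_eq0 hg)/(layer_gen (cP j).1).
have /gen_by_coef/(_ j (v - w)) := h3; rewrite free_eltK (tc_beta_uniq hc) //.
by rewrite subrK => <- //; apply/esym; apply: layer_deg; exact: (cP j).1.
Qed.

End FreeLayer.

(** ** Filtrations of summands of free modules *)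

Section Filtration.
Variables (w : X) (M : grmod) (Fl : C -> Prop).
Hypothesis Flayer : forall v N, plt w v -> @is_projective K D N -> filtered Fl (delta v N).

(** The layer is the image of the standard module of the weight space of degree
    [v], so the new submodule is an extension of that by the old one. *)
Lemma gen_by_step (U U1 : X -> Prop) v :
  plt w v -> U v -> (forall u, U1 u -> U u) ->
  (forall u (x : M), U u -> gpr u x = x -> x <> 0 -> U1 u \/ u = v) ->
  free_layer v (quot_by U1 M) ->
  filtered Fl (subobj (gen_by_gsub U1 M)) -> filtered Fl (subobj (gen_by_gsub U M)).
Proof.
move=> wv Uv U1U Usplit [pZ fZ nZ] F1.
pose Z := quot_by U1 M; pose hg1 := gen_by_gsub U1 M; pose hg := gen_by_gsub U M.
have [e eE] := delta_hom hI wtP (idm (wspace hc v Z : D)) nZ.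
have et := delta_hom_tau eE.
have ei : injective (ap e).
  apply: ap_inj0 => h; rewrite eE => h0; apply: dcomp_ext => j; rewrite dcomp0.
  apply: wsval_inj; rewrite wsval0.
  exact: (fZ (fun j => wsval v Z (dcomp h j)) (fun j => wsvalK _) h0 j).
have U1sub (x : M) : gen_by U1 x -> gen_by U x.
  by move=> h; refine (h _ hg _) => u y /U1U Uu; apply: gen_by_deg Uu.
have [|i /ap_comp_eq iE] := hom_lift (g := sub_incl hg1) (sub_incl_inj hg).
  by move=> t; exact: ((sub_inclP hg _).2 (U1sub _ ((sub_inclP hg1 _).1 (ex_intro _
    t erefl)))).
have img (x : M) : gen_by U x -> exists h, ap e h = ap (quot_proj hg1) x.
  move=> /(_ _ (gsub_preim (quot_proj hg1) (gimg_gsub e))); apply=> u y Uu uy.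
  have [->|/eqP ny] := eqVneq y 0; first by exists 0; rewrite !ap0.
  have [U1u|uv] := Usplit u y Uu uy ny.
    exists 0; rewrite ap0; apply/esym/(quot_proj_eq0 hg1).
    exact: gen_by_deg U1u uy.
  exists (tau _ 1 (wsmk hc v (ap (quot_proj hg1) y))).
  by rewrite et ap_id wsmkK -ap_gpr -uv uy.
have [|g /ap_comp_eq gE] := hom_lift (g := quot_proj hg1 \oc sub_incl hg) ei.
  by move=> t; exact: (img _ ((sub_inclP hg _).1 (ex_intro _ t erefl))).
apply: (filtered_ext (f := i) (g := g)) (Flayer wv pZ) => //; split.
- by move=> s t st; apply: (sub_incl_inj hg1); rewrite -!iE st.
- move=> h.
  have /choice[c cP] : forall j, exists c : M, gpr v c = c /\
      ap (quot_proj hg1) c = wsval v Z (dcomp h j).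
    move=> j; have [c cE] := quot_proj_surj hg1 (wsval v Z (dcomp h j)).
    by exists (gpr v c); rewrite gprK eqxx ap_gpr cE wsvalK.
  have /(sub_inclP hg)[t tE] : gen_by U (\sum_j a j *: c j).
    by apply: (gsub_sum hg) => j _; apply: (gsubZ hg); apply: (gen_by_deg Uv);
      exact: (cP j).1.
  exists t; apply: ei; rewrite gE ap_comp tE eE ap_sum; apply: eq_bigr => j _.
  by rewrite apZ (cP j).2.
move=> t; split=> [g0|[s <-]].
  have /(quot_proj_eq0 hg1)/(sub_inclP hg1)[s sE] : ap (quot_proj hg1) (ap (sub_incl
    hg) t) = 0.
    by rewrite -ap_comp -gE g0 ap0.
  by exists s; apply: (sub_incl_inj hg); rewrite iE.
apply: ei; rewrite gE ap0 ap_comp iE; apply/(quot_proj_eq0 hg1)/(sub_inclP hg1).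
by exists s.
Qed.

Variables (i : Hom M (freeobj wtP (fun _ : 'I_1 => w)))
  (r : Hom (freeobj wtP (fun _ : 'I_1 => w)) M).
Hypothesis ri : r \oc i = idm (M : C).

(** Induction on the number of degrees of [M] in [U]: removing from [U] all
    degrees below a degree [v] of minimal height removes one layer. *)
Lemma gen_by_filtered (U : X -> Prop) :
  (forall u u', U u -> cone I (u' - u) -> U u') -> (forall u, U u -> plt w u) ->
  filtered Fl (subobj (gen_by_gsub U M)).
Proof.
have [ht [htB htpos]] := height_exists hI.
have [s us hs] := gpr_unif M.
have out u (x : M) : gpr u x = x -> x <> 0 -> u \in s.
  move=> ux nx; apply: contrapT => /negP nu; apply: nx; rewrite -ux.
  exact: (supp_out (gprP M) us (hs x) nu).
have [k] := ubnP (count (fun u => `[< U u >]) s).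
elim: k U => // k IH U; rewrite ltnS => le Uup Ugt.
pose hg := gen_by_gsub U M.
have [ex|nex] := pselect (exists2 u, u \in s & U u); last first.
  apply: Filtered0; apply/zeroP => t; apply: (sub_incl_inj hg); rewrite ap0.
  have /(_ _ (gsub_zero M)) := (sub_inclP hg (ap (sub_incl hg) t)).1 (ex_intro _ t erefl).
  apply=> u x Uu ux; apply: contrapT => nx; apply: nex; exists u => //.
  exact: out ux nx.
have [v [vs Uv vmin]] := @seq_max _ s (fun u => - ht u) U ex.
pose U1 u := U u /\ ~ cone I (v - u).
have U1up u u' : U1 u -> cone I (u' - u) -> U1 u'.
  move=> [Uu nu] c; split; first exact: Uup Uu c.
  by move=> c'; apply: nu; apply: cone_trans c c'.
have F1 : filtered Fl (subobj (gen_by_gsub U1 M)).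
  apply: IH => // [|u []]; last by move=> Uu _; apply: Ugt.
  apply: leq_trans le; apply: (count_lt vs); first exact/asboolP.
    by apply/asboolPn => -[_]; apply; rewrite subrr; exists (fun=> 0%N); rewrite big1.
  by move=> u /asboolP[Uu _]; apply/asboolP.
apply: (gen_by_step (v := v)) F1 => //.
- exact: Ugt.
- by move=> u [].
- move=> u x Uu ux nx.
  have [c|nc] := pselect (cone I (v - u)); [right|by left].
  apply/eqP; rewrite eq_sym -subr_eq0; apply/negP => /negP/eqP/(htpos _ c).
  by rewrite htB subr_gt0 ltNge -lerN2 vmin // (out u x).
have [i' [r' r'i']] := quot_by_retract U1 ri.
apply: free_layer_retract r'i' _; apply: layer_free => //.
  by move=> [_]; apply; rewrite subrr; exists (fun=> 0%N); rewrite big1.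
move=> u [cu vu]; split; first exact: Uup Uv cu.
by move=> c; apply: vu; apply: (cone_anti hI).
Qed.

End Filtration.
End Layers.
(** * Projective covers of simple objects *)

Section Stratified.
Context {K : fieldType} {X : zmodType} {A : falgType K} {wt : X -> A -> A}.
Context {n : nat} {I : 'I_n -> X}.
Hypothesis hI : is_Zbasis I.
Hypothesis wtP : is_alg_grading wt.
Context {T : {aspace A}} {B : {vspace A}} {m : nat}.
Context {a : 'I_m.+1 -> A} {d : 'I_m.+1 -> X} {beta : 'I_m.+1 -> A -> A}.
Context {q : nat} {p : 'I_q -> A} {gam : 'I_q -> A -> A}.
Hypothesis hc : tri_coords wt I T B a d beta p gam.
Notation TT := (subvs_of T).
Notation grmod := (grmod wt).
Notation C := (grmodcat wt).
Notation Hom M N := (@hom K (grmodcat wt) M N).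
Notation D := (grmodcat (@wt_triv K TT)).
Notation THom M N := (@hom K (grmodcat (@wt_triv K TT)) M N).
Notation tmodule := (Defs.grmod (@wt_triv K TT)).
Notation J := 'I_m.+1.
Notation delta := (delta hI wtP hc).
Notation Delta := (Delta hI wtP hc).
Notation tau N := (@tau K X A wt n I hI wtP T B m a d beta q p gam hc N).
Notation eta := (eta hI wtP hc).
Notation pi := (pi hc).
Notation plt := (@plt (cone_poset hI)).
Notation wsval w M := (@wsval _ _ _ _ _ _ _ _ _ _ _ _ _ _ _ hc w M).
Context {IrrT : Type} {S : IrrT -> lmodType TT} (hS : mod_irr S).
Notation L := (simple_obj hI wtP hc hS).

Lemma simple_tmod (Z : tmodule) : @is_simple K D Z -> mod_simple (gcar Z).
Proof.
move=> /simpleP[nz h]; apply/mod_simpleP; split=> // v v' nv.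
have hP : gsub (fun u : Z => exists t : TT, u = t *: v).
  split=> [|c _ _ [s ->] [t ->]|x _ [t ->]]; first by exists 0; rewrite scale0r.
    by exists (c * s + t); rewrite scalerDl scalerA.
  by exists t; rewrite triv_gpr.
by have [z|all] := h _ hP; [case: nv; apply: z; exists 1; rewrite scale1r|apply: all].
Qed.

(** ** Finiteness of the set of labels *)

Lemma simple_hom_iso (M N : tmodule) (f : THom M N) :
  @is_simple K D M -> @is_simple K D N -> (exists v, ap f v <> 0) -> is_iso f.
Proof.
move=> /simpleP[_ hM] /simpleP[_ hN] [v nv]; apply/isoP; split.
  by apply: ap_inj0; have [//|all] := hM _ (gker_gsub f); case: nv; apply: all.
by have [z|//] := hN _ (gimg_gsub f); case: nv; apply: z; exists v.
Qed.

(** A map to a simple object that is nonzero is nonzero on some factor of the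
    filtration, and identifies this factor with the target. *)
Lemma filtered_quotients (M : D) : filtered (@is_simple K D) M ->
  exists k (e : nat -> D), forall (N : tmodule) (f : THom M N), @is_simple K D N ->
    (exists v, ap f v <> 0) -> exists2 i, (i < k)%N & @isomorphic K D N (e i).
Proof.
elim=> [x /zeroP z|x y z f g /exactP[fi gs fg] _ [k [e he]] sz].
  by exists 0%N, (fun=> x) => N f _ [v]; rewrite (z v) ap0.
exists k.+1, (fun i => if i is i'.+1 then e i' else z) => N h sN [v nv].
have [[u nu]|all] := pselect (exists u, ap (h \oc f) u <> 0).
  by have [i ik iy] := he N (h \oc f) sN (ex_intro _ u nu); exists i.+1.
have [|h' /ap_comp_eq h'E] := hom_colift (g := h) gs.
  move=> s /fg[u <-]; apply: contrapT => nu; apply: all; exists u.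
  by rewrite ap_comp.
exists 0%N => //; apply: iso_sym; exists h'; apply: simple_hom_iso => //.
by exists (ap g v); rewrite h'E.
Qed.

(** Every simple module is a quotient of [T], which has finite length. *)
Lemma irr_finite : exists k (e : 'I_k -> IrrT -> Prop),
  (forall lam, exists i, e i lam) /\ forall i lam mu, e i lam -> e i mu -> lam = mu.
Proof.
pose F := freeobj (wt_trivP TT) (fun _ : 'I_1 => 0).
have [k [e he]] := filtered_quotients (@grmodcat_finite_length _ _ _ (@wt_triv K TT) F).
exists k, (fun i lam => @isomorphic K D (tS hS lam) (e i)); split=> [lam|i lam mu h1 h2].
  have sS := S_simple hS lam; have /mod_simpleP[[v nv] h] := sS.
  have sD : @is_simple K D (tS hS lam).
    apply/simpleP; split; first by exists v.
    move=> P hP; have [[u [Pu nu]]|no] := pselect (exists u, P u /\ u <> 0).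
      by right=> u'; have [t ->] := h u u' nu; apply: (gsubZ hP).
    by left=> u Pu; apply: contrapT => nu; apply: no; exists u.
  have [f fE] := @free_hom _ _ _ _ (wt_trivP TT) _ (fun _ : 'I_1 => 0) (tS hS lam)
    (fun _ => v) (fun k => erefl).
  have [|i ik iy] := he (tS hS lam) f sD.
    by exists (fgen (ord0 : 'I_1)); rewrite (free_hom_gen fE).
  by exists (Ordinal ik).
case: (hS) => _ inj _; apply: inj.
have [f fi] := iso_trans h1 (iso_sym h2).
exact: (iso_mod_iso fi).
Qed.

Lemma labels_finite (x : X) : finite_set [set l : IrrT * X | l.2 = x]%classic.
Proof.
have [k [e [ex uni]]] := irr_finite.
have [[lam0 _]|no] := pselect (exists lam : IrrT, True); last first.
  suff -> : [set l : IrrT * X | l.2 = x]%classic = classical_sets.set0 by [].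
  by apply/seteqP; split=> // -[lam y] _; apply: no; exists lam.
have /choice[g gP] : forall i, exists lam, (exists mu, e i mu) -> e i lam.
  move=> i; have [[mu h]|h] := pselect (exists mu, e i mu); first by exists mu.
  by exists lam0.
refine (@sub_finite_set (IrrT * X)%type _ (range (fun i : 'I_k => (g i, x))) _ _).
  move=> [lam y] /= ->; have [i ei] := ex lam; exists i => //; congr pair.
  by apply: (uni i) => //; apply: gP; exists lam.
by apply: finite_image; apply: finite_finset.
Qed.

(** ** Filtrations of standard modules of projective [T]-modules *)

Variables (Q : IrrT * X -> D) (qc : forall l, @hom K D (Q l) (wspace hc l.2 (L l))).
Hypothesis qcP : forall l, is_proj_cover (qc l).

(** A simple quotient of [N] is covered by some [Q (lam, v)], which therefore
    splits off; the complement is projective of smaller dimension. *)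
Lemma proj_filtered v (N : D) : is_projective N ->
  filtered (fun y : D => exists lam, y = Q (lam, v)) N.
Proof.
have [k] := ubnP (gdim N); elim: k N => // k IH N; rewrite ltnS => le pN.
have [nz|z] := pselect (exists u : (N : tmodule), u <> 0); last first.
  apply: Filtered0; apply/zeroP => u; apply: contrapT => nu; apply: z; by exists u.
have [P [hP sP]] := max_gsub nz.
have [lam lamE] : exists lam, mod_iso (gcar (quotobj hP)) (S lam).
  by case: (hS) => _ _; apply; apply: simple_tmod.
have [f fi] := @mod_iso_hom _ _ _ (quotobj hP) (tS hS lam) lamE.
have [g gi] := simple_obj_ws hI wtP hc hS lam v.
have [pQ qe qess] := qcP (lam, v).
have /isoP[_ gfs] : is_iso (g \oc f) := iso_comp gi fi.
have [s sE] := pN _ _ (qc (lam, v)) ((g \oc f) \oc quot_proj hP) qe.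
have ss : onto s.
  apply/epiP/qess/epiP; rewrite sE => u.
  have [u' <-] := gfs u; have [u'' <-] := quot_proj_surj hP u'.
  by exists u''.
have [t tE] := pQ _ _ s (idm _) ((epiP s).2 ss).
pose hk := gker_gsub s.
have ex : sexact (sub_incl hk) s.
  by split=> [||u]; [exact: sub_incl_inj|exact: ss|rewrite sub_inclP].
apply: (FilteredS ((exactP _ _).2 ex)); last by exists lam.
have stE u : ap s (ap t u) = u := ap_comp_eq tE u.
apply: IH.
  have [le' eq] := gsub_dim_le hk.
  apply: leq_trans le; rewrite ltn_neqAle le' andbT; apply/eqP => /eq all.
  have [v' [nv' hv']] := simple_obj_nz hI wtP hc hS lam v; apply: nv'.
  have [u uE] := (epiP _).1 qe (wsmk hc v v').
  by rewrite -hv' -(wsmkK hc v v') -uE -(stE u) all ap0 wsval0.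
(* The projection onto the kernel of [s]. *)
pose e : THom N N := idm N + (-1) *: (t \oc s).
have eE u : ap e u = u - ap t (ap s u).
  by rewrite /e ap_add ap_scale scaleN1r scaleN1r.
have [|r /ap_comp_eq rE] := hom_lift (g := e) (sub_incl_inj hk).
  by move=> u; apply/(sub_inclP hk); rewrite eE apB stE subrr.
apply: (projective_retract (i := sub_incl hk) (r := r)) pN.
apply: hom_ext => u; apply: (sub_incl_inj hk); rewrite ap_comp rE eE.
have -> : ap s (ap (sub_incl hk) u) = 0 by apply/(sub_inclP hk); exists u.
by rewrite ap0 subr0.
Qed.

Lemma Delta_filtered (F : D -> Prop) (F' : C -> Prop) v (N : D) :
  (forall y, F y -> F' (Delta v y)) -> filtered F N -> filtered F' (Delta v N).
Proof.
move=> FF'; elim=> [x /zeroP z|x y z f g e _ IH Fz].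
  by apply: Filtered0; apply/zeroP => h; apply: dcomp_ext => j;
    rewrite dcomp0 (z (dcomp h j)).
by apply: (FilteredS (Delta_exact hI wtP hc v e)) IH (FF' _ Fz).
Qed.

Definition above (l : IrrT * X) (y : C) : Prop :=
  exists l', plt l.2 l'.2 /\ isomorphic y (Delta l'.2 (Q l')).

Lemma layer_filtered l v (N : D) : plt l.2 v -> is_projective N ->
  filtered (above l) (Delta v N).
Proof.
move=> lv pN; apply: Delta_filtered (proj_filtered v pN) => _ [lam ->].
exists (lam, v); split=> //; exists (idm _); exists (idm _).
by rewrite !comp1m.
Qed.

(** ** The projective cover of a simple object and its standard quotient *)

Section Cover.
Variables (l : IrrT * X) (P : C) (pc : hom P (L l)).
Hypothesis pcP : is_proj_cover pc.
Let w : X := l.2.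
Let F : grmod := freeobj wtP (fun _ : 'I_1 => w).

Lemma L_simple : @is_simple K C (L l). Proof. exact: simple_obj_simple. Qed.

Lemma L_below : supp_in (below (I := I) w) (L l).
Proof. by rewrite /w; case: l => lam v; apply: simple_obj_below. Qed.

Lemma L_nz : exists v : (L l : grmod), v <> 0 /\ gpr w v = v.
Proof. by rewrite /w; case: l => lam v; apply: simple_obj_nz. Qed.

(** The free module of rank one generated in degree [w] maps onto [P], because it
    maps onto [L] and [P] covers [L] minimally. *)
Lemma cover_retract : exists (i : Hom P F) (r : Hom F P),
  r \oc i = idm P /\ onto r.
Proof.
have [pP /epiP pe pess] := pcP.
have [v [nv hv]] := L_nz.
have [f fE] := @free_hom _ _ _ _ wtP _ (fun _ : 'I_1 => w) (L l) (fun _ => v) (fun _ => hv).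
have fs : onto f.
  move=> u; have [x ->] := simple_ws wtP L_simple (below_no_above hI L_below) nv hv u.
  exists ([ffun _ => x] : {ffun 'I_1 -> A^o}); rewrite fE big_ord1.
  by rewrite ffunE.
have [r rE] := @free_projective _ _ _ _ wtP _ (fun _ : 'I_1 => w) _ _ pc f ((epiP pc).2 pe).
have rs : onto r by apply/epiP/pess/epiP; rewrite rE.
have [i iE] := pP _ _ r (idm P) ((epiP r).2 rs).
by exists i, r.
Qed.

(** The map adjoint to [Q -> L_w] is again essential, because the standard module
    is generated in degree [w]. *)
Lemma std_to_simple : exists e : Hom (delta w (Q l)) (L l),
  [/\ onto e, forall u, ap e (tau _ 1 u) = wsval w (L l) (ap (qc l) u)
    & forall W (g : Hom W (delta w (Q l))), onto (e \oc g) -> onto g].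
Proof.
have [pQ qe qess] := qcP l; have qs := (epiP _).1 qe.
have [e eE] := delta_hom hI wtP (qc l) (below_no_above hI L_below).
have et := delta_hom_tau eE.
exists e; split=> //.
  have /simpleP[_ h] := L_simple; have [z|//] := h _ (gimg_gsub e).
  have [v [nv hv]] := L_nz; case: nv; apply: z.
  have [u uE] := qs (wsmk hc w v); exists (tau _ 1 u).
  by rewrite et uE wsmkK.
move=> W g gs.
have [ei [ei1 ei2]] := eta_iso hI wtP hc w (Q l).
have eki u : ap (eta w (Q l)) (ap ei u) = u := ap_comp_eq ei2 u.
have Ws : onto (ei \oc fmap (pi w) _ _ g).
  apply/epiP/qess/epiP => u.
  have [x xE] := gs (wsval w (L l) u).
  exists (wsmk hc w x); apply: wsval_inj.
  rewrite !ap_comp -et -(etaE hI wtP hc) eki ap_pi wsmkK -ap_comp ap_gpr xE.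
  exact: wsvalK.
move=> h; apply: (@delta_generated _ _ _ _ _ _ hI wtP _ _ _ _ _ _ _ _ _ hc w (Q l) _
  (gimg_gsub g)).
move=> x xw; rewrite (delta_ws xw); have [u uE] := Ws (dcomp x ord0).
exists (wsval w W u); rewrite -ap_pi -uE ap_comp -(etaE hI wtP hc).
by rewrite eki.
Qed.

(** The quotient [Z] of [P] by the degrees [> w] and the standard module map onto
    each other over [L], so [fb : Z -> Delta] is an isomorphism and the kernel
    of [f] is the submodule generated by the degrees [> w]. *)
Lemma cover_filtration : exists (f : hom P (Delta w (Q l))) (k : C) (i : hom k P),
  [/\ is_epi f, is_kernel i f & filtered (above l) k].
Proof.
have [pP /epiP pe pess] := pcP.
have [i0 [r0 [ri rs]]] := cover_retract.
have [e [es et eess]] := std_to_simple.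
have [f fE] := pP _ _ (e : @hom K C _ _) pc ((epiP e).2 es).
have fs : onto f by apply: eess; rewrite fE.
pose U u := plt w u.
have Uup u u' : U u -> cone I (u' - u) -> U u'.
  move=> [c ne] c'; split; first exact: cone_trans c c'.
  by move=> wu; subst u'; apply: ne; apply: (cone_anti hI).
pose hg := gen_by_gsub U P.
have kill (M : grmod) (g : Hom P M) : no_above (I :=
  I) w M -> forall v, gen_by U v -> ap g v = 0.
  move=> na v h; apply: (h _ (gker_gsub g)) => u x [c wu] ux.
  by rewrite -ux ap_gpr na // => uw; apply: wu.
have naD := below_no_above hI (delta_below (hI := hI) (wtP := wtP) (hc :=
  hc) (w := w) (N := Q l)).
have naL := below_no_above hI L_below.
have naZ : no_above (I := I) w (quot_by U P) by apply: quot_by_no_above.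
have projs := quot_proj_surj hg.
have [|fb /ap_comp_eq fbE] := hom_colift (g := f) projs.
  by move=> v /(quot_proj_eq0 hg); apply: kill.
have [|pb /ap_comp_eq pbE] := hom_colift (g := pc) projs.
  by move=> v /(quot_proj_eq0 hg); apply: kill.
have pbs : onto (fmap (pi w) _ _ pb).
  move=> u; have [v vE] := pe (wsval w (L l) u).
  exists (wsmk hc w (ap (quot_proj hg) v)); apply: wsval_inj.
  by rewrite ap_pi wsmkK ap_gpr pbE vE wsvalK.
have [pQ qe qess] := qcP l.
have [s sE] := pQ _ _ _ (qc l) ((epiP _).2 pbs).
have [S' S'E] := delta_hom hI wtP s naZ.
have S't := delta_hom_tau S'E.
have pS : pb \oc S' = e.
  apply: delta_hom_ext => u; rewrite ap_comp S't et -ap_pi.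
  by rewrite (ap_comp_eq sE).
have S's : onto S'.
  (* The elements of [P] whose class is in the image of [S'] still map onto [L]. *)
  pose hR := gsub_preim (quot_proj hg) (gimg_gsub S').
  have Rs : onto (sub_incl hR).
    apply/epiP/pess/epiP => u; have [h hE] := es u.
    have [v vE] := projs (ap S' h).
    have [t tE] : exists t, ap (sub_incl hR) t = v.
      by apply/(sub_inclP hR); exists h.
    by exists t; rewrite ap_comp tE -pbE vE (ap_comp_eq pS).
  move=> z; have [v <-] := projs z.
  exact/(sub_inclP hR)/Rs.
have fbs : onto fb by move=> h; have [v <-] := fs h; exists (ap (quot_proj hg) v).
have [le1 _] := ap_surj_dim S's; have [le2 inj] := ap_surj_dim fbs.
have fbi : injective (ap fb) by apply: inj; apply/eqP; rewrite eqn_leq le1 le2.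
exists f, (subobj hg), (sub_incl hg); split.
- exact/epiP.
- apply/kernelP; split=> [|v]; first exact: sub_incl_inj.
  rewrite sub_inclP -fbE; split=> [e0|h].
    by apply/(quot_proj_eq0 hg); apply: fbi; rewrite e0 ap0.
  by rewrite fbE; apply: kill h.
refine (@gen_by_filtered _ _ _ _ _ _ hI wtP _ _ _ _ _ _ _ _ _ hc w P (above l) _ i0
  r0 ri U Uup _) => //.
by move=> v N wv pN; apply: layer_filtered.
Qed.

End Cover.
End Stratified.


Theorem theorem4p14 (K : fieldType) (A : falgType K)
    (n : nat) (X : zmodType) (I : 'I_n -> X) (hI : is_Zbasis I)
    (wt : X -> A -> A) (htorus : is_split_torus wt)
    (Am T Ap : {aspace A}) (htri : triangular_decomp wt I Am T Ap)
    (IrrT : Type) (S : IrrT -> lmodType (subvs_of T)) (hS : mod_irr S) :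
  exists L : IrrT * X -> grmodcat wt,
    (forall (lam : IrrT) (w : X),
       is_simple_head Ap (S lam) w (L (lam, w))) /\
    @standardly_stratified K (grmodcat wt) (IrrT * X)%type L
      (cone_poset hI) (fun l : IrrT * X => l.2).

Proof.
have wtP : is_alg_grading wt by case: htorus.
have [m [a [d [beta [q [p [gam hc]]]]]]] := tri_coords_exist wtP htri.
exists (simple_obj hI wtP hc hS).
split=> [lam w|]; first exact: simple_obj_head.
have [M0 _] : exists M0 : grmod wt, True by exists (freeobj wtP (fun _ : 'I_1 => 0)).
split.
- exact: grmodcat_abelian M0.
- exact: grmodcat_finite_length.
- exact: grmodcat_enough_proj wtP.
- split; [exact: simple_obj_simple|exact: simple_obj_inj|].
  exact: simple_classification.
- exact: (simple_abs hI wtP hc (td_split htri)).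
- by move=> x; apply: (labels_finite (S := S)) x.
- exact: (interval_finite hI).
pose cov l := cid (grmodcat_proj_cover wtP (simple_obj hI wtP hc hS l)).
pose cov' l := cid (svalP (cov l)).
pose tcov (l : IrrT * X) :=
  cid (grmodcat_proj_cover (wt_trivP _) (wspace hc l.2 (simple_obj hI wtP hc hS l))).
pose tcov' l := cid (svalP (tcov l)).
exists (fun w => weight_stratum hI wtP hc hS w), (fun l => sval (cov l)),
  (fun l => sval (cov' l)), (fun l => sval (tcov l)), (fun l => sval (tcov' l)).
split=> [l|l|l]; [exact: (svalP (cov' l))|exact: (svalP (tcov' l))|].
exact: (cover_filtration (fun l => svalP (tcov' l)) (svalP (cov' l))).
Qed.
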